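(* Let $\mathcal{F}$ be a graph family admitting strongly sublinear separators. Then there is a function $f_{\mathcal{F}}:\mathbb{N}\to\mathbb{R}_{\ge 0}$ with $f_{\mathcal{F}}(n)\to 0$ as $n\to\infty$ such that for every $H\in\mathcal{F}$ with $\chi(H)\le 4$ and $\mathsf{v}(H)\ge 2$, $$(1-f_{\mathcal{F}}(\mathsf{v}(H)))\max\left\{\frac{\mathsf{v}(H)}{2},\tau(H)\right\}\le c(H)\le (1+f_{\mathcal{F}}(\mathsf{v}(H)))\max\left\{\frac{\mathsf{v}(H)}{2},\tau(H)\right\},$$ i.e. $c(H)=(1+o_{\mathcal{F}}(1))\max\{\mathsf{v}(H)/2,\tau(H)\}$ where the error term depends only on $\mathcal{F}$ and tends to $0$ as $\mathsf{v}(H)\to\infty$.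
   Context: All graphs are finite and simple. $\mathsf{v}(G)$ and $\mathsf{e}(G)$ denote the numbers of vertices and edges, and the density of a non-null graph is $\mathsf{d}(G)=\mathsf{e}(G)/\mathsf{v}(G)$. For a graph $H$ with $\mathsf{v}(H)\ge 2$, the extremal function $c(H)$ is the supremum of $\mathsf{d}(G)$ over all non-null graphs $G$ not containing $H$ as a minor. $\tau(H)$ is the minimum size of a vertex cover of $H$ (so $\tau(H)=\mathsf{v}(H)-\alpha(H)$), and $\chi(H)$ is the chromatic number. A separation of $G$ is a pair $(A_1,A_2)$ of subsets of $V(G)$ with $G=G[A_1]\cup G[A_2]$, $A_1\setminus A_2\ne\emptyset$, $A_2\setminus A_1\neq\emptyset$; its order is $|A_1\cap A_2|$; it is balanced if $|A_1|,|A_2|\ge \mathsf{v}(G)/3$. A graph family $\mathcal{F}$ admits strongly sublinear separators if it is closed under taking subgraphs and there exist $\beta<1$ and $c>0$ such that every $G\in\mathcal{F}$ has a balanced separation of order at most $c\,\mathsf{v}(G)^\beta$. *)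

(* Defs.v *)
From mathcomp Require Import all_boot all_order all_algebra.
From mathcomp Require Import all_classical all_reals all_analysis.
Import Order.TTheory GRing.Theory Num.Theory.
Import numFieldNormedType.Exports.

Set Implicit Arguments.
Unset Strict Implicit.
Unset Printing Implicit Defensive.

Local Open Scope ring_scope.

Structure sgraph := SGraph {
  vertex :> finType;
  edge : rel vertex;
  edge_sym : symmetric edge;
  edge_irr : irreflexive edge }.

Definition nb_vertices (G : sgraph) : nat := #|G|.

Definition edges (G : sgraph) : {set {set G}} :=
  [set [set p.1; p.2]%SET | p : G * G & edge p.1 p.2]%SET.

Definition nb_edges (G : sgraph) : nat := #|edges G|.

Definition density (R : realType) (G : sgraph) : R :=
  (nb_edges G)%:R / (nb_vertices G)%:R.

Definition vertex_cover (G : sgraph) (C : {set G}) : bool :=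
  [forall x, forall y, edge x y ==> (x \in C) || (y \in C)].

Lemma vertex_cover_ex (G : sgraph) :
  exists k, [exists C : {set G}, vertex_cover C && (#|C| == k)].
Proof.
exists #|[set: G]%SET|; apply/existsP; exists [set: G]%SET; rewrite eqxx andbT.
by apply/forallP => x; apply/forallP => y; rewrite finset.in_setT implybT.
Qed.

Definition vertex_cover_number (G : sgraph) : nat := ex_minn (vertex_cover_ex G).

Definition colorable (G : sgraph) (k : nat) : bool :=
  [exists f : {ffun G -> 'I_k},
     [forall x, forall y, edge x y ==> (f x != f y)]].

Lemma colorable_ex (G : sgraph) : exists k, colorable G k.
Proof.
exists #|G|; apply/existsP; exists [ffun x => enum_rank x].
apply/forallP => x; apply/forallP => y; apply/implyP => xy.
rewrite !ffunE (inj_eq enum_rank_inj); apply/eqP => eq_xy.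
by move: xy; rewrite eq_xy edge_irr.
Qed.

Definition chromatic_number (G : sgraph) : nat := ex_minn (colorable_ex G).

(* The empty set counts as connected here; [minor] asks for nonemptiness. *)
Definition connected_in (G : sgraph) (A : {set G}) : Prop :=
  {in A &, forall x y,
    connect [rel u v | [&& u \in A, v \in A & edge u v]] x y}.

(* [minor H G]: G has an H-model, that is, H is isomorphic to a graph obtained
   from a subgraph of G by contracting each branch set [B x] to a vertex. *)
Definition minor (H G : sgraph) : Prop :=
  exists B : H -> {set G},
    [/\ forall x, B x != finset.set0 /\ connected_in (B x),
        forall x y, x != y -> [disjoint B x & B y]
      & forall x y, edge x y ->
          exists u v, [/\ u \in B x, v \in B y & edge u v]].

(* The supremum is taken in the extended reals, so that boundedness of the set
   of densities is not presupposed. *)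
Definition extremal_function (R : realType) (H : sgraph) : \bar R :=
  ereal_sup [set z | exists G : sgraph,
    [/\ (0 < nb_vertices G)%N, ~ minor H G & z = (density R G)%:E]]%classic.

(* H is isomorphic to a (not necessarily induced) subgraph of G. *)
Definition subgraph (H G : sgraph) : Prop :=
  exists h : H -> G, injective h /\ forall x y, edge x y -> edge (h x) (h y).

(* The first two conditions unfold G = G[A1] \cup G[A2]. *)
Definition separation (G : sgraph) (A1 A2 : {set G}) : Prop :=
  [/\ A1 :|: A2 = [set: G]%SET,
      forall x y : G, edge x y ->
        (x \in A1) && (y \in A1) || (x \in A2) && (y \in A2),
      A1 :\: A2 != finset.set0
    & A2 :\: A1 != finset.set0].

Definition separation_order (G : sgraph) (A1 A2 : {set G}) : nat :=
  #|A1 :&: A2|.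

(* |A1|, |A2| >= v(G) / 3 *)
Definition balanced (G : sgraph) (A1 A2 : {set G}) : Prop :=
  (nb_vertices G <= 3 * #|A1|)%N /\ (nb_vertices G <= 3 * #|A2|)%N.

(* Complete graphs, in particular K_0, K_1 and K_2, have no separation at all
   because both differences must be nonempty.  Asking for a balanced separation
   of every member of a subgraph-closed family would thus only be satisfied by
   the empty family, whence the threshold [n0].  Dropping the nonemptiness
   conditions instead gives the same notion, since c absorbs small graphs and
   c * v(G)^beta < v(G) / 3 makes both differences nonempty for large ones. *)
Definition strongly_sublinear_separators (R : realType)
    (F : sgraph -> Prop) : Prop :=
  (forall G H : sgraph, F G -> subgraph H G -> F H) /\
  exists (beta c : R) (n0 : nat),
    [/\ beta < 1, 0 < c
      & forall G : sgraph, F G -> (n0 <= nb_vertices G)%N ->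
          exists A1 A2 : {set G},
            [/\ separation A1 A2, balanced A1 A2
              & (separation_order A1 A2)%:R
                  <= c * (nb_vertices G)%:R `^ beta]].

(* Main.v *)
(* The lower bound comes from K_(n-1) and K_(tau-1, tau^2), where n = v(H).

   For the upper bound, sublinear separators split H into pieces of bounded size
   that cover its edges and repeat only o(n) vertices.  Let G have density at least
   (1 + eps) max (n / 2, tau).  It suffices to find in G enough disjoint copies of
   K_(4q, 2q) and of K_(q, q, q, q) to host the pieces, and then to join the copies
   of every repeated vertex of H by disjoint connected sets.  In a dense graph the
   copies exist by a minimum degree argument, and the joining sets run through a
   small random reservoir in a robust set, that is, a set such that a positive
   proportion of the pairs crossing any of its bipartitions are edges.

   In general, replace G by a minimal minor that is dense in Mader's sense; it is
   highly connected, and the neighbourhood of a vertex of bounded degree contains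
   a robust set with about half of the required density.  If two such sets are
   almost disjoint, Menger's theorem links them and each hosts half of the pieces.
   Otherwise all of them meet a fixed one substantially, and a union of some of
   them is robust.  Either it becomes so large that copies of K_(4q, 2q) alone
   suffice or it is itself dense, or it contains most of the set found around any
   vertex of bounded degree, and then it becomes dense when some of these vertices
   are added to it. *)
Require Import Defs.
From mathcomp Require Import all_boot all_order all_algebra.
From mathcomp Require Import all_classical all_reals all_analysis.
From mathcomp Require Import zify ring lra.
From mathcomp Require Import fintype finset.
Import Order.TTheory GRing.Theory Num.Theory.
Import numFieldNormedType.Exports.

Set Implicit Arguments.
Unset Strict Implicit.
Unset Printing Implicit Defensive.

Local Open Scope set_scope.
Local Open Scope ring_scope.

(** * Arcs and robust sets *)

(** The sides of K_(4q, 2q) mirror n / 2 and tau. With d = max (n / 2, tau), about d / 2q blocks are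
    needed: each takes 4q of the at most 2d vertices of H and 2q of the at most d vertices of the
    cover. So a block may use up about 4q of the average degree 2 (1 + eps) d of a dense set. Both
    kinds of block are needed: in a nearly complete set the 6q vertices of K_(4q, 2q) are too many,
    whereas a bipartite set has no 4-partite block.

    The obstacle in a sparse graph is a factor 2. Minimality bounds the codegrees of edges by about
    D = (1 + eps) d, so a neighbourhood only yields average degree D instead of 2D. The factor is
    regained in one of two ways. Two linked sets share the blocks evenly. Or a set consists of a
    large part with few arcs inside and a small rest: if its vertices have degree about D, nearly
    all arcs run between the two parts and are counted from both ends, which gives average degree
    about 2D. *)

Lemma big_disjU (R : Type) (idx : R) (op : Monoid.com_law idx) (I : finType)
    (A B : {set I}) (F : I -> R) : [disjoint A & B] ->
  \big[op/idx]_(i in A :|: B) F i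
  = op (\big[op/idx]_(i in A) F i) (\big[op/idx]_(i in B) F i).
Proof.
by move=> dAB; rewrite -bigU //; apply: eq_bigl => i; rewrite !inE.
Qed.

Lemma disjUl (T : finType) (A B C : {set T}) :
  [disjoint A :|: B & C] = [disjoint A & C] && [disjoint B & C].
Proof. by rewrite -!setI_eq0 setIUl setU_eq0. Qed.

Lemma disj1 (T : finType) (x : T) (C : {set T}) : [disjoint [set x] & C] = (x \notin C).
Proof. by rewrite disjoints_subset sub1set inE. Qed.

Section Arcs.
Variable G : sgraph.
Implicit Types (A B C S T : {set G}) (x y : G).

Definition dg x S : nat := #|[set y in S | edge x y]|.

(* Arcs are ordered adjacent pairs, so [ar S S] is twice the number of edges
   spanned by [S]. *)
Definition ar A B : nat := (\sum_(x in A) dg x B)%N.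

Lemma dgE x S : dg x S = (\sum_(y in S) edge x y)%N.
Proof.
rewrite /dg -sum1_card big_mkcond [RHS]big_mkcond /=; apply: eq_bigr => y _.
by rewrite !inE; case: (y \in S) => //=; case: edge.
Qed.

Lemma arE A B : ar A B = (\sum_(x in A) \sum_(y in B) edge x y)%N.
Proof. by apply: eq_bigr => x _; rewrite dgE. Qed.

Lemma arC A B : ar A B = ar B A.
Proof.
rewrite !arE exchange_big /=; apply: eq_bigr => x _; apply: eq_bigr => y _.
by rewrite edge_sym.
Qed.

Lemma ar1 x B : ar [set x] B = dg x B.
Proof. by rewrite /ar big_set1. Qed.

Lemma dgU x A B : [disjoint A & B] -> dg x (A :|: B) = (dg x A + dg x B)%N.
Proof. by move=> dAB; rewrite !dgE big_disjU. Qed.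

Lemma arUl A A' B : [disjoint A & A'] -> ar (A :|: A') B = (ar A B + ar A' B)%N.
Proof. by move=> dA; rewrite /ar big_disjU. Qed.

Lemma arUr A B B' : [disjoint B & B'] -> ar A (B :|: B') = (ar A B + ar A B')%N.
Proof. by move=> dB; rewrite arC arUl // ![ar _ A]arC. Qed.

Lemma dg_le x S : (dg x S <= #|S|)%N.
Proof. by apply: subset_leq_card; apply/subsetP => y; rewrite inE => /andP[]. Qed.

Lemma dgS x A B : A \subset B -> (dg x A <= dg x B)%N.
Proof.
move=> /subsetP sAB; apply: subset_leq_card; apply/subsetP => y.
by rewrite !inE => /andP[/sAB -> ->].
Qed.

Lemma arSl A A' B : A \subset A' -> (ar A B <= ar A' B)%N.
Proof.
move=> sA; rewrite /ar [X in (_ <= X)%N](big_setID A) /= (setIidPr sA).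
exact: leq_addr.
Qed.

Lemma arS A A' B B' : A \subset A' -> B \subset B' -> (ar A B <= ar A' B')%N.
Proof.
move=> sA sB; apply: leq_trans (arSl B sA) _.
by rewrite arC [X in (_ <= X)%N]arC; apply: arSl.
Qed.

Lemma ar_le A B : (ar A B <= #|A| * #|B|)%N.
Proof.
rewrite /ar -sum_nat_const; apply: leq_sum => x _; exact: dg_le.
Qed.

Lemma ar_split A B S : A :|: B = S -> [disjoint A & B] ->
  ar S S = (ar A A + ar B B + 2 * ar A B)%N.
Proof.
by move=> <- dAB; rewrite arUl // !arUr // [ar B A]arC; lia.
Qed.

Lemma ar_setD S T : T \subset S ->
  (ar S S <= ar (S :\: T) (S :\: T) + 2 * ar T S)%N.
Proof.
move=> sTS; have dTS : [disjoint T & S :\: T].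
  by rewrite -setI_eq0; apply/eqP/setP => x; rewrite !inE; case: (x \in T).
have US : T :|: (S :\: T) = S by rewrite -{1}(setIidPr sTS) setID.
have -> : ar T S = (ar T T + ar T (S :\: T))%N by rewrite -arUr // US.
rewrite (ar_split US dTS); lia.
Qed.

Lemma cards_cup A B S : A :|: B = S -> [disjoint A & B] -> #|S| = (#|A| + #|B|)%N.
Proof. by move=> <- dAB; rewrite cardsU disjoint_setI0 // cards0 subn0. Qed.

Lemma disjD S T : [disjoint T & S :\: T].
Proof. by rewrite -setI_eq0; apply/eqP/setP => x; rewrite !inE; case: (x \in T). Qed.

Lemma cupD S T : T \subset S -> T :|: (S :\: T) = S.
Proof. by move=> sTS; rewrite -{1}(setIidPr sTS) setID. Qed.

End Arcs.

Section Maximizers.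
Variables (R : realType).

Lemma exists_max_set (T : finType) (S0 : {set T}) (phi : {set T} -> R) :
  S0 != set0 ->
  exists S : {set T}, [/\ S \subset S0, S != set0
    & forall S' : {set T}, S' \subset S0 -> S' != set0 -> phi S' <= phi S].
Proof.
move=> S0n; pose P (S : {set T}) := (S \subset S0) && (S != set0).
have P0 : P S0 by rewrite /P subxx.
case: (@Order.TotalTheory.arg_maxP _ _ _ S0 P phi P0) => S /andP[sS nS] maxS.
by exists S; split=> // S' sS' nS'; apply: maxS; rewrite /P sS' nS'.
Qed.

Variable G : sgraph.
Implicit Types (A B S : {set G}).

Definition robust (lam : R) S := forall A B, A :|: B = S -> [disjoint A & B] ->
  lam * #|A|%:R * #|B|%:R <= (ar A B)%:R.

(* Splitting a maximizer [S] of [(ar S S - lam |S|^2 - om S) / |S|] into two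
   parts can gain at most what the quadratic penalty loses, so many arcs cross. *)
Lemma robust_subset (lam : R) (om : G -> R) (S0 : {set G}) : 0 <= lam ->
  S0 != set0 ->
  exists S : {set G}, [/\ S \subset S0, S != set0, robust lam S &
    ((ar S0 S0)%:R - lam * #|S0|%:R ^+ 2 - \sum_(x in S0) om x) * #|S|%:R
    <= ((ar S S)%:R - lam * #|S|%:R ^+ 2 - \sum_(x in S) om x) * #|S0|%:R].
Proof.
move=> lam0 S0n.
pose num S : R := (ar S S)%:R - lam * #|S|%:R ^+ 2 - \sum_(x in S) om x.
have cpos S : S != set0 -> 0 < #|S|%:R :> R by rewrite ltr0n card_gt0.
have [S [sS nS maxS]] := exists_max_set (fun S => num S / #|S|%:R) S0n.
exists S; split=> //; last first.
  have := maxS S0 (subxx _) S0n.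
  by rewrite ler_pdivlMr ?cpos // mulrAC ler_pdivrMr ?cpos.
move=> A B US dAB.
have [->|nA] := eqVneq A set0; first by rewrite cards0 mulr0 mul0r ler0n.
have [->|nB] := eqVneq B set0; first by rewrite cards0 mulr0 ler0n.
have sA : A \subset S0 by apply: subset_trans sS; rewrite -US subsetUl.
have sB : B \subset S0 by apply: subset_trans sS; rewrite -US subsetUr.
pose r := num S / #|S|%:R.
have hA : num A <= r * #|A|%:R by rewrite -ler_pdivrMr ?cpos //; apply: maxS.
have hB : num B <= r * #|B|%:R by rewrite -ler_pdivrMr ?cpos //; apply: maxS.
have hS : num S = r * #|S|%:R by rewrite /r mulfVK // gt_eqF ?cpos.
have omS : \sum_(x in S) om x = \sum_(x in A) om x + \sum_(x in B) om x.
  by rewrite -US big_disjU.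
move: hA hB hS; rewrite /num omS (ar_split US dAB) (cards_cup US dAB).
rewrite !natrD; nra.
Qed.

Lemma robust_deg (lam : R) S x : robust lam S -> x \in S ->
  lam * (#|S|%:R - 1) <= (dg x S)%:R.
Proof.
move=> rS xS; have := rS [set x] (S :\ x).
rewrite setD1K // => /(_ erefl); rewrite disjoints1 !inE eqxx => /(_ isT).
rewrite cards1 mulr1 ar1 (cardsD1 x S) xS natrD addrC addKr => h.
apply: le_trans h _; rewrite ler_nat; exact/dgS/subD1set.
Qed.

End Maximizers.

(** * Connected sets and random colourings *)

Section Connectivity.
Variable G : sgraph.
Implicit Types (A B X Y : {set G}) (u v x y : G).

Definition edge_in A : rel G := [rel u v | [&& u \in A, v \in A & edge u v]].

Lemma edge_in_sym A : connect_sym (edge_in A).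
Proof.
by apply: sym_connect_sym => u v; rewrite /edge_in /= edge_sym; case: (u \in A); case: (v \in A).
Qed.

Lemma connect_inS A B x y : A \subset B ->
  connect (edge_in A) x y -> connect (edge_in B) x y.
Proof.
move=> /subsetP sAB; apply: connect_sub => u v /and3P[/sAB uB /sAB vB uv].
by apply: connect1; rewrite /edge_in /= uB vB.
Qed.

Lemma connected_in_root A r : (forall x, x \in A -> connect (edge_in A) r x) ->
  connected_in A.
Proof.
move=> h x y xA yA; apply: (@connect_trans _ _ r); last exact: h.
by rewrite edge_in_sym; apply: h.
Qed.

Lemma connected_inP A B x y : connected_in A -> A \subset B -> x \in A -> y \in A ->
  connect (edge_in B) x y.
Proof. by move=> cA sAB xA yA; apply: (connect_inS sAB); apply: cA. Qed.

(** The ends need not lie in [X]: in a minor model they belong to hosted pieces, and only [X] has to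
    avoid everything else. *)
Definition joined X u v := connected_in (u |: (v |: X)).

Lemma joined_sym X u v : joined X u v -> joined X v u.
Proof. by rewrite /joined setUCA. Qed.

Lemma joined_edge u v : edge u v -> joined set0 u v.
Proof.
move=> uv; apply: (@connected_in_root _ u) => x; rewrite !inE orbF.
case/orP => /eqP->; first exact: connect0.
by apply: connect1; rewrite /edge_in /= !inE !eqxx orbT.
Qed.

Lemma joined_cat X Y u a v : joined X u a -> joined Y a v ->
  joined (a |: (X :|: Y)) u v.
Proof.
move=> jX jY; apply: (@connected_in_root _ a) => x xin.
have sX : u |: (a |: X) \subset u |: (v |: (a |: (X :|: Y))).
  by apply/subsetP => z; rewrite !inE => /or3P[] ->; rewrite ?orbT.
have sY : a |: (v |: Y) \subset u |: (v |: (a |: (X :|: Y))).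
  by apply/subsetP => z; rewrite !inE => /or3P[] ->; rewrite ?orbT.
have [xX|xX] := boolP (x \in u |: (a |: X)).
  by apply: (connected_inP jX) => //; rewrite !inE eqxx ?orbT.
apply: (connected_inP jY) => //; first by rewrite !inE eqxx.
by move: xin xX; rewrite !inE; case: (x == u); case: (x == v); case: (x == a) => //=;
   case: (x \in X).
Qed.

Lemma joined_cons X u y v : edge u y -> joined X y v -> joined (y |: X) u v.
Proof. by move=> /joined_edge uy /(joined_cat uy); rewrite set0U. Qed.

End Connectivity.

Section RandomClasses.

(** Bernoulli's inequality bounds powers from below, so it is applied to the inverse [1 + z] of the
    base: its power [2 * n] is at least 1 + 2n / (2n - 1) >= 2. *)
Lemma bernoulli_half (F : realFieldType) (n : nat) : (0 < n)%N ->
  2 * (1 - (2 * n%:R)^-1) ^+ (2 * n) <= 1 :> F.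
Proof.
move=> n0; have nR : 1 <= n%:R :> F by rewrite ler1n.
set y : F := 1 - _; pose z : F := (2 * n%:R - 1)^-1.
have z0 : 0 <= z by rewrite invr_ge0; lra.
have yz : y * (1 + z) = 1 by rewrite /y /z; field; apply/andP; split; lra.
have ber k : 1 + k%:R * z <= (1 + z) ^+ k.
  elim: k => [|k IH]; first by rewrite mul0r addr0 expr0.
  rewrite exprS -natr1; have : 0 <= k%:R :> F by [].
  nra.
have : 2 <= (1 + z) ^+ (2 * n).
  apply: le_trans (ber _); rewrite natrM /z.
  have -> : 2 = 1 + 1 :> F by lra.
  rewrite lerD2l ler_pdivlMr; lra.
have y0 : 0 <= y.
  by rewrite /y subr_ge0 invf_le1; lra.
have := exprn_ge0 (2 * n) y0.
have : y ^+ (2 * n) * (1 + z) ^+ (2 * n) = 1 by rewrite -exprMn yz expr1n.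
nra.
Qed.

(* Chernoff bound: for a uniformly random colouring, the expectation of
   [2 ^- #|colour class in A|] is [(1 - 1 / 2M) ^ #|A|]. *)
Lemma random_classes (T I : finType) (A : I -> {set T}) (M m : nat) :
  (0 < M)%N -> (forall i, 4 * M * m <= #|A i|)%N -> (#|I| * M < 2 ^ m)%N ->
  exists s : {ffun T -> 'I_M}, forall i j, (m <= #|[set x in A i | s x == j]|)%N.
Proof.
move=> M0 hA hI.
have [//|no] := pselect (exists s : {ffun T -> 'I_M},
  forall i j, (m <= #|[set x in A i | s x == j]|)%N); exfalso.
pose cl (s : {ffun T -> 'I_M}) i j := [set x in A i | s x == j].
pose f (s : {ffun T -> 'I_M}) i j : rat := 2^-1 ^+ #|cl s i j|.
have fE s i j : f s i j = \prod_x (if (x \in A i) && (s x == j) then 2^-1 else 1).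
  rewrite /f -prodr_const big_mkcond /=; apply: eq_bigr => x _; by rewrite !inE.
pose y : rat := 1 - (2 * M%:R)^-1.
have MR : 1 <= M%:R :> rat by rewrite ler1n.
have y0 : 0 <= y.
  by rewrite /y subr_ge0 invf_le1; lra.
have y1 : y <= 1 by rewrite /y gerBl invr_ge0; lra.
(* The sum over all colourings factors over the vertices: a vertex of [A i] contributes M - 1/2 = M
   * y, any other one M. As y ^ 2M <= 1/2, at least 4Mm vertices give the factor 4 ^ -m. *)
have sumf i j : \sum_s f s i j <= M%:R ^+ #|T| * 4^-1 ^+ m.
  under eq_bigr => s _ do rewrite fE.
  rewrite -(bigA_distr_bigA (fun x c => if (x \in A i) && (c == j) then 2^-1 else 1 : rat)) /=.
  have -> : \prod_x \sum_(c : 'I_M) (if (x \in A i) && (c == j) then 2^-1 else 1 : rat)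
      = \prod_x (M%:R * (if x \in A i then y else 1)).
    apply: eq_bigr => x _; case: (x \in A i) => /=; last first.
      by rewrite sumr_const card_ord mulr1.
    rewrite (bigD1 j) //= eqxx (eq_bigr (fun=> 1)); last by move=> c /negbTE ->.
    rewrite sumr_const cardC1 card_ord -subn1 natrB // /y; field; lra.
  rewrite big_split /= prodr_const -big_mkcond prodr_const /=.
  rewrite ler_pM2l ?exprn_gt0 ?ltr0n //.
  apply: le_trans (_ : y ^+ (4 * M * m) <= _); first exact: ler_wiXn2l.
  have -> : (4 * M * m = 2 * M * (2 * m))%N by lia.
  have -> : 4^-1 = 2^-1 ^+ 2 :> rat by rewrite expr2; field.
  rewrite exprM -[X in _ <= X]exprM; apply: lerXn2r; rewrite ?nnegrE ?exprn_ge0 //.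
  have := @bernoulli_half rat M M0; rewrite -/y => h; lra.
(* By contradiction, every colouring has a class with fewer than [m] elements in some [A i]; that
   class alone contributes 2 ^ -m. Comparison with [sumf] then yields 2 ^ m <= |I| M. *)
have low s : 2^-1 ^+ m <= \sum_i \sum_j f s i j.
  have [i [j hij]] : exists i j, (#|cl s i j| < m)%N.
    apply: contrapT => hn; apply: no; exists s => i j; rewrite leqNgt.
    by apply/negP => h; apply: hn; exists i, j.
  have f0 i' j' : 0 <= f s i' j' by rewrite exprn_ge0.
  rewrite (bigD1 i) //= (bigD1 j) //= -addrA; apply: le_trans (_ : f s i j <= _).
    by apply: ler_wiXn2l; [lra | lra | exact: ltnW].
  rewrite lerDl addr_ge0 //; apply: sumr_ge0 => // i' _; exact: sumr_ge0.
have : \sum_(s : {ffun T -> 'I_M}) 2^-1 ^+ m <= \sum_s \sum_i \sum_j f s i j.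
  by apply: ler_sum => s _; apply: low.
rewrite sumr_const card_ffun card_ord exchange_big /=.
under eq_bigr => i _ do rewrite exchange_big /=.
move=> /le_trans /(_ (ler_sum _ (fun i _ => ler_sum _ (fun j _ => sumf i j)))).
rewrite !sumr_const card_ord -[_ *+ M]mulr_natr -[X in _ <= X]mulr_natr -[X in X <= _]mulr_natr.
have -> : 4^-1 ^+ m = 2^-1 ^+ m * 2^-1 ^+ m :> rat by rewrite -exprMn; congr (_ ^+ _); field.
rewrite natrX => h.
have p0 : 0 < 2^-1 ^+ m :> rat by rewrite exprn_gt0.
have q0 : 0 < M%:R ^+ #|T| :> rat by rewrite exprn_gt0 // ltr0n.
have : 1 <= 2^-1 ^+ m * (#|I| * M)%:R :> rat.
  rewrite natrM -(ler_pM2l (mulr_gt0 p0 q0)); nra.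
rewrite exprVn ler_pdivlMl ?exprn_gt0 // mulr1 -natrX ler_nat.
by rewrite leqNgt hI.
Qed.

End RandomClasses.

(** * Reservoirs *)

Section Reservoir.
Variable R : realType.

Lemma exists_nat_ge (x : R) : exists n : nat, x <= n%:R.
Proof.
exists (Num.truncn `|x|).+1; apply: le_trans (ler_norm x) _.
by apply: ltW; have := truncnS_gt `|x|.
Qed.

Lemma truncn_bounds (x : R) : 0 <= x ->
  exists m : nat, m%:R <= x /\ x < m%:R + 1.
Proof.
move=> x0; exists (Num.truncn x); rewrite natr1; apply/andP; exact: truncn_itv.
Qed.

(** Made for the union bound in [random_classes], where the number of sets is quadratic in [N] while
    [m] is linear. For k = m / 4 the inequality k < 2 ^ k gives k ^ 4 < 2 ^ m, and a fourth power
    beats the quadratic term. *)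
Lemma expn2_dominates (a : R) (b : nat) : 0 < a -> exists N0 : nat, forall N : nat,
  (N0 <= N)%N -> exists m : nat,
    [/\ m%:R <= a * N%:R, a / 2 * N%:R < m%:R & (N ^ 2 * b < 2 ^ m)%N].
Proof.
move=> a0.
have [n1 h1] := exists_nat_ge (8 / a).
have [n2 h2] := exists_nat_ge (b%:R * (8 / a) ^+ 4).
exists (n1 + n2 + 1)%N => N hN.
have nR : n1%:R + n2%:R + 1 <= N%:R :> R by rewrite -natrD natr1 ler_nat; lia.
have N1 : 8 <= a * N%:R.
  have : 8 / a <= N%:R by have : 0 <= n2%:R :> R by []; lra.
  by rewrite ler_pdivrMr // mulrC.
have [m [m1 m2]] := @truncn_bounds (a * N%:R) ltac:(lra).
exists m; split=> //; first lra.
pose k := (m %/ 4)%N.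
have km : (m < 4 * k + 4)%N by rewrite /k; lia.
have km' : (4 * k <= m)%N by rewrite /k; lia.
have kR : a / 8 * N%:R <= k%:R.
  have : m%:R + 1 <= 4 * k%:R + 4 :> R.
    by rewrite natr1 -(natrM _ 4) -natrD ler_nat.
  lra.
apply: leq_trans (_ : (2 ^ (4 * k) <= _)%N); last by rewrite leq_exp2l.
rewrite mulnC expnM (_ : 2 ^ 4 = 16)%N //.
apply: leq_ltn_trans (_ : (k ^ 4 < _)%N); last first.
  rewrite (_ : 16 ^ k = (2 ^ k) ^ 4)%N; last by rewrite -expnM mulnC expnM.
  by rewrite ltn_exp2r // ltn_expl.
rewrite -(ler_nat R) natrM !natrX.
have k0 : 0 <= a / 8 * N%:R by rewrite mulr_ge0 // divr_ge0 ?ltW.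
apply: le_trans (_ : (a / 8 * N%:R) ^+ 4 <= _); last first.
  by apply: lerXn2r => //; rewrite nnegrE // (le_trans k0).
have NN : N%:R <= N%:R ^+ 2 :> R by rewrite -natrX ler_nat -mulnn leq_pmulr // -(ltr_nat R); nra.
have hb : b%:R * (8 / a) ^+ 4 <= N%:R ^+ 2.
  have : 0 <= n1%:R :> R by []. lra.
have -> : b%:R = b%:R * (8 / a) ^+ 4 * (a / 8) ^+ 4 :> R.
  rewrite -mulrA -exprMn (_ : 8 / a * (a / 8) = 1) ?expr1n ?mulr1 //; field; lra.
rewrite [X in _ <= X]exprMn (_ : N%:R ^+ 4 = N%:R ^+ 2 * N%:R ^+ 2); last by rewrite -exprD.
have : 0 <= (a / 8) ^+ 4 * N%:R ^+ 2 by rewrite mulr_ge0 // exprn_ge0 // divr_ge0 ?ltW.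
move: hb; nra.
Qed.

Variable G : sgraph.
Implicit Types (S Q W X : {set G}) (u v x y z : G).

(* A set [Q] of spare vertices through which any two vertices of [S] can be
   joined by at most [ell] vertices, even after [w] vertices are forbidden. *)
Definition reservoir S Q (w : R) (ell : nat) : Prop := Q \subset S /\
  forall W, #|W|%:R <= w -> forall u v, u \in S -> v \in S ->
    exists X : {set G},
      [/\ X \subset Q, [disjoint X & W], (#|X| <= ell)%N & joined X u v].

(** A breadth-first search from [z] that admits a vertex only if it has at least [k] neighbours
    among those reached before. These many choices are what survives when connecting vertices are
    confined to a random class and some of them are forbidden. *)
Fixpoint layer S (k : R) z (i : nat) : {set G} :=
  if i is j.+1 then
    layer S k z j :|: [set y in S | k <= (dg y (layer S k z j))%:R]
  else [set y in S | edge z y].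

Lemma layer_sub S k z i : layer S k z i \subset S.
Proof.
elim: i => [|i IH] /=; last by rewrite subUset IH /=; apply/subsetP => y; rewrite inE => /andP[].
by apply/subsetP => y; rewrite inE => /andP[].
Qed.

Lemma layer_mono S k z i : layer S k z i \subset layer S k z i.+1.
Proof. exact: subsetUl. Qed.

Lemma dg_setD x (A S : {set G}) : (dg x S <= dg x A + #|S :\: A|)%N.
Proof.
have h : S \subset A :|: (S :\: A) by apply/subsetP => y yS; rewrite !inE yS andbT orbN.
apply: leq_trans (dgS x h) _; by rewrite dgU ?disjD // leq_add2l dg_le.
Qed.

(** While more than lam N / 4 vertices are missing, robustness puts so many arcs between them and
    the layer that at least lam^2 N / 8 of them enter in the next round. After [e] rounds at most
    lam N / 4 are missing. As all degrees are at least lam N / 2, each of these has lam N / 4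
    neighbours in the layer, and one more round admits them all. *)
Lemma layer_full (lam : R) S z (e : nat) : 0 < lam -> lam <= 1 ->
  robust lam S -> z \in S -> (2 <= #|S|)%N -> 8 / lam ^+ 2 <= e%:R ->
  layer S (lam ^+ 2 / 4 * #|S|%:R) z e.+1 = S.
Proof.
move=> l0 l1 rS zS S2 he; set k := lam ^+ 2 / 4 * _; set N : R := #|S|%:R.
have N2 : 2 <= N by rewrite (ler_nat R 2).
have mindg y : y \in S -> lam * N / 2 <= (dg y S)%:R.
  by move=> yS; have := robust_deg rS yS; rewrite -/N; nra.
pose L := layer S k z; have LS i : L i \subset S := layer_sub S k z i.
have L0 : lam * N / 2 <= #|L 0%N|%:R by apply: mindg.
have Li i : lam * N / 2 <= #|L i|%:R.
  elim: i => [//|i IH]; apply: le_trans IH _; rewrite ler_nat.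
  exact/subset_leq_card/layer_mono.
have step i : lam * N / 4 < #|S :\: L i|%:R ->
    #|S :\: L i.+1|%:R <= #|S :\: L i|%:R - lam ^+ 2 / 8 * N.
  move=> big.
  have := rS (L i) (S :\: L i) (cupD (LS i)) (disjD S (L i)); rewrite arC /ar natr_sum.
  set b := #|S :\: L i|%:R; set a := #|L i|%:R; set b' := #|S :\: L i.+1|%:R.
  have -> : \sum_(x in S :\: L i) (dg x (L i))%:R =
     \sum_(x in (S :\: L i) :\: L i.+1) (dg x (L i))%:R
     + \sum_(x in (S :\: L i) :&: L i.+1) (dg x (L i))%:R :> R.
    by rewrite addrC -(big_setID (L i.+1)).
  have SLL : (S :\: L i) :\: L i.+1 = S :\: L i.+1.
    by rewrite setDDl (setUidPr (layer_mono S k z i)).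
  rewrite SLL.
  have e1 : \sum_(x in S :\: L i.+1) (dg x (L i))%:R <= b' * k.
    rewrite /b' mulr_natl -sumr_const; apply: ler_sum => x.
    rewrite inE => /andP[xL xS]; move: xL.
    by rewrite /L /= !inE negb_or xS /= -ltNge => /andP[_ /ltW].
  have e2 : \sum_(x in (S :\: L i) :&: L i.+1) (dg x (L i))%:R <= (b - b') * a.
    have -> : b - b' = #|(S :\: L i) :&: L i.+1|%:R.
      rewrite /b /b' -(cardsID (L i.+1) (S :\: L i)) natrD.
      by rewrite SLL addrK.
    by rewrite mulr_natl -sumr_const; apply: ler_sum => x _; rewrite ler_nat dg_le.
  have aN : lam * N / 2 <= a := Li i.
  have bb : lam * N / 4 < b := big.
  have kN : k <= lam / 2 * a.
    have l2 : 0 <= lam / 2 by lra.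
    have -> : k = lam / 2 * (lam * N / 2) by rewrite /k -/N; field.
    exact: ler_wpM2l.
  have b'0 : 0 <= b' by rewrite /b'.
  have b'b : b' <= b by rewrite /b' /b ler_nat; apply/subset_leq_card/setDS/layer_mono.
  move=> h0.
  have h : lam * a * b <= b' * (lam / 2 * a) + (b - b') * a.
    apply: le_trans h0 _; apply: lerD; last exact: e2.
    by apply: le_trans e1 _; apply: ler_wpM2l.
  have a0 : 0 < a by move: aN; nra.
  have : lam * b <= b' * (lam / 2) + (b - b').
    rewrite -(ler_pM2l a0); move: h; lra.
  nra.
have small i : #|S :\: L i|%:R <= lam * N / 4 \/ #|S :\: L i|%:R <= N - i%:R * (lam ^+ 2 / 8 * N).
  elim: i => [|i [IH|IH]].
  - by right; rewrite mul0r subr0 /N ler_nat subset_leq_card // subsetDl.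
  - by left; apply: le_trans IH; rewrite ler_nat; apply/subset_leq_card/setDS/layer_mono.
  have [h|h] := lerP (#|S :\: L i|%:R) (lam * N / 4).
    by left; apply: le_trans h; rewrite ler_nat; apply/subset_leq_card/setDS/layer_mono.
  right; apply: le_trans (step i h) _; rewrite -[i.+1%:R]natr1 mulrDl mul1r opprD addrA.
  by rewrite lerD2r.
have Se : #|S :\: L e|%:R <= lam * N / 4.
  have [//|h] := small e; apply: le_trans h _.
  have : 1 <= e%:R * (lam ^+ 2 / 8).
    move: he; rewrite ler_pdivrMr ?exprn_gt0 //; lra.
  have : 0 <= lam * N by rewrite mulr_ge0 ?ltW //; lra.
  nra.
apply/eqP; rewrite eqEsubset layer_sub /=; apply/subsetP => y yS.
rewrite !inE yS /=; apply/orP; right.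
have := dg_setD y (L e) S; rewrite -(ler_nat R) natrD => h.
have := mindg y yS; rewrite -/(L e) /k -/N.
have lN : 0 <= (1 - lam) * (lam * N) by apply: mulr_ge0; [lra | apply: mulr_ge0; lra].
rewrite -/L; nra.
Qed.

End Reservoir.

(** [Q] is a smallest class of a colouring with [M] colours in which every large set [neighbours of
    [u] in a layer of [v]] has more than |W| vertices of each colour. A connection from [u] descends
    through the layers of [v], at each step choosing a neighbour in [Q] outside [W]. *)
Lemma reservoir_exists (R : realType) (lam : R) (M : nat) :
  0 < lam -> lam <= 1 -> (0 < M)%N ->
  exists (ell N0 : nat) (c : R), 0 < c /\
    forall (G : sgraph) (S : {set G}), robust lam S -> (N0 <= #|S|)%N ->
    exists Q : {set G}, (#|Q| * M <= #|S|)%N /\ reservoir S Q (c * #|S|%:R) ell.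
Proof.
move=> l0 l1 M0.
have [e he] := exists_nat_ge (8 / lam ^+ 2).
have MR : 0 < M%:R :> R by rewrite ltr0n.
pose a : R := lam ^+ 2 / 4 / (4 * M%:R).
have a0 : 0 < a by rewrite /a divr_gt0 ?divr_gt0 ?exprn_gt0 ?mulr_gt0.
have [N0 hN0] := expn2_dominates (e.+1 * M) a0.
exists e.+1, (N0 + 2)%N, (a / 2); split; first lra.
move=> G S rS SN.
have [m [m1 m2 m3]] := hN0 #|S| ltac:(lia).
set N : R := #|S|%:R in m1 m2; pose k := lam ^+ 2 / 4 * N.
have mk : (4 * M * m)%:R <= k.
  rewrite !natrM; have -> : k = 4 * M%:R * (a * N) by rewrite /k /a; field; lra.
  by rewrite ler_pM2l // mulr_gt0.
pose T := {x : G | x \in S}.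
pose L := layer S k.
pose I : finType := (T * T * 'I_e.+1)%type.
pose A0 (i : I) := [set x in L (val i.1.2) i.2 | edge (val i.1.1) x].
pose A i := if (4 * M * m <= #|A0 i|)%N then A0 i else S.
have SM : (4 * M * m <= #|S|)%N.
  rewrite -(ler_nat R); apply: le_trans mk _; rewrite /k -/N.
  have N0' : 0 <= N by rewrite /N.
  have l2 : lam ^+ 2 <= 1 by apply: exprn_ile1; lra.
  by rewrite -[leRHS]mul1r ler_wpM2r //; lra.
have hA i : (4 * M * m <= #|A i|)%N by rewrite /A; case: ifP.
have cI : (#|I| * M < 2 ^ m)%N.
  rewrite !card_prod card_ord card_sig.
  by move: m3; rewrite (_ : #|[pred x | x \in S]| = #|S|) //; lia.
have [s hs] := random_classes M0 hA cI.
have [j hj] : exists j, (#|[set x in S | s x == j]| * M <= #|S|)%N.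
  apply: contrapT => no.
  have : (\sum_(j < M) #|S| < \sum_(j < M) (#|[set x in S | s x == j]| * M))%N.
    have lt j : (#|S| < #|[set x in S | s x == j]| * M)%N.
      by rewrite ltnNge; apply/negP => h; apply: no; exists j.
    rewrite [X in (X < _)%N](bigD1 (Ordinal M0)) // [X in (_ < X)%N](bigD1 (Ordinal M0)) //= -addSn; apply: leq_add; first exact: lt.
    by apply: leq_sum => i _; apply: ltnW.
  rewrite -big_distrl /= sum_nat_const card_ord mulnC.
  have -> : (\sum_(j < M) #|[set x in S | s x == j]| = #|S|)%N.
    rewrite -sum1_card (partition_big (fun x => s x) predT) //=; apply: eq_bigr => j _.
    by rewrite -sum1_card; apply: eq_bigl => x; rewrite !inE.
  by rewrite ltnn.
exists [set x in S | s x == j]; split=> //; split.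
  by apply/subsetP => x; rewrite inE => /andP[].
move=> W hW u v uS vS.
have Wm : (#|W| < m)%N by rewrite -(ltr_nat R); apply: le_lt_trans m2.
suff : forall i, (i <= e.+1)%N -> forall u, u \in L v i -> exists X : {set G},
   [/\ X \subset [set x in S | s x == j], [disjoint X & W], (#|X| <= i)%N & joined X u v].
  by move=> /(_ e.+1 (leqnn _) u); apply; rewrite /L /k layer_full //; lia.
clear u uS.
elim=> [|i IH] hi u.
  rewrite /L /= inE => /andP[uS vu]; exists set0; split.
  - exact: sub0set.
  - by rewrite disjoints_subset sub0set.
  - by rewrite cards0.
  by apply: joined_edge; rewrite edge_sym.
rewrite /L /= inE => /orP[/(IH (ltnW hi))[X [X1 X2 X3 X4]]|].
  by exists X; split=> //; apply: leqW.
rewrite inE => /andP[uS hu].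
pose ii : I := (exist _ u uS, exist _ v vS, Ordinal hi).
have Aii : A ii = A0 ii.
  rewrite /A; case: ifP => // /negP; case; rewrite -(ler_nat R).
  by apply: le_trans mk _; apply: hu.
have [y yin yW] : exists2 y, y \in [set x in A ii | s x == j] & y \notin W.
  have : ~~ ([set x in A ii | s x == j] \subset W).
    apply/negP => /subset_leq_card h; have := hs ii j.
    by rewrite leqNgt (leq_ltn_trans h).
  by case/subsetPn => y; exists y.
move: yin; rewrite Aii !inE /= => /andP[/andP[yL uy] sy].
have [X [X1 X2 X3 X4]] := IH (ltnW hi) y yL.
exists (y |: X); split.
- rewrite subUset X1 andbT sub1set inE sy andbT.
  exact: (subsetP (layer_sub S k v i)).
- by rewrite disjUl disj1 yW X2.
- by rewrite (leq_trans (leq_card_setU _ _)) // cards1 add1n.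
exact: joined_cons.
Qed.

(** * Blow-ups of frequent patterns *)

Section Counting.
Variable R : realType.

Lemma card_fibers (T U : finType) (P : {set T * U}) :
  #|P| = (\sum_x #|[set y | (x, y) \in P]|)%N.
Proof.
rewrite -sum1_card big_mkcond /=.
rewrite (eq_bigr (fun p => (if (p.1, p.2) \in P then 1 else 0)%N)); last by case.
rewrite -(pair_bigA _ (fun x y => if (x, y) \in P then 1 else 0)%N) /=.
by apply: eq_bigr => x _; rewrite -big_mkcond /= -sum1_card; apply: eq_bigl => y; rewrite inE.
Qed.

Lemma card_fibers_swap (T U : finType) (P : {set T * U}) :
  #|P| = (\sum_y #|[set x | (x, y) \in P]|)%N.
Proof.
rewrite card_fibers; under eq_bigr => x _ do rewrite -sum1_card big_mkcond /=.
rewrite exchange_big /=; apply: eq_bigr => y _.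
by rewrite -sum1_card [RHS]big_mkcond /=; apply: eq_bigr => x _; rewrite !inE.
Qed.

(** Markov's inequality for the sizes of the fibres of [P]. *)
Lemma heavy_le (T U : finType) (P : {set T * U}) (c M : R) : 0 < c ->
  #|P|%:R < c * M ->
  #|[set x | c <= #|[set y | (x, y) \in P]|%:R]|%:R <= M.
Proof.
move=> c0; rewrite card_fibers => h.
rewrite -(ler_pM2l c0); apply: le_trans (ltW h).
rewrite natr_sum [leRHS](bigID [pred x | x \in [set x | c <= #|[set y | (x, y) \in P]|%:R]]) /=.
apply: ler_wpDr; first exact: sumr_ge0.
by rewrite mulr_natr -sumr_const; apply: ler_sum => x; rewrite inE.
Qed.

Lemma card_indicator (T : finType) (S N : {set T}) : N \subset S ->
  #|N|%:R = \sum_(v in S) (v \in N)%:R :> R.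
Proof.
move=> sN; rewrite -sum1_card natr_sum big_mkcond [RHS]big_mkcond /=; apply: eq_bigr => v _.
have /subsetP/(_ v) := sN; case: (v \in N) => [->|] //.
by case: (v \in S).
Qed.

(** A layer-cake bound: a vertex lying in the first few of the nested sets has telescoping weight
    equal to the level guaranteed there. The levels never exceed 1, so an exceptional vertex in [E]
    costs at most 1. *)
Lemma layer_sum (T : finType) (S N1 N2 N3 E : {set T}) (a : T -> R) (a1 a2 a3 a4 : R) :
  N1 \subset S -> N2 \subset N1 -> N3 \subset N2 -> E \subset S ->
  a1 <= a2 -> a2 <= a3 -> a3 <= a4 -> a4 <= 1 ->
  (forall v, v \in S -> 0 <= a v) ->
  (forall v, v \in S -> v \notin E -> a1 <= a v) ->
  (forall v, v \in N1 -> v \notin E -> a2 <= a v) ->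
  (forall v, v \in N2 -> v \notin E -> a3 <= a v) ->
  (forall v, v \in N3 -> v \notin E -> a4 <= a v) ->
  a1 * #|S|%:R + (a2 - a1) * #|N1|%:R + (a3 - a2) * #|N2|%:R + (a4 - a3) * #|N3|%:R
  <= \sum_(v in S) a v + #|E|%:R.
Proof.
move=> s1 s2 s3 sE h12 h23 h34 h41 h0 H1 H2 H3 H4.
have s2' := subset_trans s2 s1; have s3' := subset_trans s3 s2'.
rewrite (card_indicator s1) (card_indicator s2') (card_indicator s3') (card_indicator sE).
rewrite (card_indicator (subxx S)) !mulr_sumr -!big_split /=.
apply: ler_sum => v vS; rewrite vS.
have p0 := h0 v vS; have p1 := H1 v vS.
case: (boolP (v \in E)) => [vE|vE].
  by case: (v \in N1); case: (v \in N2); case: (v \in N3) => /=; lra.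
have {}p1 := p1 vE.
case: (boolP (v \in N3)) => [v3|v3].
  have v2 := subsetP s3 v v3; have v1 := subsetP s2 v v2.
  by rewrite v1 v2 /=; have := H4 v v3 vE; lra.
case: (boolP (v \in N2)) => [v2|v2].
  by rewrite (subsetP s2 v v2) /=; have := H3 v v2 vE; lra.
case: (boolP (v \in N1)) => [v1|v1] /=; last lra.
by have := H2 v v1 vE; lra.
Qed.

Lemma exists_min (T : finType) (A E : {set T}) (a : T -> R) :
  #|E|%:R < #|A|%:R :> R ->
  exists x, [/\ x \in A, x \notin E & forall y, y \in A -> y \notin E -> a x <= a y].
Proof.
rewrite ltr_nat => lt.
have [x0 xA xE] : exists2 x, x \in A & x \notin E.
  by apply/subsetPn; apply/negP => /subset_leq_card; rewrite leqNgt lt.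
pose P := [pred x | (x \in A) && (x \notin E)].
have P0 : P x0 by rewrite /= xA.
case: (@Order.TotalTheory.arg_minP _ _ _ x0 P a P0) => x /andP[h1 h2] mn.
by exists x; split=> // y yA yE; apply: mn; rewrite /= yA.
Qed.

Lemma card_cap (T : finType) (A B S : {set T}) : A \subset S -> B \subset S ->
  (#|A| + #|B| <= #|A :&: B| + #|S|)%N.
Proof.
move=> sA sB; have := cardsUI A B; have : (#|A :|: B| <= #|S|)%N.
  by apply: subset_leq_card; rewrite subUset sA.
lia.
Qed.

End Counting.

(** * Complete multipartite patterns by averaging *)

Section Box.

(** [A] is built greedily: by double counting some new vertex is related to a proportion g / |S| of
    the surviving [y]. The surplus [s] in the hypothesis pays for the vertices already chosen. *)
Lemma select (T U : finType) (S : {set T}) (r : T -> U -> bool) (g s : nat) (Y : {set U}) :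
  (s <= #|S|)%N -> (forall y, y \in Y -> g + s <= #|[set x in S | r x y]|)%N ->
  exists (A : {set T}) (Y' : {set U}),
    [/\ A \subset S, #|A| = s, Y' \subset Y,
        forall a y, a \in A -> y \in Y' -> r a y
      & (#|Y| * g ^ s <= #|Y'| * #|S| ^ s)%N].
Proof.
move=> sS hY; suff : forall j, (j <= s)%N -> exists (A : {set T}) (Y' : {set U}),
    [/\ A \subset S, #|A| = j, Y' \subset Y,
        forall a y, a \in A -> y \in Y' -> r a y
      & (#|Y| * g ^ j <= #|Y'| * #|S| ^ j)%N] by apply.
elim=> [|j IH] hj.
  exists set0, Y; split.
  - exact: sub0set.
  - exact: cards0.
  - exact: subxx.
  - by move=> a y; rewrite inE.
  - by rewrite !expn0.
have [A [Yj [sA cA sYj rA hc]]] := IH (ltnW hj).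
have [x xSA hx] : exists2 x, x \in S :\: A &
    (g * #|Yj| <= #|[set y in Yj | r x y]| * #|S|)%N.
  apply: contrapT => no.
  have lt x : x \in S :\: A -> (#|[set y in Yj | r x y]| * #|S| < g * #|Yj|)%N.
    by move=> xin; rewrite ltnNge; apply/negP => h; apply: no; exists x.
  have SA0 : (0 < #|S :\: A|)%N by rewrite cardsD (setIidPr sA) cA subn_gt0 (leq_trans hj).
  have e : (\sum_(x in S :\: A) #|[set y in Yj | r x y]|
      = \sum_(y in Yj) #|[set x in S :\: A | r x y]|)%N.
    under eq_bigr => x _ do rewrite -sum1_card big_mkcond /=.
    under [RHS]eq_bigr => y _ do rewrite -sum1_card big_mkcond /=.
    rewrite [LHS](eq_bigr (fun x => \sum_(y in Yj) r x y)%N); last first.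
      move=> x _; rewrite [RHS]big_mkcond; apply: eq_bigr => y _; rewrite !inE.
      by case: (y \in Yj); case: (r x y).
    rewrite exchange_big /=; apply: eq_bigr => y _; rewrite [LHS]big_mkcond.
    by apply: eq_bigr => x _; rewrite !inE; case: (x \in A); case: (x \in S); case: (r x y).
  have lo : (#|Yj| * g <= \sum_(y in Yj) #|[set x in S :\: A | r x y]|)%N.
    rewrite -sum_nat_const; apply: leq_sum => y yY.
    have := hY y (subsetP sYj y yY).
    have : (#|[set x in S | r x y]| <= #|[set x in S :\: A | r x y]| + #|A|)%N.
      rewrite (leq_trans _ (leq_card_setU _ _)) //; apply: subset_leq_card.
      by apply/subsetP => z; rewrite !inE => /andP[-> ->]; case: (z \in A).
    rewrite cA; lia.
  have hi : (\sum_(x in S :\: A) #|[set y in Yj | r x y]| * #|S|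
      < \sum_(x in S :\: A) g * #|Yj|)%N.
    move: SA0; rewrite card_gt0 => /set0Pn[x0 x0in].
    rewrite [X in (X < _)%N](bigD1 x0) // [X in (_ < X)%N](bigD1 x0) //= -addSn.
    apply: leq_add; first exact: lt.
    by apply: leq_sum => x /andP[xin _]; apply/ltnW/lt.
  move: hi; rewrite -big_distrl /= e sum_nat_const => hi.
  have cSA : (#|S :\: A| <= #|S|)%N by rewrite subset_leq_card ?subsetDl.
  have := leq_mul lo (leqnn #|S|); have := leq_mul cSA (leqnn (g * #|Yj|)).
  by move: hi; rewrite [(#|Yj| * g)%N]mulnC [(g * #|Yj| * _)%N]mulnC; lia.
exists (x |: A), [set y in Yj | r x y]; split.
- by rewrite subUset sA andbT sub1set; move: xSA; rewrite inE => /andP[].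
- by move: xSA; rewrite inE => /andP[xA _]; rewrite cardsU1 xA cA.
- by apply: subset_trans sYj; apply/subsetP => y; rewrite inE => /andP[].
- move=> a y; rewrite !inE => /orP[/eqP->|aA] /andP[yY rxy] //; exact: rA.
rewrite !expnS; have := leq_mul hc (leqnn g); have := leq_mul hx (leqnn (#|S| ^ j)%N).
by lia.
Qed.

Variable R : realType.

(** The factor c / 2 comes from keeping only those [y] whose fibre has at least c / 2 |S| elements,
    and c / 8 is the proportion that survives each of the [s] choices in [select]. *)
Definition box_rate (s : nat) (c : R) : R := c / 2 * (c / 8) ^+ s.

Lemma box_rate_gt0 s c : 0 < c -> 0 < box_rate s c.
Proof. by move=> c0; rewrite mulr_gt0 ?exprn_gt0 ?divr_gt0. Qed.

(** One round of Erdős's argument for complete multipartite hypergraphs. As [Y] keeps a positive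
    proportion of [V], the lemma can be iterated with [V] a product of the remaining coordinates. *)
Lemma box (T U : finType) (S : {set T}) (V : {set U}) (P : {set T * U}) (c : R) (s : nat) :
  0 < c -> c <= 1 -> P \subset setX S V -> c * #|S|%:R * #|V|%:R <= #|P|%:R ->
  s%:R <= c / 4 * #|S|%:R -> 8 <= c * #|S|%:R ->
  exists (A : {set T}) (Y : {set U}), [/\ A \subset S, #|A| = s, Y \subset V,
    forall a y, a \in A -> y \in Y -> (a, y) \in P
    & box_rate s c * #|V|%:R <= #|Y|%:R].
Proof.
move=> c0 c1 sP hP hs h8; set N : R := #|S|%:R in hP hs h8 *; set M : R := #|V|%:R in hP *.
have N0 : 0 < N by nra.
pose d y := #|[set x | (x, y) \in P]|.
pose Y0 := [set y in V | c / 2 * N <= (d y)%:R].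
have dN y : (d y)%:R <= N.
  rewrite ler_nat; apply: subset_leq_card; apply/subsetP => x; rewrite inE => h.
  by have /subsetP/(_ _ h) := sP; rewrite in_setX => /andP[].
have dV y : y \notin V -> d y = 0%N.
  move=> yV; apply/eqP; rewrite cards_eq0; apply/eqP/setP => x; rewrite !inE.
  apply/negP => h; have /subsetP/(_ _ h) := sP.
  by rewrite in_setX (negbTE yV) andbF.
have cY0 : c / 2 * M <= #|Y0|%:R.
  have : #|P|%:R <= #|Y0|%:R * N + M * (c / 2 * N).
    rewrite card_fibers_swap natr_sum (bigID (mem V)) /= [X in _ + X]big1 ?addr0; last first.
      by move=> y yV; rewrite -/(d y) dV.
    rewrite (big_setID Y0) /=; apply: lerD.
      rewrite mulr_natl -sumr_const (_ : V :&: Y0 = Y0).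
        by apply: ler_sum => y _; apply: dN.
      by apply/setIidPr/subsetP => y; rewrite inE => /andP[].
    apply: le_trans (_ : \sum_(i in V :\: Y0) c / 2 * N <= _).
      apply: ler_sum => y; rewrite !inE => /andP[h yV]; move: h; rewrite yV /= -ltNge.
      exact: ltW.
    rewrite sumr_const -[leLHS]mulr_natl; apply: ler_wpM2r; first by rewrite mulr_ge0 ?ltW // divr_gt0.
    by rewrite ler_nat subset_leq_card ?subsetDl.
  move=> h; rewrite -(ler_pM2r N0); move: hP; lra.
have [g [g1 g2]] := @truncn_bounds R (c / 4 * N) ltac:(nra).
have sS : (s <= #|S|)%N by rewrite -(ler_nat R) -/N; nra.
have hY y : y \in Y0 -> (g + s <= #|[set x in S | (x, y) \in P]|)%N.
  rewrite inE => /andP[_ h]; rewrite -(ler_nat R) natrD.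
  have -> : [set x in S | (x, y) \in P] = [set x | (x, y) \in P].
    apply/setP => x; rewrite !inE andb_idl // => h'.
    by have /subsetP/(_ _ h') := sP; rewrite in_setX => /andP[].
  rewrite -/(d y); lra.
have [A [Y [sA cA sY hr hc]]] := select sS hY.
exists A, Y; split=> //.
  by apply: subset_trans sY _; apply/subsetP => y; rewrite inE => /andP[].
move: hc; rewrite -(ler_nat R) !natrM !natrX -/N => hc.
have Ns : 0 < N ^+ s by rewrite exprn_gt0.
rewrite -(ler_pM2r Ns); apply: le_trans hc; rewrite /box_rate.
have gc : c / 8 * N <= g%:R by lra.
have : (c / 8 * N) ^+ s <= g%:R ^+ s by apply: lerXn2r; rewrite // nnegrE; nra.
rewrite exprMn => hg.
have e0 : 0 <= (c / 8) ^+ s * N ^+ s by rewrite mulr_ge0 ?exprn_ge0 ?ltW // divr_gt0.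
apply: le_trans (_ : (c / 2 * M) * ((c / 8) ^+ s * N ^+ s) <= _); first by rewrite le_eqVlt; apply/orP; left; apply/eqP; ring.
by apply: ler_pM; [rewrite mulr_ge0 // divr_ge0 // ltW | exact: e0 | exact: cY0 | exact: hg].
Qed.

End Box.

(** * Dense blocks *)

Section Dichotomy.
Variable R : realType.
Implicit Types (a b rho th ep eta nu : R).

(** Here [a] stands for the least degree and 1 + 3/2 rho + ep - 2 a for the degree forced on its
    neighbours, both relative to |S|; the last hypothesis compares the average degree with them. Up
    to [th] it says a * ep <= (2 a - rho) (3/2 a - 1), and 2 a > rho, so a exceeds 2/3. *)
Lemma low_degree_ineq a rho th ep eta : 0 < ep -> ep <= 1 -> 0 < eta -> eta <= 1 ->
  eta <= rho -> rho / 2 <= a -> a <= 1 -> th = eta * ep / 100 ->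
  1 + 3 / 2 * rho + ep - 2 * a <= 1 ->
  a + (1 + 3 / 2 * rho + ep - 2 * a - a) * a <= rho + 2 * th ->
  2 / 3 + eta * ep / 12 <= a.
Proof.
move=> ep0 ep1 eta0 eta1 hrho ha a1 -> hb h; rewrite leNgt; apply/negP => lt.
have e1 : eta * ep / 2 <= a * ep by nra.
have e0 : 0 < eta * ep by rewrite mulr_gt0.
have h2 : a * ep - eta * ep / 50 <= (2 * a - rho) * (3 / 2 * a - 1) by move: h; nra.
have p0 : 0 < 2 * a - rho by lra.
have p2 : 2 * a - rho <= 2 by lra.
have [hn|hp] := lerP (3 / 2 * a - 1) 0; first by nra.
nra.
Qed.

(** The expression is affine in [a4], so it suffices to look at a4 = a3 and a4 = 1, where it is a
    sum of nonnegative products; the identity [e] interpolates between the two. The interval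
    degenerates when a3 = 1. *)
Lemma clique_ineq (a1 a2 a3 a4 : R) : 2 / 3 <= a1 -> a1 <= a2 -> a2 <= a3 ->
  a3 <= a4 -> a4 <= 1 ->
  0 <= 2 + (a1 + a2 + a3) - 2 * (a1 ^+ 2 + a2 ^+ 2 + a3 ^+ 2)
       + (2 * (a1 + a2 + a3) - 5) * a4.
Proof.
move=> h1 h12 h23 h34 h4.
set F := (X in 0 <= X).
have q (x : R) : 2 / 3 <= x -> x <= 1 -> 0 <= (1 - x) * (2 * x - 1).
  by move=> ? ?; apply: mulr_ge0; lra.
have q1 := q a1 ltac:(lra) ltac:(lra); have q2 := q a2 ltac:(lra) ltac:(lra).
have q3 := q a3 ltac:(lra) ltac:(lra).
have q4 : 0 <= (1 - a3) * (4 - 2 * a1 - 2 * a2) by apply: mulr_ge0; lra.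
have e : (1 - a3) * F = (a4 - a3) * ((1 - a1) * (2 * a1 - 1) + (1 - a2) * (2 * a2 - 1)
      + (1 - a3) * (2 * a3 - 1))
  + (1 - a4) * ((1 - a1) * (2 * a1 - 1) + (1 - a2) * (2 * a2 - 1)
      + (1 - a3) * (4 - 2 * a1 - 2 * a2)) by rewrite /F; ring.
have [a31|a31] := lerP 1 a3.
  have -> : F = (1 - a1) * (2 * a1 - 1) + (1 - a2) * (2 * a2 - 1).
    have e3 : a3 = 1 by lra.
    have e4 : a4 = 1 by lra.
    by rewrite /F e3 e4; ring.
  lra.
rewrite -(@pmulr_rge0 _ (1 - a3)) ?subr_gt0 // e.
by apply: addr_ge0; apply: mulr_ge0; lra.
Qed.

(** The expression of [clique_ineq] is twice the left side of the last hypothesis, with the lower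
    bounds in place of [n1], [n2], [n3], minus (a1 + a2 + a3 + a4 - 2). Hence twice that side is at
    least 2 rho + ep, more than 2 rho + 10 th. *)
Lemma no_clique_ineq (a1 a2 a3 a4 rho th ep n1 n2 n3 : R) :
  2 / 3 <= a1 -> a1 <= a2 -> a2 <= a3 -> a3 <= a4 -> a4 <= 1 ->
  2 + 2 * rho + ep <= a1 + a2 + a3 + a4 ->
  n1 = a1 -> a1 + a2 - 1 <= n2 -> a1 + a2 + a3 - 2 <= n3 -> 10 * th < ep ->
  a1 + (a2 - a1) * n1 + (a3 - a2) * n2 + (a4 - a3) * n3 <= rho + 5 * th -> False.
Proof.
move=> h1 h12 h23 h34 h4 hs -> hn2 hn3 hth h.
have F := clique_ineq h1 h12 h23 h34 h4.
have p2 : (a3 - a2) * (a1 + a2 - 1) <= (a3 - a2) * n2 by apply: ler_wpM2l; lra.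
have p3 : (a4 - a3) * (a1 + a2 + a3 - 2) <= (a4 - a3) * n3 by apply: ler_wpM2l; lra.
nra.
Qed.

Lemma heavy_le_in (T U : finType) (P : {set T * U}) (S : {set T}) (c M : R) : 0 < c ->
  #|P|%:R < c * M ->
  #|[set x | c <= #|[set y | (x, y) \in P]|%:R] :&: S|%:R <= M.
Proof.
move=> c0 h; apply: le_trans (heavy_le c0 h); rewrite ler_nat.
exact/subset_leq_card/subsetIl.
Qed.

Variables (G : sgraph) (S : {set G}).
Let N : R := #|S|%:R.
Let a (x : G) : R := (dg x S)%:R / N.
Let rho : R := (ar S S)%:R / N ^+ 2.

(** In a K_(4q, 2q) between such [u] and [v] the values of [a] sum to about 2q (2 a u + a v), and
    the threshold lets its removal lower [ar S S / |S|] by at most 4q (1 + ep) or so. Four parts of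
    size [q] lead to the threshold in [good_cliques] in the same way. *)
Definition good_edges (ep : R) : {set G * G} :=
  [set p | [&& p.1 \in S, p.2 \in S, edge p.1 p.2
    & 2 * a p.1 + a p.2 <= 1 + 3 / 2 * rho + ep]].

Definition good_cliques (ep : R) : {set G * (G * (G * G))} :=
  [set p | let: (x, (y, (z, t))) := p in
    [&& [&& x \in S, y \in S, z \in S & t \in S],
        [&& edge x y, edge x z & edge x t], [&& edge y z, edge y t & edge z t]
      & a x + a y + a z + a t <= 2 + 2 * rho + ep]].

(* Suppose almost no edge [uv] is good.  A vertex [u] of (almost) minimum degree
   [a] has only neighbours of degree above [1 + 3/2 rho + ep - 2 a], which forces
   [a > 2/3].  Then cliques can be built greedily, always taking a common
   neighbour of (almost) minimum degree, and if no clique is good either, the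
   average degree comes out larger than [rho]. *)
Lemma good_dichotomy (ep eta : R) : 0 < ep -> ep <= 1 -> 0 < eta -> eta <= 1 ->
  (0 < #|S|)%N -> eta <= rho -> (forall x, x \in S -> rho / 2 <= a x) ->
  let th := eta * ep / 100 in
  th ^+ 4 * N ^+ 2 <= #|good_edges ep|%:R \/ th ^+ 4 * N ^+ 4 <= #|good_cliques ep|%:R.
Proof.
move=> ep0 ep1 eta0 eta1 S0 hrho hmin th.
have N0 : 0 < N by rewrite ltr0n.
have th0 : 0 < th by rewrite /th divr_gt0 // mulr_gt0.
have th1 : th <= 1 / 100 by rewrite /th; nra.
have [h|few1] := lerP (th ^+ 4 * N ^+ 2) (#|good_edges ep|%:R); first by left.
have [h|few4] := lerP (th ^+ 4 * N ^+ 4) (#|good_cliques ep|%:R); first by right.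
exfalso.
have sS (Q : pred G) : [set v in S | Q v] \subset S.
  by apply/subsetP => v; rewrite inE => /andP[].
have aN x : (dg x S)%:R = a x * N by rewrite /a mulfVK // gt_eqF.
have a1 x : a x <= 1 by rewrite /a ler_pdivrMr // mul1r ler_nat dg_le.
have a0 x : 0 <= a x by rewrite divr_ge0 // ltW.
have suma : \sum_(v in S) a v = rho * N.
  rewrite /a -mulr_suml -natr_sum -/(ar S S) /rho; field; lra.
(* By Markov's inequality all but th N vertices lie in few good edges. The clique is also chosen
   vertex by vertex outside such exceptional sets, and each coordinate spends one factor [th], which
   explains th ^ 4. *)
pose X := [set x | th * N <= #|[set y | (x, y) \in good_edges ep]|%:R] :&: S.
have cX : #|X|%:R <= th * N.
  apply: heavy_le_in; first exact: mulr_gt0.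
  apply: lt_le_trans few1 _.
  have : th ^+ 2 <= 1 by rewrite expr_le1 ?ltW //; lra.
  have : 0 <= th ^+ 2 * N ^+ 2 by rewrite mulr_ge0 ?exprn_ge0 ?ltW.
  nra.
have XS : X \subset S by exact: subsetIr.
pose H1 := [set x | th ^+ 3 * N ^+ 3 <= #|[set y | (x, y) \in good_cliques ep]|%:R] :&: S.
have cH1 : #|H1|%:R <= th * N.
  apply: heavy_le_in; first by rewrite mulr_gt0 ?exprn_gt0.
  by apply: lt_le_trans few4 _; rewrite le_eqVlt; apply/orP; left; apply/eqP; ring.
have H1S : H1 \subset S by exact: subsetIr.
have notinI (P : pred G) (x : G) : x \in S -> x \notin [set x | P x] :&: S -> ~~ P x.
  by move=> xS; rewrite !inE xS andbT.
have thN : 0 < th * N by rewrite mulr_gt0.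
have amin x : x \in S -> x \notin X -> 2 / 3 + eta * ep / 12 <= a x.
  have [u [uS uX umin]] : exists u, [/\ u \in S, u \notin X &
      forall y, y \in S -> y \notin X -> a u <= a y].
    by apply: (@exists_min R); rewrite -/N; nra.
  move=> xS xX; apply: le_trans (umin x xS xX).
  have light := notinI _ u uS uX; rewrite -ltNge in light.
  set b := 1 + 3 / 2 * rho + ep - 2 * a u.
  pose N1 := [set v in S | edge u v].
  pose E := X :|: ([set y | (u, y) \in good_edges ep] :&: S).
  have ES : E \subset S by rewrite subUset XS subsetIr.
  have cE : #|E|%:R <= 2 * th * N.
    have : #|E|%:R <= #|X|%:R + #|[set y | (u, y) \in good_edges ep]|%:R :> R.
      rewrite -natrD ler_nat; apply: leq_trans (leq_card_setU _ _) _.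
      by rewrite leq_add2l subset_leq_card // subsetIl.
    lra.
  have bN v : v \in N1 -> v \notin E -> b <= a v.
    rewrite !inE negb_or => /andP[vS uv] /andP[_]; rewrite vS uS uv andbT /=.
    by rewrite -ltNge /b => h; lra.
  have au : eta / 2 <= a u by have := hmin u uS; lra.
  have cN1 : #|N1|%:R = a u * N by rewrite -aN.
  have [v [vN vE _]] : exists v, [/\ v \in N1, v \notin E & forall y, y \in N1 -> y \notin E -> a v <= a y].
    apply: (@exists_min R); rewrite cN1; apply: le_lt_trans cE _.
    by rewrite ltr_pM2r // /th; nra.
  have b1 : b <= 1 by apply: le_trans (bN v vN vE) (a1 v).
  have vS := subsetP (sS _) v vN.
  apply: (@low_degree_ineq _ rho th ep eta) => //; first exact: hmin.
  (* The levels in [layer_sum] have to increase, but [b] may lie below [a u]. *)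
  pose b' := Num.max b (a u).
  have bb' : b <= b' by rewrite le_max lexx.
  have ab' : a u <= b' by rewrite le_max lexx orbT.
  have b'1 : b' <= 1 by rewrite ge_max b1 a1.
  have inX y : y \notin E -> y \notin X by rewrite inE negb_or => /andP[].
  have h1 y : y \in S -> y \notin E -> a u <= a y.
    by move=> yS yE; apply: umin => //; apply: inX.
  have h2 y : y \in N1 -> y \notin E -> b' <= a y.
    move=> yN yE; rewrite ge_max bN //=; apply: umin; last exact: inX.
    exact: (subsetP (sS _) y yN).
  have h3 y : y \in set0 -> y \notin E -> b' <= a y by rewrite inE.
  have := @layer_sum R G S N1 set0 set0 E a (a u) b' b' b'
    (sS _) (sub0set _) (subxx _) ES ab' (lexx _) (lexx _) b'1
    (fun v _ => a0 v) h1 h2 h3 h3.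
  rewrite suma cards0 cN1 !mulr0 !addr0 -/N => h.
  have h4 : a u + (b' - a u) * a u <= rho + 2 * th.
    rewrite -(ler_pM2r N0); move: h cE; lra.
  by have := ler_wpM2r (a0 u) bb'; rewrite /b in bb' *; lra.
(* The margin above 2/3: three degrees of at least (2/3 + nu) N leave 3 nu N common neighbours, more
   than the exceptional vertices, of which there are at most 5 th N. *)
pose nu := eta * ep / 12.
have nu0 : 0 < nu by rewrite /nu divr_gt0 // mulr_gt0.
have nth : 8 * th <= nu by rewrite /nu /th; nra.
pose E1 := X :|: H1.
have cU (A B : {set G}) : #|A :|: B|%:R <= #|A|%:R + #|B|%:R :> R.
  by rewrite -natrD ler_nat leq_card_setU.
have E1S : E1 \subset S by rewrite subUset XS.
have cE1 : #|E1|%:R <= 2 * th * N by have := cU X H1; rewrite -/E1; lra.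
have XE1 x : x \notin E1 -> x \notin X by rewrite inE negb_or => /andP[].
have [u [uS uE umin]] : exists u, [/\ u \in S, u \notin E1 &
    forall y, y \in S -> y \notin E1 -> a u <= a y].
  by apply: (@exists_min R); rewrite -/N; nra.
have lightu : #|[set y | (u, y) \in good_cliques ep]|%:R < th ^+ 3 * N ^+ 3.
  have uH : u \notin H1 by move: uE; rewrite inE negb_or => /andP[].
  by have := notinI _ u uS uH; rewrite -ltNge.
have au := amin u uS (XE1 _ uE); rewrite -/nu in au.
pose N1 := [set v in S | edge u v].
have N1S : N1 \subset S := sS _.
have cN1 : #|N1|%:R = a u * N by rewrite -aN.
pose P2 := [set y : G * (G * G) | (u, y) \in good_cliques ep].
pose H2 := [set x | th ^+ 2 * N ^+ 2 <= #|[set y | (x, y) \in P2]|%:R] :&: S.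
have H2S : H2 \subset S by exact: subsetIr.
have cH2 : #|H2|%:R <= th * N.
  apply: heavy_le_in; first by rewrite mulr_gt0 ?exprn_gt0.
  by apply: lt_le_trans lightu _; rewrite le_eqVlt; apply/orP; left; apply/eqP; ring.
pose E2 := E1 :|: H2.
have E2S : E2 \subset S by rewrite subUset E1S.
have cE2 : #|E2|%:R <= 3 * th * N by have := cU E1 H2; rewrite -/E2; lra.
have E12 x : x \notin E2 -> x \notin E1 by rewrite [x \in E2]inE negb_or => /andP[].
have [v [vN vE vmin]] : exists v, [/\ v \in N1, v \notin E2 &
    forall y, y \in N1 -> y \notin E2 -> a v <= a y].
  apply: (@exists_min R); rewrite cN1; apply: le_lt_trans cE2 _.
  by rewrite ltr_pM2r //; lra.
have vS := subsetP N1S v vN.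
have lightv : #|[set y | (v, y) \in P2]|%:R < th ^+ 2 * N ^+ 2.
  have vH : v \notin H2 by move: vE; rewrite [v \in E2]inE negb_or => /andP[].
  by have := notinI _ v vS vH; rewrite -ltNge.
have av := amin v vS (XE1 _ (E12 _ vE)); rewrite -/nu in av.
have auv : a u <= a v by apply: umin => //; apply: E12.
pose N2 := [set w in N1 | edge v w].
have N21 : N2 \subset N1 by apply/subsetP => w; rewrite inE => /andP[].
have cN2 : (a u + a v - 1) * N <= #|N2|%:R.
  have e : N2 = N1 :&: [set w in S | edge v w].
    by apply/setP => w; rewrite !inE; case: (w \in S); rewrite ?andbF.
  have := card_cap N1S (sS (fun w => edge v w)); rewrite -e -(ler_nat R) !natrD cN1 -/N.
  rewrite -/(dg v S) aN; lra.
pose P3 := [set y : G * G | (v, y) \in P2].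
pose H3 := [set x | th * N <= #|[set y | (x, y) \in P3]|%:R] :&: S.
have H3S : H3 \subset S by exact: subsetIr.
have cH3 : #|H3|%:R <= th * N.
  apply: heavy_le_in => //.
  by apply: lt_le_trans lightv _; rewrite le_eqVlt; apply/orP; left; apply/eqP; ring.
pose E3 := E2 :|: H3.
have E3S : E3 \subset S by rewrite subUset E2S.
have cE3 : #|E3|%:R <= 4 * th * N by have := cU E2 H3; rewrite -/E3; lra.
have E23 x : x \notin E3 -> x \notin E2 by rewrite [x \in E3]inE negb_or => /andP[].
have [w [wN wE wmin]] : exists w, [/\ w \in N2, w \notin E3 &
    forall y, y \in N2 -> y \notin E3 -> a w <= a y].
  apply: (@exists_min R); apply: lt_le_trans cN2; apply: le_lt_trans cE3 _.
  by rewrite ltr_pM2r //; lra.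
have wN1 := subsetP N21 w wN.
have wS := subsetP N1S w wN1.
have lightw : #|[set y | (w, y) \in P3]|%:R < th * N.
  have wH : w \notin H3 by move: wE; rewrite [w \in E3]inE negb_or => /andP[].
  by have := notinI _ w wS wH; rewrite -ltNge.
have avw : a v <= a w by apply: vmin => //; apply: E23.
pose N3 := [set t in N2 | edge w t].
have N32 : N3 \subset N2 by apply/subsetP => t; rewrite inE => /andP[].
have N2S := subset_trans N21 N1S.
have cN3 : (a u + a v + a w - 2) * N <= #|N3|%:R.
  have e : N3 = N2 :&: [set t in S | edge w t].
    apply/setP => t; rewrite !inE; case: (t \in S); rewrite ?andbF //.
  have := card_cap N2S (sS (fun t => edge w t)); rewrite -e -(ler_nat R) !natrD -/N.
  rewrite -/(dg w S) aN; lra.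
pose E4 := E3 :|: ([set y | (w, y) \in P3] :&: S).
have E4S : E4 \subset S by rewrite subUset E3S subsetIr.
have cE4 : #|E4|%:R <= 5 * th * N.
  have := cU E3 ([set y | (w, y) \in P3] :&: S); rewrite -/E4.
  have : #|[set y | (w, y) \in P3] :&: S|%:R <= #|[set y | (w, y) \in P3]|%:R :> R.
    by rewrite ler_nat subset_leq_card // subsetIl.
  lra.
have E34 x : x \notin E4 -> x \notin E3 by rewrite [x \in E4]inE negb_or => /andP[].
set b := 2 + 2 * rho + ep - (a u + a v + a w).
have bN t : t \in N3 -> t \notin E4 -> b <= a t.
  move=> tN3 tE4; move: (tN3); rewrite !inE => /andP[/andP[/andP[tS ut] vt] wt].
  have : t \notin [set y | (w, y) \in P3] :&: S.
    by move: tE4; rewrite [t \in E4]inE negb_or => /andP[].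
  rewrite [t \in _]inE tS andbT [t \in _]inE [_ \in P3]inE [_ \in P2]inE [_ \in good_cliques ep]inE /=.
  move: wN vN; rewrite !inE => /andP[/andP[_ uw] vw] /andP[_ uv].
  rewrite uS vS wS tS uv uw ut vw vt wt /= -ltNge => h; rewrite /b; lra.
have [t [tN tE _]] : exists t, [/\ t \in N3, t \notin E4 &
    forall y, y \in N3 -> y \notin E4 -> a t <= a y].
  apply: (@exists_min R); apply: lt_le_trans cN3; apply: le_lt_trans cE4 _.
  by rewrite ltr_pM2r //; lra.
pose b' := Num.max b (a w).
have bb' : b <= b' by rewrite le_max lexx.
have ab' : a w <= b' by rewrite le_max lexx orbT.
have b'1 : b' <= 1 by rewrite ge_max a1 andbT; apply: le_trans (bN t tN tE) (a1 t).
have h1 y : y \in S -> y \notin E4 -> a u <= a y.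
  by move=> yS yE; apply: umin => //; apply/E12/E23/E34.
have h2 y : y \in N1 -> y \notin E4 -> a v <= a y.
  by move=> yS yE; apply: vmin => //; apply/E23/E34.
have h3 y : y \in N2 -> y \notin E4 -> a w <= a y.
  by move=> yS yE; apply: wmin => //; apply/E34.
have h4 y : y \in N3 -> y \notin E4 -> b' <= a y.
  move=> yN yE; rewrite ge_max bN //=; apply: wmin; last exact: E34.
  exact: (subsetP N32 y yN).
have := @layer_sum R G S N1 N2 N3 E4 a (a u) (a v) (a w) b' N1S N21 N32 E4S
  auv avw ab' b'1 (fun v _ => a0 v) h1 h2 h3 h4.
rewrite suma cN1 -/N => h.
apply: (@no_clique_ineq (a u) (a v) (a w) b' rho th ep (a u) (#|N2|%:R / N) (#|N3|%:R / N)) => //.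
- lra.
- by rewrite /b in bb'; lra.
- by rewrite ler_pdivlMr.
- by rewrite ler_pdivlMr.
- by rewrite /th; nra.
rewrite -(ler_pM2r N0).
have -> : (a u + (a v - a u) * a u + (a w - a v) * (#|N2|%:R / N) + (b' - a w) * (#|N3|%:R / N)) * N
  = a u * N + (a v - a u) * (a u * N) + (a w - a v) * #|N2|%:R + (b' - a w) * #|N3|%:R.
  by field; lra.
lra.
Qed.

End Dichotomy.

(** * Greedy packing of disjoint blocks *)

Section Packing.
Variable R : realType.

Lemma exists_subset_card (T : finType) (Y : {set T}) (k : nat) : (k <= #|Y|)%N ->
  exists2 B : {set T}, B \subset Y & #|B| = k.
Proof.
move=> kY; exists [set x in take k (enum Y)].
  by apply/subsetP => x; rewrite inE => /mem_take; rewrite mem_enum.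
rewrite cardsE; have /card_uniqP-> : uniq (take k (enum Y)) by rewrite take_uniq ?enum_uniq.
by rewrite size_take -cardE; case: ltngtP kY.
Qed.

Lemma sum_le_max (T : finType) (A : {set T}) (a : T -> R) : A != set0 ->
  exists2 x, x \in A & \sum_(v in A) a v <= #|A|%:R * a x.
Proof.
move=> nA.
have [x [xA _ mx]] : exists x, [/\ x \in A, x \notin set0 &
    forall y, y \in A -> y \notin set0 -> - a x <= - a y].
  by apply: (@exists_min R); rewrite cards0 ltr_nat card_gt0.
exists x => //; rewrite mulr_natl -sumr_const; apply: ler_sum => y yA.
by have := mx y yA; rewrite inE lerN2 => ->.
Qed.

Definition complete_between (G : sgraph) (A B : {set G}) : Prop :=
  forall a b, a \in A -> b \in B -> edge a b.

Lemma complete_disjoint (G : sgraph) (A B : {set G}) :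
  complete_between A B -> [disjoint A & B].
Proof.
move=> h; rewrite -setI_eq0; apply/eqP/setP => x; rewrite !inE.
by apply/negP => /andP[xA xB]; have := h x x xA xB; rewrite edge_irr.
Qed.

(* The two ways of hosting a piece of [H]: its part of the vertex cover goes to
   the small side of [K_(4q, 2q)], or its colour classes go to the four parts of
   a complete 4-partite graph. *)
Definition block (G : sgraph) (q : nat) (T : {set G}) : Prop :=
  (exists A B : {set G}, [/\ A \subset T, B \subset T, #|A| = (4 * q)%N, #|B| = (2 * q)%N
     & complete_between A B]) \/
  (exists A : 'I_4 -> {set G}, [/\ forall p, A p \subset T, forall p, #|A p| = q
     & forall p p', p != p' -> complete_between (A p) (A p')]).

Lemma edge_block (q : nat) (c : R) : 0 < c -> c <= 1 -> exists N0 : nat,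
  forall (G : sgraph) (S : {set G}) (P : {set G * G}), (N0 <= #|S|)%N ->
  (forall p, p \in P -> [&& p.1 \in S, p.2 \in S & edge p.1 p.2]) ->
  c * #|S|%:R ^+ 2 <= #|P|%:R ->
  exists A B : {set G}, [/\ A \subset S, B \subset S, #|A| = (4 * q)%N, #|B| = (2 * q)%N
     & forall a b, a \in A -> b \in B -> (a, b) \in P].
Proof.
move=> c0 c1.
have [n1 h1] := exists_nat_ge (16 * q%:R / c); have [n2 h2] := exists_nat_ge (8 / c).
have b0 := box_rate_gt0 (4 * q) c0.
have [n3 h3] := exists_nat_ge (2 * q%:R / box_rate (4 * q) c).
exists (n1 + n2 + n3)%N => G S P hN hP hc.
have nR : n1%:R + n2%:R + n3%:R <= #|S|%:R :> R by rewrite -!natrD ler_nat.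
have [p1 p2 p3] : [/\ 0 <= n1%:R :> R, 0 <= n2%:R :> R & 0 <= n3%:R :> R] by [].
have [||||A [Y [sA cA sY hAY cY]]] := @box R G G S S P c (4 * q) c0 c1.
- by apply/subsetP => p /hP; rewrite [p]surjective_pairing in_setX => /and3P[-> ->].
- by rewrite -mulrA -expr2.
- have : 16 * q%:R / c <= #|S|%:R by lra.
  by rewrite ler_pdivrMr // natrM; lra.
- have : 8 / c <= #|S|%:R by lra.
  by rewrite ler_pdivrMr //; lra.
have [|B sB cB] := @exists_subset_card G Y (2 * q).
  rewrite -(ler_nat R); apply: le_trans cY.
  have : 2 * q%:R / box_rate (4 * q) c <= #|S|%:R by lra.
  by rewrite ler_pdivrMr // natrM [_ * box_rate _ _]mulrC.
exists A, B; split=> //; first exact: subset_trans sB sY.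
by move=> a b aA /(subsetP sB); apply: hAY.
Qed.

(** [box] is applied to one coordinate after the other. The proportion that it preserves is the
    density for the next round, and the last part is any [q] elements of what remains. *)
Lemma clique_block (q : nat) (c : R) : 0 < c -> c <= 1 -> exists N0 : nat,
  forall (G : sgraph) (S : {set G}) (P : {set G * (G * (G * G))}), (N0 <= #|S|)%N ->
  P \subset setX S (setX S (setX S S)) ->
  c * #|S|%:R ^+ 4 <= #|P|%:R ->
  exists A B C D : {set G}, [/\ [/\ A \subset S, B \subset S, C \subset S & D \subset S],
     [/\ #|A| = q, #|B| = q, #|C| = q & #|D| = q]
     & forall a b x y, a \in A -> b \in B -> x \in C -> y \in D -> (a, (b, (x, y))) \in P].
Proof.
move=> c0 c1.
have rle1 (x : R) : 0 < x -> x <= 1 -> box_rate q x <= 1.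
  move=> x0 x1; rewrite /box_rate; have : (x / 8) ^+ q <= 1 by apply: exprn_ile1; lra.
  have : 0 <= (x / 8) ^+ q by rewrite exprn_ge0 //; lra.
  nra.
pose c2 := box_rate q c; have c20 : 0 < c2 := box_rate_gt0 q c0.
have c21 : c2 <= 1 by apply: rle1.
pose c3 := box_rate q c2; have c30 : 0 < c3 := box_rate_gt0 q c20.
have c31 : c3 <= 1 by apply: rle1.
pose c4 := box_rate q c3; have c40 : 0 < c4 := box_rate_gt0 q c30.
have [n1 h1] := exists_nat_ge ((4 * q%:R + 8) / c).
have [n2 h2] := exists_nat_ge ((4 * q%:R + 8) / c2).
have [n3 h3] := exists_nat_ge ((4 * q%:R + 8) / c3).
have [n4 h4] := exists_nat_ge (q%:R / c4).
exists (n1 + n2 + n3 + n4)%N => G S P hN sP hc; set N : R := #|S|%:R in hc.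
have nR : n1%:R + n2%:R + n3%:R + n4%:R <= N by rewrite -!natrD ler_nat.
have [p1 p2 p3] : [/\ 0 <= n1%:R :> R, 0 <= n2%:R :> R & 0 <= n3%:R :> R] by [].
have p4 : 0 <= n4%:R :> R by [].
have q0 : 0 <= q%:R :> R by [].
have g1 : 4 * q%:R + 8 <= c * N by rewrite [c * N]mulrC -ler_pdivrMr //; lra.
have g2 : 4 * q%:R + 8 <= c2 * N by rewrite [c2 * N]mulrC -ler_pdivrMr //; lra.
have g3 : 4 * q%:R + 8 <= c3 * N by rewrite [c3 * N]mulrC -ler_pdivrMr //; lra.
have g4 : q%:R <= c4 * N by rewrite [c4 * N]mulrC -ler_pdivrMr //; lra.
clear nR h1 h2 h3 h4 p1 p2 p3 p4.
have [|||A [Y1 [sA cA sY1 hA cY1]]] := @box R G _ S _ P c q c0 c1 sP.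
- by rewrite !cardsX !natrM -/N; move: hc; rewrite !exprS expr0 mulr1 !mulrA.
- by rewrite -/N; lra.
- by rewrite -/N; lra.
rewrite !cardsX !natrM -/N -/c2 in cY1.
have [|||B [Y2 [sB cB sY2 hB cY2]]] := @box R G _ S _ Y1 c2 q c20 c21 sY1.
- by rewrite !cardsX !natrM -/N; move: cY1; rewrite !mulrA.
- by rewrite -/N; lra.
- by rewrite -/N; lra.
rewrite !cardsX !natrM -/N -/c3 in cY2.
have [|||C [Y3 [sC cC sY3 hC cY3]]] := @box R G _ S _ Y2 c3 q c30 c31 sY2.
- by rewrite -/N; move: cY2; rewrite !mulrA.
- by rewrite -/N; lra.
- by rewrite -/N; lra.
rewrite -/N -/c4 in cY3.
have [|D sD cD] := @exists_subset_card G Y3 q.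
  by rewrite -(ler_nat R); apply: le_trans cY3.
exists A, B, C, D; split=> //; first by split=> //; apply: subset_trans sD sY3.
by move=> a b x y aA bB xC /(subsetP sD) yD; apply: hA => //; apply: hB => //; apply: hC.
Qed.

(** Removing [T] destroys at most 2 ar T S arcs. The first term on the right is what leaves
    [ar S S / |S|] unchanged, and the second charges 4q (1 + ep) to it, for blocks of either
    kind. *)
Lemma step_block (ep eta : R) (q : nat) : 0 < ep -> ep <= 1 -> 0 < eta -> eta <= 1 ->
  (0 < q)%N -> exists N0 : nat, forall (G : sgraph) (S : {set G}),
  (N0 <= #|S|)%N -> eta * #|S|%:R ^+ 2 <= (ar S S)%:R ->
  (forall x, x \in S -> ar S S <= 2 * dg x S * #|S|)%N ->
  exists T : {set G}, [/\ T \subset S, block q T, (#|T| <= 6 * q)%N &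
    2 * (ar T S)%:R <= (ar S S)%:R / #|S|%:R * #|T|%:R
      + 4 * q%:R * (1 + ep) * #|S|%:R :> R].
Proof.
move=> ep0 ep1 eta0 eta1 q0; set th := eta * ep / 100.
have th0 : 0 < th by rewrite /th divr_gt0 // mulr_gt0.
have th1 : th <= 1 by rewrite /th; nra.
have c0 : 0 < th ^+ 4 by rewrite exprn_gt0.
have c1 : th ^+ 4 <= 1 by rewrite exprn_ile1 // ltW.
have [n1 h1] := edge_block q c0 c1; have [n2 h2] := clique_block q c0 c1.
exists (n1 + n2 + 1)%N => G S hN har hmin.
have [hN1 hN2 cS] : [/\ (n1 <= #|S|)%N, (n2 <= #|S|)%N & (0 < #|S|)%N].
  by clear -hN; split; lia.
set N : R := #|S|%:R; set rho := (ar S S)%:R / N ^+ 2.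
have N0 : 0 < N by rewrite ltr0n.
pose a x : R := (dg x S)%:R / N.
have sum_a (T : {set G}) : (ar T S)%:R = (\sum_(v in T) a v) * N.
  by rewrite /a -mulr_suml mulfVK ?gt_eqF // natr_sum.
have rhoN : (ar S S)%:R / N = rho * N by rewrite /rho; field; lra.
have hrho : eta <= rho by rewrite /rho ler_pdivlMr // exprn_gt0.
have hmin' x : x \in S -> rho / 2 <= a x.
  move=> xS; have := hmin x xS; rewrite -(ler_nat R) !natrM -/N => h.
  rewrite /rho /a ler_pdivlMr //.
  have -> : (ar S S)%:R / N ^+ 2 / 2 * N = (ar S S)%:R / (2 * N) by field; lra.
  by rewrite ler_pdivrMr ?mulr_gt0 //; lra.
have [hE|hC] := good_dichotomy ep0 ep1 eta0 eta1 cS hrho hmin'.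
- have [|A [B [sA sB cA cB hAB]]] := h1 G S (good_edges S ep) hN1 _ hE.
    by move=> p; rewrite inE => /and4P[-> -> ->].
  have cAB : complete_between A B.
    by move=> x y xA yB; have := hAB x y xA yB; rewrite inE /= => /and4P[].
  have dAB := complete_disjoint cAB.
  have cT := cards_cup erefl dAB.
  exists (A :|: B); split.
  + by rewrite subUset sA.
  + by left; exists A, B; rewrite subsetUl subsetUr.
  + by rewrite cT cA cB -mulnDl.
  (* The vertices of largest degree in [A] and in [B] are themselves joined by a good edge, so the
     bound for one edge controls the sum over the block. *)
  have [x xA hx] := @sum_le_max G A a ltac:(by rewrite -card_gt0 cA ?muln_gt0).
  have [y yB hy] := @sum_le_max G B a ltac:(by rewrite -card_gt0 cB ?muln_gt0).
  have := hAB x y xA yB; rewrite inE /= => /and4P[_ _ _ hxy].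
  rewrite sum_a rhoN cT big_disjU //= cA cB natrD !natrM.
  rewrite cA natrM in hx; rewrite cB natrM in hy.
  rewrite -/N -/rho -/(a x) -/(a y) in hxy.
  have q1 : 0 < q%:R :> R by rewrite ltr0n.
  rewrite [X in _ <= X](_ : _ = (rho * (4 * q%:R + 2 * q%:R) + 4 * q%:R * (1 + ep)) * N); last by ring.
  rewrite mulrA ler_pM2r //.
  have := ler_wpM2l (ltW q1) hxy; lra.
have [|A [B [C [D [[sA sB sC sD] [cA cB cC cD] hABCD]]]]] := h2 G S (good_cliques S ep) hN2 _ hC.
  apply/subsetP => -[x [y [z t]]]; rewrite inE => /and4P[/and4P[? ? ? ?] _ _ _].
  by rewrite !in_setX; apply/and4P.
have ex (Z : {set G}) : #|Z| = q -> exists z, z \in Z.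
  by move=> cZ; apply/set0Pn; rewrite -card_gt0 cZ.
have [[x0 xA] [y0 yB]] := (ex A cA, ex B cB); have [[z0 zC] [t0 tD]] := (ex C cC, ex D cD).
have AB : complete_between A B.
  move=> x y h h'; have := hABCD x y z0 t0 h h' zC tD; rewrite inE.
  by case/and4P=> _ /and3P[].
have AC : complete_between A C.
  move=> x y h h'; have := hABCD x y0 y t0 h yB h' tD; rewrite inE.
  by case/and4P=> _ /and3P[].
have AD : complete_between A D.
  move=> x y h h'; have := hABCD x y0 z0 y h yB zC h'; rewrite inE.
  by case/and4P=> _ /and3P[].
have BC : complete_between B C.
  move=> x y h h'; have := hABCD x0 x y t0 xA h h' tD; rewrite inE.
  by case/and4P=> _ _ /and3P[].
have BD : complete_between B D.
  move=> x y h h'; have := hABCD x0 x z0 y xA h zC h'; rewrite inE.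
  by case/and4P=> _ _ /and3P[].
have CD : complete_between C D.
  move=> x y h h'; have := hABCD x0 y0 x y xA yB h h'; rewrite inE.
  by case/and4P=> _ _ /and3P[].
have sym (X Y : {set G}) : complete_between X Y -> complete_between Y X.
  by move=> h x y xX yY; rewrite edge_sym; apply: h.
have d1 : [disjoint A :|: (B :|: C) & D].
  by rewrite !disjUl !complete_disjoint.
have d2 : [disjoint A & B :|: C].
  by rewrite disjoint_sym disjUl !complete_disjoint //; apply: sym.
have d3 := complete_disjoint BC.
pose F (p : 'I_4) := nth set0 [:: A; B; C; D] p.
exists (A :|: (B :|: C) :|: D); split.
- by rewrite !subUset sA sB sC sD.
- right; exists F; split.
  + move=> [[|[|[|[|p]]]] hp] //; rewrite /F /=; apply/subsetP => x;
      by rewrite !inE => ->; rewrite ?orbT.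
  + by move=> [[|[|[|[|p]]]] hp] //; rewrite /F /=.
  by move=> [[|[|[|[|p]]]] hp] // [[|[|[|[|p']]]] hp'] // _; rewrite /F /=; auto.
- by rewrite (cards_cup erefl d1) (cards_cup erefl d2) (cards_cup erefl d3) cA cB cC cD; clear; lia.
have [x xA' hx] := @sum_le_max G A a ltac:(by rewrite -card_gt0 cA ?muln_gt0).
have [y yB' hy] := @sum_le_max G B a ltac:(by rewrite -card_gt0 cB ?muln_gt0).
have [z zC' hz] := @sum_le_max G C a ltac:(by rewrite -card_gt0 cC ?muln_gt0).
have [t tD' ht] := @sum_le_max G D a ltac:(by rewrite -card_gt0 cD ?muln_gt0).
have := hABCD x y z t xA' yB' zC' tD'; rewrite inE /= => /and4P[_ _ _ hxy].
rewrite sum_a rhoN (cards_cup erefl d1) (cards_cup erefl d2) (cards_cup erefl d3) !big_disjU //=.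
rewrite cA in hx *; rewrite cB in hy *; rewrite cC in hz *; rewrite cD in ht *.
rewrite -/N -/rho -/(a x) -/(a y) -/(a z) -/(a t) in hxy.
have q1 : 0 < q%:R :> R by rewrite ltr0n.
rewrite !natrD [X in _ <= X](_ : _ = (rho * (4 * q%:R) + 4 * q%:R * (1 + ep)) * N); last by ring.
rewrite mulrA ler_pM2r //.
have := ler_wpM2l (ltW q1) hxy.
have := mulr_gt0 q1 ep0.
clear - hx hy hz ht; move: hx hy hz ht; lra.
Qed.

(** A subset [S'] maximizing ar S' S' / |S'| has all degrees at least half of this ratio, so
    [step_block] applies to it and lowers the ratio by at most 4q (1 + ep). The bound [Nm] on all
    sizes stays fixed in the induction: D >= eta * Nm keeps [S'] both dense and large. *)
Lemma pack (ep eta : R) (q : nat) : 0 < ep -> ep <= 1 -> 0 < eta -> eta <= 1 ->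
  (0 < q)%N -> exists N0 : R, forall (r : nat) (G : sgraph) (S : {set G}) (D Nm : R),
  S != set0 -> #|S|%:R <= Nm -> N0 <= Nm ->
  eta * Nm + r%:R * (4 * q%:R * (1 + ep)) <= D -> D * #|S|%:R <= (ar S S)%:R ->
  exists T : nat -> {set G}, (forall b, (b < r)%N -> block q (T b) /\ T b \subset S) /\
    forall b b', (b < b')%N -> (b' < r)%N -> [disjoint T b & T b'].
Proof.
move=> ep0 ep1 eta0 eta1 q0.
(* The other half of [ep] absorbs the division by |S'| - |T| instead of |S'|; see [key]. *)
have e0 : 0 < ep / 2 by lra.
have e1 : ep / 2 <= 1 by lra.
have [N0 step] := step_block e0 e1 eta0 eta1 q0.
exists ((N0%:R + 24 * q%:R / ep + 1) / eta).
elim=> [|r IH] G S D Nm S0 SNm hNm hD hS.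
  by exists (fun=> set0).
have cpos (Z : {set G}) : Z != set0 -> 0 < #|Z|%:R :> R.
  by rewrite ltr0n card_gt0.
have [S' [sS' S'0 maxS']] :=
  exists_max_set (fun Z : {set G} => (ar Z Z)%:R / #|Z|%:R : R) S0.
set N : R := #|S'|%:R; have Np : 0 < N := cpos _ S'0.
pose D1 := (ar S' S')%:R / N.
have arD1 : (ar S' S')%:R = D1 * N by rewrite /D1 mulfVK ?gt_eqF.
have DD1 : D <= D1.
  by apply: le_trans (maxS' _ (subxx _) S0); rewrite ler_pdivlMr ?cpos.
have D1N : D1 <= N.
  by rewrite /D1 ler_pdivrMr // -natrM ler_nat ar_le.
have NNm : N <= Nm by apply: le_trans SNm; rewrite ler_nat subset_leq_card.
have q1 : 0 < q%:R :> R by rewrite ltr0n.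
have qe : 0 < 4 * q%:R * (1 + ep) by rewrite !mulr_gt0 //; lra.
have r0 : 0 <= r%:R :> R by [].
rewrite -[r.+1%:R]natr1 mulrDl mul1r in hD.
have rq : 0 <= r%:R * (4 * q%:R * (1 + ep)) by rewrite mulr_ge0 // ltW.
have etaD : eta * Nm <= D by lra.
have hNm' : N0%:R + 24 * q%:R / ep + 1 <= eta * Nm by rewrite [eta * _]mulrC -ler_pdivrMr.
have qep : 0 <= 24 * q%:R / ep by rewrite divr_ge0 ?mulr_ge0 // ltW.
have N00 : 0 <= N0%:R :> R by [].
have bigN : N0%:R + 24 * q%:R / ep + 1 <= N by lra.
have NN0 : (N0 <= #|S'|)%N by rewrite -(ler_nat R) -/N; lra.
have dens : eta * N ^+ 2 <= (ar S' S')%:R.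
  rewrite arD1 expr2 mulrA ler_pM2r //; apply: le_trans DD1; apply: le_trans etaD.
  by rewrite ler_pM2l.
have mindeg x : x \in S' -> (ar S' S' <= 2 * dg x S' * #|S'|)%N.
  move=> xS'; have sx : [set x] \subset S' by rewrite sub1set.
  have := ar_setD sx; rewrite ar1 -(ler_nat R) natrD natrM arD1 => h.
  have cS'x : #|S' :\ x|%:R = N - 1 :> R.
    by rewrite /N (cardsD1 x S') xS' natrD addrAC subrr add0r.
  have nx : S' :\ x != set0 by rewrite -card_gt0 -(ltr0n R) cS'x; lra.
  have := maxS' (S' :\ x) (subset_trans (subD1set _ _) sS') nx.
  rewrite -/N -/D1 ler_pdivrMr ?cpos // cS'x => h2.
  rewrite -(ler_nat R) !natrM arD1 -/N ler_pM2r //; lra.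
have [T [sT bT cT sumT]] := step G S' NN0 dens mindeg.
rewrite -/N -/D1 in sumT.
have cST : #|S' :\: T|%:R = N - #|T|%:R :> R.
  by rewrite /N -(cardsID T S') (setIidPr sT) natrD addrAC subrr add0r.
have cT' : #|T|%:R <= 6 * q%:R :> R by rewrite -natrM ler_nat.
have epN : 24 * q%:R <= ep * N by rewrite [ep * _]mulrC -ler_pdivrMr //; lra.
have STp : 0 < N - #|T|%:R by nra.
have [|||||T' [hT' dT']] := IH G (S' :\: T) (D1 - 4 * q%:R * (1 + ep)) Nm.
- by rewrite -card_gt0 -(ltr0n R) cST.
- by rewrite cST; have : 0 <= #|T|%:R :> R by []; lra.
- by [].
- lra.
- have := ar_setD sT; rewrite -(ler_nat R) natrD natrM arD1 cST => h.
  have key : (1 + ep / 2) * N <= (1 + ep) * (N - #|T|%:R) by nra.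
  have := ler_wpM2l (ltW q1) key; lra.
exists (fun b => if b == r then T else T' b); split.
  move=> b; rewrite ltnS leq_eqVlt; case: eqP => [_ _|_ /= /hT'[b1 b2]].
    by split=> //; apply: subset_trans sT sS'.
  by split=> //; apply: subset_trans b2 _; apply: subset_trans sS'; apply: subsetDl.
move=> b b' bb' b'r; case: eqP => [br|_]; first by move: bb' b'r; rewrite br ltnS => /leq_trans h /h; rewrite ltnn.
case: eqP => [b'r'|b'r']; last by apply: dT' => //; rewrite ltn_neqAle -ltnS b'r andbT; apply/eqP.
have /hT'[_ sTb] : (b < r)%N by rewrite -b'r'.
by apply: disjointWl sTb _; rewrite disjoint_sym disjD.
Qed.

End Packing.

(** * Gluing hosted pieces *)

Section Disjoint.
Variable T : finType.
Implicit Types (A B : {set T}).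

Lemma disjointI' A B : (forall x, x \in A -> x \in B -> False) -> [disjoint A & B].
Proof.
move=> h; rewrite -setI_eq0; apply/eqP/setP => x; rewrite !inE.
by apply/negP => /andP[]; apply: h.
Qed.

Lemma disjoint_false A B x : [disjoint A & B] -> x \in A -> x \in B -> False.
Proof. by move=> /disjointFr h /h ->. Qed.

End Disjoint.

Section RoundRobin.

(** The items of each type are dealt to the bins in turn, so a bin gets at most one more than the
    average of each type. As [w] comes after [be], all weights depending on the type are balanced at
    once. *)
Lemma round_robin (I Ty Bn : finType) (ty : I -> Ty) : (0 < #|Bn|)%N ->
  exists be : I -> Bn, forall (w : Ty -> nat) b,
  ((\sum_(i | be i == b) w (ty i)) * #|Bn| <= \sum_i w (ty i) + #|Bn| * \sum_y w y)%N.
Proof.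
move=> k0; set k := #|Bn| in k0 *.
pose cl y := [set i | ty i == y].
pose pos i := index i (enum (cl (ty i))).
pose be i : Bn := enum_val (Ordinal (ltn_pmod (pos i) k0)).
exists be => w b.
have cnt y : (#|[set i | (ty i == y) && (be i == b)]| * k <= #|cl y| + k)%N.
  set X := [set i | _].
  pose f i : 'I_(#|cl y| %/ k).+1 := inord (pos i %/ k).
  have posE i : i \in X -> (pos i < #|cl y|)%N /\ (pos i = pos i %/ k * k + enum_rank b)%N.
    rewrite inE => /andP[/eqP tyi /eqP beb]; split.
      by rewrite /pos tyi cardE index_mem mem_enum inE tyi.
    by rewrite -beb enum_valK /=; apply: divn_eq.
  have finj : {in X &, injective f}.
    move=> i j iX jX /(congr1 val) /=.
    have [pi ei] := posE i iX; have [pj ej] := posE j jX.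
    rewrite !inordK ?ltnS ?leq_div2r ?(ltnW pi) ?(ltnW pj) // => eq.
    have pij : pos i = pos j by rewrite ei ej eq.
    move: iX jX; rewrite !inE => /andP[/eqP ti _] /andP[/eqP tj _].
    have := @index_inj _ i (enum (cl y)) i j; rewrite !mem_enum !inE ti tj eqxx.
    by apply=> //; move: pij; rewrite /pos ti tj.
  have : (#|X| <= (#|cl y| %/ k).+1)%N.
    by rewrite -(card_in_imset finj) (leq_trans (max_card _)) // card_ord.
  move=> h; apply: leq_trans (leq_mul h (leqnn k)) _.
  by rewrite mulSn addnC leq_add2r leq_trunc_div.
have e1 : (\sum_(i | be i == b) w (ty i) = \sum_y w y * #|[set i | (ty i == y) && (be i == b)]|)%N.
  rewrite (partition_big ty predT) //=; apply: eq_bigr => y _.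
  rewrite mulnC -sum_nat_const; apply: eq_big => i; first by rewrite inE andbC.
  by case/andP => _ /eqP->.
have e2 : (\sum_i w (ty i) = \sum_y w y * #|cl y|)%N.
  rewrite (partition_big ty predT) //=; apply: eq_bigr => y _.
  rewrite mulnC -sum_nat_const; apply: eq_big => i; first by rewrite inE.
  by move=> /eqP->.
rewrite e1 e2 big_distrl big_distrr /= -big_split /=; apply: leq_sum => y _.
by rewrite -mulnA [(k * _)%N]mulnC -mulnDr leq_mul2l cnt orbT.
Qed.

Lemma inj_into (T U : finType) (Y : {set T}) (A : {set U}) : (0 < #|A|)%N ->
  (#|Y| <= #|A|)%N ->
  exists2 f : T -> U, forall y, f y \in A & {in Y &, injective f}.
Proof.
rewrite card_gt0 => /set0Pn[u0 u0A] h.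
pose f y := if y \in Y then nth u0 (enum A) (index y (enum Y)) else u0.
have ix y : y \in Y -> (index y (enum Y) < size (enum A))%N.
  by move=> yY; rewrite -cardE (leq_trans _ h) // cardE index_mem mem_enum.
exists f => [y|y y' yY y'Y].
  by rewrite /f; case: ifP => // yY; rewrite -mem_enum mem_nth ?ix.
rewrite /f yY y'Y => /eqP; rewrite nth_uniq ?enum_uniq ?ix // => /eqP.
by have := @index_inj _ y (enum Y) y y'; rewrite !mem_enum; apply.
Qed.

End RoundRobin.

(** * Distributing the pieces among the blocks *)

Section Embedding.
Variables (H G : sgraph) (I : finType) (P : I -> {set H}) (K : nat).
Variables (C : {set H}) (col : H -> 'I_4).
Hypothesis PK : forall i, (#|P i| <= K)%N.
Hypothesis PH : forall x, exists i, x \in P i.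
Hypothesis PE : forall x y, edge x y -> exists i, x \in P i /\ y \in P i.
Hypothesis HC : vertex_cover C.
Hypothesis Hcol : forall x y, edge x y -> col x != col y.

Definition copies : {set I * H} := [set y | y.2 \in P y.1].

Lemma card_copies (Q : pred I) (Z : I -> {set H}) :
  #|[set y : I * H | Q y.1 && (y.2 \in Z y.1)]| = (\sum_(i | Q i) #|Z i|)%N.
Proof.
rewrite card_fibers [RHS]big_mkcond /=; apply: eq_bigr => i _.
case Qi : (Q i); last by apply/eqP; rewrite cards_eq0; apply/eqP/setP => x; rewrite !inE Qi.
by congr #|pred_of_set _|; apply/setP => x; rewrite !inE Qi.
Qed.

(** The rounding error of [round_robin] per bin. A type records the sizes of the four colour classes
    of a piece and of its part of the cover, each at most [K], and the weights in use are at most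
    [4 * K]. *)
Definition type_bound : nat := (#|{: {ffun 'I_4 -> 'I_K.+1} * 'I_K.+1}| * (4 * K))%N.

(** A bin is a block together with a cyclic shift of the colours. Pieces of one type spread evenly
    over the four shifts, so every part of a 4-partite block receives about a quarter of the
    vertices, however unbalanced the colouring of [H] is. *)
Lemma balanced_assignment (q r : nat) : (0 < r)%N ->
  (\sum_i #|P i| + 4 * r * type_bound <= 4 * r * q)%N ->
  (\sum_i #|P i :&: C| + 4 * r * type_bound <= 2 * r * q)%N ->
  exists be : I -> 'I_r * 'I_4, forall b,
    [/\ (\sum_(i | (be i).1 == b) #|P i| <= 4 * q)%N,
        (\sum_(i | (be i).1 == b) #|P i :&: C| <= 2 * q)%N
      & forall p : 'I_4, (#|[set y in copies | ((be y.1).1 == b)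
            && (col y.2 + (be y.1).2 == p)%R]| <= q)%N].
Proof.
move=> r0 h1 h2.
pose Ty : finType := ({ffun 'I_4 -> 'I_K.+1} * 'I_K.+1)%type.
pose cnt i (c : 'I_4) := #|[set x in P i | col x == c]|.
have cntK i c : (cnt i c < K.+1)%N.
  rewrite ltnS; apply: leq_trans (PK i); apply: subset_leq_card.
  by apply/subsetP => x; rewrite inE => /andP[].
have PCK i : (#|P i :&: C| < K.+1)%N.
  by rewrite ltnS; apply: leq_trans (PK i); rewrite subset_leq_card ?subsetIl.
pose ty i : Ty := ([ffun c => Ordinal (cntK i c)], Ordinal (PCK i)).
have k4 : #|{: 'I_r * 'I_4}| = (4 * r)%N by rewrite card_prod !card_ord mulnC.
have [be hbe] := @round_robin I Ty ('I_r * 'I_4)%type ty ltac:(by rewrite k4 muln_gt0).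
rewrite k4 in hbe.
have wsum (w : Ty -> nat) : (forall y, w y <= 4 * K)%N -> (\sum_y w y <= type_bound)%N.
  by move=> hw; rewrite /type_bound -sum_nat_const; apply: leq_sum => y _; apply: hw.
have ordK (c : 'I_K.+1) : (c <= K)%N by rewrite -ltnS.
pose wv (y : Ty) : nat := (\sum_c y.1 c)%N.
have wvK y : (wv y <= 4 * K)%N.
  apply: leq_trans (_ : (\sum_(c < 4) K <= _)%N); last by rewrite sum_nat_const card_ord.
  by apply: leq_sum => c _; apply: ordK.
have wvE i : wv (ty i) = #|P i|.
  rewrite /wv /= -sum1_card (partition_big col predT) //=; apply: eq_bigr => c _.
  by rewrite ffunE /= /cnt -sum1_card; apply: eq_bigl => x; rewrite inE.
have bins (F : I -> nat) b : (\sum_(i | (be i).1 == b) F i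
    = \sum_(j < 4) \sum_(i | be i == (b, j)) F i)%N.
  by rewrite (partition_big (fun i => (be i).2) predT).
have r4 : (0 < 4 * r)%N by rewrite muln_gt0.
exists be => b; split.
- rewrite -(leq_pmul2r r4) bins big_distrl /=.
  apply: leq_trans (_ : (\sum_(j < 4) (\sum_i #|P i| + 4 * r * type_bound) <= _)%N).
    apply: leq_sum => j _; under eq_bigr => i _ do rewrite -wvE.
    apply: leq_trans (hbe wv (b, j)) _; rewrite leq_add //.
      by apply/eq_leq/eq_bigr => i _; rewrite wvE.
    by rewrite leq_mul2l wsum ?orbT.
  by rewrite sum_nat_const card_ord; move: h1; clear; lia.
- rewrite -(leq_pmul2r r4) bins big_distrl /=.
  apply: leq_trans (_ : (\sum_(j < 4) (\sum_i #|P i :&: C| + 4 * r * type_bound) <= _)%N).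
    apply: leq_sum => j _; apply: leq_trans (hbe (fun y => nat_of_ord y.2) (b, j)) _.
    rewrite leq_add2l leq_mul2l wsum ?orbT // => y.
    by apply: leq_trans (ordK _) _; rewrite leq_pmull.
  by rewrite sum_nat_const card_ord; move: h2; clear; lia.
move=> p; rewrite -(leq_pmul2r r4).
have -> : #|[set y in copies | ((be y.1).1 == b) && (col y.2 + (be y.1).2 == p)%R]|
    = (\sum_(j < 4) \sum_(i | be i == (b, j)) cnt i (p - j)%R)%N.
  rewrite -[RHS](_ : (\sum_(i | (be i).1 == b) cnt i (p - (be i).2)%R = _)%N); last first.
    rewrite bins; apply: eq_bigr => j _; apply: eq_bigr => i /eqP-> //.
  rewrite -(card_copies (fun i => (be i).1 == b)
    (fun i => [set x in P i | col x == p - (be i).2]%R)).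
  congr #|pred_of_set _|; apply/setP => y; rewrite !inE -subr_eq opprK.
  by rewrite [RHS]andbCA; congr (_ && (_ && _)); rewrite -subr_eq eq_sym -subr_eq opprK eq_sym.
rewrite big_distrl /=.
pose wj (j : 'I_4) (y : Ty) : nat := y.1 (p - j)%R.
have wjE i j : wj j (ty i) = cnt i (p - j)%R by rewrite /wj /= ffunE.
(* For a fixed part [p] the colours [p - j] run through all four as the shift [j] does, so the four
   bins of a block together account for whole pieces. *)
have reind (F : 'I_4 -> nat) : (\sum_(j < 4) F (p - j)%R = \sum_c F c)%N.
  rewrite [RHS](reindex_inj (h := fun j => p - j)%R) // => j j' /addrI /oppr_inj //.
apply: leq_trans (_ : (\sum_(j < 4) (\sum_i wj j (ty i) + 4 * r * \sum_y wj j y) <= _)%N).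
  apply: leq_sum => j _; under eq_bigr => i _ do rewrite -wjE.
  exact: hbe.
rewrite big_split /= -big_distrr /= exchange_big /=.
have -> : (\sum_i \sum_(j < 4) wj j (ty i) = \sum_i #|P i|)%N.
  apply: eq_bigr => i _; rewrite -wvE /wv; exact: (reind (fun c => (ty i).1 c : nat)).
rewrite exchange_big /=.
have : (\sum_y \sum_(j < 4) wj j y <= type_bound)%N.
  by apply: wsum => y; rewrite /wj (reind (fun c => y.1 c : nat)); apply: wvK.
move=> h3; apply: leq_trans (_ : (\sum_i #|P i| + 4 * r * type_bound <= _)%N).
  by rewrite leq_add2l leq_mul2l h3 orbT.
by move: h1; clear; lia.
Qed.

(** In K_(4q, 2q) every copy receives a vertex of the large side, and a copy of a cover vertex also
    one of the small side, the two forming an edge. An edge of [H] has an end in the cover, whose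
    second vertex is adjacent to the first vertex of the other end. In a 4-partite block, shifted
    colours select the part. *)
Lemma host_block (r : nat) (be : I -> 'I_r * 'I_4) (b : 'I_r) (q : nat) (T : {set G}) :
  (0 < q)%N -> block q T ->
  (\sum_(i | (be i).1 == b) #|P i| <= 4 * q)%N ->
  (\sum_(i | (be i).1 == b) #|P i :&: C| <= 2 * q)%N ->
  (forall p : 'I_4, (#|[set y in copies | ((be y.1).1 == b)
            && (col y.2 + (be y.1).2 == p)%R]| <= q)%N) ->
  exists D : I * H -> {set G}, [/\
    forall y, y \in copies -> (be y.1).1 = b ->
      [/\ D y \subset T, D y != set0 & connected_in (D y)],
    forall y y', y \in copies -> y' \in copies -> (be y.1).1 = b -> (be y'.1).1 = b ->
      y != y' -> [disjoint D y & D y']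
    & forall i x x', x \in P i -> x' \in P i -> (be i).1 = b -> edge x x' ->
      exists u v, [/\ u \in D (i, x), v \in D (i, x') & edge u v]].
Proof.
move=> q0 [[A [B [sA sB cA cB AB]]]|[A [sA cA AA]]] h1 h2 h3.
- pose Y := [set y : I * H | ((be y.1).1 == b) && (y.2 \in P y.1)].
  pose YC := [set y : I * H | ((be y.1).1 == b) && (y.2 \in P y.1 :&: C)].
  have [|f fA finj] := @inj_into _ _ Y A ltac:(by rewrite cA muln_gt0).
    by rewrite cA (card_copies (fun i => (be i).1 == b) P).
  have [|g gB ginj] := @inj_into _ _ YC B ltac:(by rewrite cB muln_gt0).
    by rewrite cB (card_copies (fun i => (be i).1 == b) (fun i => P i :&: C)).
  have dAB := complete_disjoint AB.
  exists (fun y => if y.2 \in C then [set f y; g y] else [set f y]).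
  split.
  + move=> y yc yb; case: ifP => yC; split.
    * by rewrite subUset !sub1set (subsetP sA) ?(subsetP sB) ?fA ?gB.
    * by apply/set0Pn; exists (f y); rewrite !inE eqxx.
    * apply: (@connected_in_root _ _ (f y)) => x; rewrite !inE => /orP[] /eqP->.
        exact: connect0.
      by apply: connect1; rewrite /edge_in /= !inE !eqxx orbT AB.
    * by rewrite sub1set (subsetP sA).
    * by apply/set0Pn; exists (f y); rewrite inE.
    * by move=> x x'; rewrite !inE => /eqP-> /eqP->; apply: connect0.
  + move=> y y' yc y'c yb y'b yy'.
    have yY : y \in Y by rewrite inE yb eqxx; move: yc; rewrite inE.
    have y'Y : y' \in Y by rewrite inE y'b eqxx; move: y'c; rewrite inE.
    have ff : f y != f y' by apply: contra yy' => /eqP /finj ->.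
    have fg z z' : f z != g z'.
      by apply/eqP => e; apply: (disjoint_false dAB (fA z)); rewrite e.
    have gg : y.2 \in C -> y'.2 \in C -> g y != g y'.
      move=> yC y'C; apply: contra yy' => /eqP /ginj ->; rewrite ?eqxx //.
        by rewrite !inE yb eqxx yC andbT; move: yc; rewrite inE.
      by rewrite !inE y'b eqxx y'C andbT; move: y'c; rewrite inE.
    apply: disjointI' => x.
    case: ifP => yC; case: ifP => y'C; rewrite !inE.
    * move=> /orP[] /eqP-> /orP[] /eqP e.
      - by rewrite e eqxx in ff.
      - by have := fg y y'; rewrite e eqxx.
      - by have := fg y' y; rewrite e eqxx.
      - by have := gg yC y'C; rewrite e eqxx.
    * move=> /orP[] /eqP-> /eqP e; first by rewrite e eqxx in ff.
      by have := fg y' y; rewrite e eqxx.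
    * move=> /eqP-> /orP[] /eqP e; first by rewrite e eqxx in ff.
      by have := fg y y'; rewrite e eqxx.
    * by move=> /eqP-> /eqP e; rewrite e eqxx in ff.
  move=> i x x' xP x'P ib xx' /=.
  have /orP[xC|x'C] : (x \in C) || (x' \in C).
    by move/forallP/(_ x)/forallP/(_ x')/implyP: HC; apply.
    exists (g (i, x)), (f (i, x')); split; rewrite ?xC ?inE ?eqxx ?orbT //.
      by case: ifP; rewrite !inE eqxx.
    by rewrite edge_sym AB.
  exists (f (i, x)), (g (i, x')); split; rewrite ?x'C ?inE ?eqxx ?orbT //; last exact: AB.
  by case: ifP; rewrite !inE eqxx.
pose Yp p := [set y in copies | ((be y.1).1 == b) && (col y.2 + (be y.1).2 == p)%R].
have fex p : exists f : I * H -> G, (forall y, f y \in A p) /\ {in Yp p &, injective f}.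
  have [|f f1 f2] := @inj_into _ _ (Yp p) (A p) ltac:(by rewrite cA).
    by rewrite cA h3.
  by exists f.
have [f hf] := choice fex.
pose pt (y : I * H) := (col y.2 + (be y.1).2)%R.
have AA' p p' : p != p' -> [disjoint A p & A p'] by move=> /AA/complete_disjoint.
exists (fun y => [set f (pt y) y]); split.
- move=> y yc yb; split.
  + by rewrite sub1set (subsetP (sA (pt y))) //; case: (hf (pt y)).
  + by apply/set0Pn; exists (f (pt y) y); rewrite inE.
  by move=> x x'; rewrite !inE => /eqP-> /eqP->; apply: connect0.
- move=> y y' yc y'c yb y'b yy'; apply: disjointI' => x; rewrite !inE => /eqP-> /eqP e.
  have [pe|pn] := eqVneq (pt y) (pt y').
    move: yy'; rewrite (_ : y = y') ?eqxx //; have [_ finj] := hf (pt y').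
    rewrite pe in e; apply: finj => //.
      by rewrite inE yc yb eqxx /= -pe; apply: eqxx.
    by rewrite inE y'c y'b eqxx /=; apply: eqxx.
  apply: (disjoint_false (AA' _ _ pn) (_ : f (pt y) y \in _)); first by case: (hf (pt y)).
  by rewrite e; case: (hf (pt y')).
move=> i x x' xP x'P ib xx'.
exists (f (pt (i, x)) (i, x)), (f (pt (i, x')) (i, x')); split; rewrite ?inE //.
apply: (AA (pt (i, x)) (pt (i, x'))).
- by rewrite /pt /= (inj_eq (addIr _)) Hcol.
- by case: (hf (pt (i, x))).
- by case: (hf (pt (i, x'))).
Qed.

End Embedding.

(** The pairs may share ends, since one vertex can be the end of several links. Hence only the sets
    [X l] are required to be disjoint from each other and from [T]. *)
Definition linkable (G : sgraph) (T : {set G}) (J : nat) : Prop :=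
  forall (L : finType) (f : L -> G * G), (#|L| <= J)%N ->
  (forall l, (f l).1 \in T /\ (f l).2 \in T) ->
  exists X : L -> {set G},
    (forall l, [disjoint X l & T] /\ joined (X l) (f l).1 (f l).2) /\
    forall l l', l != l' -> [disjoint X l & X l'].

(* Every piece is hosted by a block, and the copies of a vertex in different
   pieces are joined outside the blocks. *)
Lemma embedding (H G : sgraph) (I : finType) (P : I -> {set H}) (K : nat) (C : {set H})
    (col : H -> 'I_4) (q r J : nat) (T : nat -> {set G}) :
  (forall i, (#|P i| <= K)%N) -> (forall x, exists i, x \in P i) ->
  (forall x y, edge x y -> exists i, x \in P i /\ y \in P i) ->
  vertex_cover C -> (forall x y, edge x y -> col x != col y) ->
  (0 < q)%N -> (0 < r)%N ->
  (\sum_i #|P i| + 4 * r * type_bound K <= 4 * r * q)%N ->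
  (\sum_i #|P i :&: C| + 4 * r * type_bound K <= 2 * r * q)%N ->
  (forall b, (b < r)%N -> block q (T b)) ->
  (forall b b', (b < b')%N -> (b' < r)%N -> [disjoint T b & T b']) ->
  linkable (\bigcup_(b < r) T b) J ->
  (\sum_i #|P i| <= J + #|H|)%N -> minor H G.
Proof.
move=> PK PH PE HC Hcol q0 r0 h1 h2 bT dT lk hJ.
have [be hbe] := @balanced_assignment H I P K C col PK q r r0 h1 h2.
pose Y := copies P.
have exD : forall b : 'I_r, exists Db : I * H -> {set G}, [/\
    forall y, y \in Y -> (be y.1).1 = b ->
      [/\ Db y \subset T b, Db y != set0 & connected_in (Db y)],
    forall y y', y \in Y -> y' \in Y -> (be y.1).1 = b -> (be y'.1).1 = b ->
      y != y' -> [disjoint Db y & Db y']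
    & forall i x x', x \in P i -> x' \in P i -> (be i).1 = b -> edge x x' ->
      exists u v, [/\ u \in Db (i, x), v \in Db (i, x') & edge u v]].
  move=> b; have [l1 l2 l3] := hbe b.
  exact: (@host_block H G I P C col HC Hcol r be b q (T b) q0 (bT b (ltn_ord b)) l1 l2 l3).
have [D0 hD0] := choice exD.
pose D y := D0 (be y.1).1 y.
have D1 y : y \in Y -> [/\ D y \subset T (be y.1).1, D y != set0 & connected_in (D y)].
  by move=> yY; have [h _ _] := hD0 (be y.1).1; apply: h.
have TT b b' : b != b' :> 'I_r -> [disjoint T b & T b'].
  move=> bb'; have : (b < b')%N || (b' < b)%N by rewrite -neq_ltn.
  by case/orP => h; [|rewrite disjoint_sym]; apply: dT.
have D2 y y' : y \in Y -> y' \in Y -> y != y' -> [disjoint D y & D y'].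
  move=> yY y'Y yy'; have [e|ne] := eqVneq (be y.1).1 (be y'.1).1.
    have [_ h _] := hD0 (be y.1).1; rewrite /D -e; exact: h.
  have [s1 _ _] := D1 y yY; have [s2 _ _] := D1 y' y'Y.
  exact: disjointW s1 s2 (TT _ _ ne).
have DT y : y \in Y -> D y \subset \bigcup_(b < r) T b.
  move=> yY; have [s1 _ _] := D1 y yY; apply: subset_trans s1 _.
  exact: (bigcup_sup (be y.1).1).
have [i0 hi0] := choice PH.
have i0Y x : (i0 x, x) \in Y by rewrite inE /= hi0.
have exrep (y : I * H) : exists u, y \in Y -> u \in D y.
  have [yY|nY] := boolP (y \in Y).
    by have [_ /set0Pn[u uD] _] := D1 y yY; exists u.
  have [u] : exists u, u \in T (Ordinal r0).
    have card_pos (Z : {set G}) : (0 < #|Z|)%N -> exists z, z \in Z.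
      by rewrite card_gt0 => /set0Pn.
    case: (bT _ (ltn_ord (Ordinal r0))) => [[A [B [sA _ cA _ _]]]|[A [sA cA _]]].
      have [z zA] := card_pos A ltac:(by rewrite cA muln_gt0).
      by exists z; apply: (subsetP sA).
    have [z zA] := card_pos (A ord0) ltac:(by rewrite cA).
    by exists z; apply: (subsetP (sA ord0)).
  by exists u.
have [rep hrep] := choice exrep.
(* The copies of [x] are joined in a star around the copy in the piece [i0 x]. This takes one link
   per repetition of a vertex, at most [J] in all. *)
pose L : finType := {y : I * H | (y \in Y) && (y.1 != i0 y.2)}.
pose fl (l : L) := (rep (val l), rep (i0 (val l).2, (val l).2)).
have LY (l : L) : val l \in Y by case: l => y /= /andP[].
have cL : (#|L| <= J)%N.
  rewrite card_sig -(leq_add2r #|H|); apply: leq_trans hJ.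
  have -> : (\sum_i #|P i| = #|Y|)%N.
    by rewrite -(card_copies predT P); apply: eq_card => y; rewrite !inE.
  have inj : injective (fun x : H => (i0 x, x)) by move=> x x' [].
  rewrite -cardsT -(card_imset _ inj) -[X in (_ <= X)%N](cardsID [set y | y.1 == i0 y.2] Y).
  rewrite addnC; apply: leq_add; apply: subset_leq_card.
    apply/subsetP => y /imsetP[x _ ->]; rewrite in_setI i0Y inE /=.
    exact: eqxx.
  by apply/subsetP => y; rewrite inE in_setD inE andbC.
have flT l : (fl l).1 \in \bigcup_(b < r) T b /\ (fl l).2 \in \bigcup_(b < r) T b.
  split; first by apply: (subsetP (DT _ (LY l))); apply: hrep.
  by apply: (subsetP (DT _ (i0Y (val l).2))); apply: hrep.
have [X [X1 X2]] := lk L fl cL flT.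
pose B x := \bigcup_(i | x \in P i) D (i, x) :|: \bigcup_(l : L | (val l).2 == x) X l.
have DB i x : x \in P i -> D (i, x) \subset B x.
  by move=> xi; apply: subset_trans (subsetUl _ _); apply: (bigcup_sup i).
have XB (l : L) : X l \subset B (val l).2.
  by apply: subset_trans (subsetUr _ _); apply: (bigcup_sup l).
have jB (l : L) : (fl l).1 |: ((fl l).2 |: X l) \subset B (val l).2.
  rewrite !subUset !sub1set XB andbT; apply/andP; split.
    have := LY l; rewrite inE => h; apply: (subsetP (DB _ _ h)).
    by rewrite -surjective_pairing; apply/hrep/LY.
  by apply: (subsetP (DB _ _ (hi0 (val l).2))); apply/hrep/i0Y.
exists B; split.
- move=> x; split.
    have [_ /set0Pn[u uD] _] := D1 _ (i0Y x); apply/set0Pn; exists u.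
    by apply: (subsetP (DB _ _ (hi0 x))).
  have inL (l : L) z : (val l).2 = x -> z \in (fl l).1 |: ((fl l).2 |: X l) ->
      connect (edge_in (B x)) (rep (i0 x, x)) z.
    move=> lx zin; have [_ jl] := X1 l.
    apply: (connected_inP jl) => //; first by rewrite -lx jB.
    by rewrite /fl lx !inE eqxx orbT.
  apply: (@connected_in_root _ _ (rep (i0 x, x))) => z; rewrite /B inE => /orP[].
    case/bigcupP => i xi zD.
    have iY : (i, x) \in Y by rewrite inE.
    have [_ _ cD] := D1 _ iY.
    apply: (@connect_trans _ _ (rep (i, x))); last first.
      by apply: (connected_inP cD) => //; [exact: DB | exact: hrep].
    have [->|ii0] := eqVneq i (i0 x); first exact: connect0.
    have pl : ((i, x) \in Y) && ((i, x).1 != i0 (i, x).2) by rewrite iY.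
    pose l : L := exist _ (i, x) pl.
    by apply: (inL l) => //; rewrite !inE eqxx.
  case/bigcupP => l /eqP lx zX; apply: (inL l) => //.
  by rewrite !inE zX !orbT.
- move=> x x' xx'; apply: disjointI' => z.
  rewrite /B !inE => /orP[] /bigcupP[a ha za] /orP[] /bigcupP[a' ha' za'].
  + apply: (@disjoint_false _ _ _ z (D2 (a, x) (a', x') _ _ _)) => //; rewrite ?inE //.
    by apply: contra xx' => /eqP[_ ->].
  + have [dX _] := X1 a'; apply: (@disjoint_false _ _ _ z dX za').
    by apply: (subsetP (DT (a, x) _)) => //; rewrite inE.
  + have [dX _] := X1 a; apply: (@disjoint_false _ _ _ z dX za).
    by apply: (subsetP (DT (a', x') _)) => //; rewrite inE.
  apply: (@disjoint_false _ _ _ z (X2 a a' _)) => //.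
  by apply: contra xx' => /eqP aa'; rewrite -(eqP ha) aa' (eqP ha').
move=> x y xy; have [i [xi yi]] := PE x y xy.
have [_ _ h] := hD0 (be i).1; have [u [v [uD vD uv]]] := h i x y xi yi erefl xy.
exists u, v; split=> //.
  by apply: (subsetP (DB _ _ xi)).
by apply: (subsetP (DB _ _ yi)).
Qed.

(** * Disjoint paths *)

Section Menger.
Variable T : finType.
Implicit Types (e : rel T) (X Y A B C D S : {set T}).

Definition separates e X Y A B : Prop :=
  [/\ A :|: B = [set: T], X \subset A, Y \subset B
    & forall u v, u \in A -> u \notin B -> v \in B -> v \notin A -> e u v = false].

Definition path_system e X Y (k : nat) (s : 'I_k -> T * seq T) : Prop :=
  (forall i, [/\ (s i).1 \in X, path e (s i).1 (s i).2, last (s i).1 (s i).2 \in Y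
      & uniq ((s i).1 :: (s i).2)]) /\
  forall i j z, i != j -> z \in (s i).1 :: (s i).2 -> z \in (s j).1 :: (s j).2 -> False.

Lemma inAB A B z : A :|: B = [set: T] -> (z \in A) || (z \in B).
Proof. by move=> /setP/(_ z); rewrite !inE. Qed.

Lemma inj_surj (k : nat) (f : 'I_k -> T) X : injective f -> (forall i, f i \in X) ->
  #|X| = k -> forall z, z \in X -> exists i, f i = z.
Proof.
move=> fi fX cX z zX.
have : f @: [set: 'I_k] = X.
  apply/eqP; rewrite eqEcard card_imset // cardsT card_ord cX leqnn andbT.
  by apply/subsetP => y /imsetP[i _ ->].
by move/setP/(_ z); rewrite zX => /imsetP[i _ ->]; exists i.
Qed.

(** A path can leave [A] only through [A :&: B], hence through [S], which it meets in its last
    vertex alone. *)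
Lemma path_stays_left e A B S x p : A :|: B = [set: T] ->
  (forall u v, u \in A -> u \notin B -> v \in B -> v \notin A -> e u v = false) ->
  A :&: B \subset S -> x \in A -> path e x p -> uniq (x :: p) ->
  (forall z, z \in x :: p -> z \in S -> z = last x p) -> {subset x :: p <= A}.
Proof.
move=> AB sep sS; elim: p x => [|y p IH] x xA /=.
  by move=> _ _ _ z; rewrite inE => /eqP->.
move=> /andP[xy pyp] /andP[xn un] hS.
have xS : x \notin S.
  apply/negP => /(hS x (mem_head _ _)) e1; move: xn; rewrite e1 mem_last //.
have xB : x \notin B.
  by apply: contra xS => xB; apply: (subsetP sS); rewrite inE xA.
have yA : y \in A.
  have := inAB y AB; case: (boolP (y \in A)) => //= yA yB.
  by rewrite sep in xy.
move=> z; rewrite inE => /orP[/eqP->//|]; apply: IH => // w wp wS.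
by apply: hS => //; rewrite inE wp orbT.
Qed.

Lemma path_stays_right e A B S x p : A :|: B = [set: T] ->
  (forall u v, u \in A -> u \notin B -> v \in B -> v \notin A -> e u v = false) ->
  A :&: B \subset S -> last x p \in B -> path e x p ->
  (forall z, z \in p -> z \notin S) -> {subset x :: p <= B}.
Proof.
move=> AB sep sS; elim: p x => [|y p IH] x /=.
  by move=> xB _ _ z; rewrite inE => /eqP->.
move=> lB /andP[xy pyp] hS.
have sub : {subset y :: p <= B}.
  by apply: IH => // z zp; apply: hS; rewrite inE zp orbT.
have yB : y \in B by apply: sub; rewrite mem_head.
have yA : y \notin A.
  apply: contra (hS y (mem_head _ _)) => yA; apply: (subsetP sS).
  by rewrite inE yA.
move=> z; rewrite inE => /orP[/eqP->|]; last exact: sub.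
have := inAB x AB; case: (boolP (x \in B)) => // xB; rewrite orbF => xA.
by rewrite sep in xy.
Qed.

(* Goring's proof, by induction on the number of edges: delete an edge [xy]; if
   this creates a too small separation [(A, B)], then [x |: A :&: B] and
   [y |: A :&: B] have exactly [k] elements, and systems of paths from [X] to the
   former and from the latter to [Y] fit together. *)
Lemma menger e X Y k : symmetric e -> irreflexive e ->
  (forall A B, separates e X Y A B -> (k <= #|A :&: B|)%N) ->
  exists s : 'I_k -> T * seq T, path_system e X Y s.
Proof.
move: {2}(#|[set p : T * T | e p.1 p.2]|) (leqnn #|[set p : T * T | e p.1 p.2]|) => n.
elim: n e X Y => [|n IH] e X Y hn es ei hsep; last first.
  have [[[x y] exy]|no] := pselect (exists p : T * T, e p.1 p.2); last first.
    apply: (IH e X Y) => //; rewrite (_ : [set p | _] = set0) ?cards0 //.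
    apply/setP => p; rewrite !inE; apply/negP => ep; apply: no; by exists p.
  rewrite /= in exy.
  pose e' : rel T := fun u v => e u v && ~~ [|| (u == x) && (v == y) | (u == y) && (v == x)].
  have e'e u v : e' u v -> e u v by case/andP.
  have es' : symmetric e'.
    by move=> u v; rewrite /e' es orbC; congr (_ && ~~ (_ || _)); rewrite andbC.
  have ei' : irreflexive e' by move=> u; rewrite /e' ei.
  have hn' : (#|[set p : T * T | e' p.1 p.2]| <= n)%N.
    rewrite -ltnS; apply: leq_trans hn; apply: proper_card; apply/properP; split.
      by apply/subsetP => p; rewrite !inE; apply: e'e.
    by exists (x, y); rewrite !inE //= /e' !eqxx andbF.
  have [all|] := pselect (forall A B, separates e' X Y A B -> (k <= #|A :&: B|)%N).
    have [s [s1 s2]] := IH e' X Y hn' es' ei' all.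
    exists s; split=> // i; have [h1 h2 h3 h4] := s1 i; split=> //.
    exact: sub_path h2.
  move/existsNP => [A /existsNP[B /not_implyP[sAB /negP]]]; rewrite -ltnNge => small.
  (* The deleted edge joins [A :\: B] to [B :\: A], since otherwise (A, B) would be a small
     separation for [e] itself. Its ends are renamed so that [x] is on the side of [A]. *)
  have {exy x y e'e es' ei' hn' sAB e'} : exists x y, [/\ e x y, x \in A :\: B, y \in B :\: A &
     let e' := (fun u v => e u v && ~~ [|| (u == x) && (v == y) | (u == y) && (v == x)]) : rel T in
     [/\ symmetric e', irreflexive e', (#|[set p : T * T | e' p.1 p.2]| <= n)%N & separates e' X Y A B]].
    have [sAB1 sXA sYB sAB2] := sAB.
    have [/and3P[xA xB]|n1] := boolP [&& x \in A, x \notin B & (y \in B) && (y \notin A)].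
      by case/andP=> yB yA; exists x, y; rewrite !inE xA xB yA yB; split.
    have [/and3P[yA yB]|n2] := boolP [&& y \in A, y \notin B & (x \in B) && (x \notin A)].
      case/andP=> xB xA; exists y, x; rewrite !inE xA xB yA yB es.
      have ee : (fun u v => e u v && ~~ ((u == y) && (v == x) || (u == x) && (v == y))) = e' :> rel T.
        by apply/funext => u; apply/funext => v; rewrite /e' orbC.
      by rewrite ee; split.
    exfalso; move: small; rewrite ltnNge hsep //; split=> // u v uA uB vB vA.
    have := sAB2 u v uA uB vB vA; rewrite /e'; case euv : (e u v) => //=.
    move=> /negbFE/orP[] /andP[/eqP ux /eqP vy].
      by move: n1; rewrite -ux -vy uA uB vB vA.
    by move: n2; rewrite -ux -vy uA uB vB vA.
  case=> x [y [exy]]; rewrite !inE => /andP[xB xA] /andP[yA yB].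
  set e' := (fun u v => _) : rel T => -[es' ei' hn' [AB sXA sYB sep]].
  have e'e u v : e' u v -> e u v by case/andP.
  have ecase u v : e u v -> e' u v || ((u == x) && (v == y) || (u == y) && (v == x)).
    by move=> uv; rewrite /e' uv /=; apply: orNb.
  set S := A :&: B in small.
  have xS : x \notin S by rewrite inE xA (negbTE xB).
  have yS : y \notin S by rewrite inE (negbTE yA).
  have cS : (#|S|.+1 = k)%N.
    apply/eqP; rewrite eqn_leq small /=.
    (* With [x] added to [B] the edge [xy] no longer crosses, so this is a separation for [e], of
       order |S| + 1. *)
    apply: leq_trans (hsep A (x |: B) _) _.
      split=> //; first by rewrite setUCA AB; apply/setP => z; rewrite !inE orbT.
        by apply: subset_trans sYB (subsetUr _ _).
      move=> u v uA; rewrite !inE negb_or => /andP[ux uB] /orP[/eqP->|vB]; first by rewrite xA.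
      move=> vA; apply/negP => /ecase; rewrite sep //= (negbTE ux) /=.
      by case: eqP => //= uy _; move: yA; rewrite -uy uA.
    have -> : A :&: (x |: B) = x |: S.
      by apply/setP => z; rewrite !inE; case: eqP => [->|]; rewrite ?xA.
    by rewrite cardsU1 xS.
  have cSx : #|x |: S| = k by rewrite cardsU1 xS.
  have cSy : #|y |: S| = k by rewrite cardsU1 yS.
  (* A separation (C, D) of [X] from [x |: S] for [e'] extends to the separation (C :&: A, D :|: B)
     of [X] from [Y] for [e], of no larger order. The argument for [Q] is symmetric. *)
  have [|P [P1 P2]] := IH e' X (x |: S) hn' es' ei'.
    move=> C D [CD sXC sSD sep2].
    apply: leq_trans (hsep (C :&: A) (D :|: B) _) _; last first.
      apply: subset_leq_card; apply/subsetP => z; rewrite !inE.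
      case/andP=> /andP[zC zA] /orP[zD|zB]; first by rewrite zC.
      by rewrite zC (subsetP sSD) // !inE zA zB orbT.
    split.
    - apply/setP => z; rewrite !inE; have := inAB z CD; have := inAB z AB.
      by case: (z \in A); case: (z \in B); case: (z \in C); case: (z \in D).
    - by rewrite subsetI sXC.
    - by apply: subset_trans sYB (subsetUr _ _).
    move=> u v; rewrite !inE negb_or negb_and => /andP[uC uA] /andP[uD uB] vDB vCA.
    apply/negP => /ecase /orP[|].
      have [vA|vA] := boolP (v \in A).
        rewrite vA /= orbF in vCA.
        have vD : v \in D by have := inAB v CD; rewrite (negbTE vCA).
        by rewrite sep2.
      have vB : v \in B by have := inAB v AB; rewrite (negbTE vA).
      by rewrite sep.
    case/orP => /andP[/eqP ux /eqP vy].
      by move: uD; rewrite ux (subsetP sSD) // !inE eqxx.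
    by move: yA; rewrite -ux uA.
  have [|Q [Q1 Q2]] := IH e' (y |: S) Y hn' es' ei'.
    move=> C D [CD sSC sYD sep2].
    apply: leq_trans (hsep (C :|: A) (D :&: B) _) _; last first.
      apply: subset_leq_card; apply/subsetP => z; rewrite !inE.
      case/andP=> /orP[zC|zA] /andP[zD zB]; first by rewrite zC.
      by rewrite zD andbT (subsetP sSC) // !inE zA zB orbT.
    split.
    - apply/setP => z; rewrite !inE; have := inAB z CD; have := inAB z AB.
      by case: (z \in A); case: (z \in B); case: (z \in C); case: (z \in D).
    - by apply: subset_trans sXA (subsetUr _ _).
    - by rewrite subsetI sYD.
    move=> u v; rewrite !inE negb_or negb_and => uCA uDB /andP[vD vB] /andP[vC vA].
    apply/negP => /ecase /orP[|].
      have [uD|uD] := boolP (u \in D).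
        rewrite uD /= in uDB.
        have uA : u \in A by have := inAB u AB; rewrite (negbTE uDB) orbF.
        by rewrite sep.
      have uC : u \in C by have := inAB u CD; rewrite (negbTE uD) orbF.
      by rewrite sep2.
    case/orP => /andP[/eqP ux /eqP vy].
      by move: vC; rewrite vy (subsetP sSC) // !inE eqxx.
    by move: vA; rewrite vy xA.
  pose lP i := last (P i).1 (P i).2.
  have lPin i : lP i \in (P i).1 :: (P i).2 by apply: mem_last.
  have lPinj : injective lP.
    move=> i j e1; apply/eqP/negPn/negP => ij; apply: (P2 i j (lP i) ij (lPin i)).
    by rewrite e1.
  have lPS i : lP i \in x |: S by case: (P1 i).
  have hQinj : injective (fun j => (Q j).1).
    move=> i j e1; apply/eqP/negPn/negP => ij; apply: (Q2 i j (Q i).1 ij (mem_head _ _)).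
    by rewrite e1 mem_head.
  have hQS j : (Q j).1 \in y |: S by case: (Q1 j).
  have Psurj := inj_surj lPinj lPS cSx.
  have Qsurj := inj_surj hQinj hQS cSy.
  have Pend i z : z \in (P i).1 :: (P i).2 -> z \in x |: S -> z = lP i.
    move=> zP zS; have [j e1] := Psurj z zS.
    have [e2|ij] := eqVneq i j; first by rewrite -e1 e2.
    by exfalso; apply: (P2 i j z ij zP); rewrite -e1.
  have Qend j z : z \in (Q j).1 :: (Q j).2 -> z \in y |: S -> z = (Q j).1.
    move=> zQ zS; have [i e1] := Qsurj z zS.
    have [ji|ji] := eqVneq j i; first by rewrite ji e1.
    by exfalso; apply: (Q2 j i z ji zQ); rewrite -e1 mem_head.
  have PA i : {subset (P i).1 :: (P i).2 <= A}.
    have [h1 h2 h3 h4] := P1 i.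
    apply: (@path_stays_left e' A B (x |: S)) => //; first exact: subsetUr.
      exact: (subsetP sXA).
    by move=> z zP zS; apply: Pend.
  have QB j : {subset (Q j).1 :: (Q j).2 <= B}.
    have [h1 h2 h3 h4] := Q1 j.
    apply: (@path_stays_right e' A B (y |: S)) => //; first exact: subsetUr.
      exact: (subsetP sYB).
    move=> z zQ; apply/negP => zS.
    have e1 := Qend j z ltac:(by rewrite inE zQ orbT) zS.
    by move: h4; rewrite /= -e1 zQ.
  (* The path of [P] that ends in [x] continues along the edge [xy]; any other one continues with
     the path of [Q] that starts at its end. *)
  pose t z := if z == x then y else z.
  have tS i : t (lP i) \in y |: S.
    rewrite /t; case: eqP => [_|/eqP ne]; first by rewrite !inE eqxx.
    by have := lPS i; rewrite !inE (negbTE ne) /= => ->; rewrite orbT.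
  have [j hj] := choice (fun i => Qsurj _ (tS i)).
  have tinj i i' : t (lP i) = t (lP i') -> i = i'.
    rewrite /t; case: eqP => [e1|n1]; case: eqP => [e2|n2] e3.
    - by apply: lPinj; rewrite e1 e2.
    - exfalso; have := lPS i'; rewrite !inE -e3 (negbTE yA) /=.
      by case: eqP => // yx; move: yA; rewrite yx xA.
    - exfalso; have := lPS i; rewrite !inE e3 (negbTE yA) /=.
      by case: eqP => // yx; move: yA; rewrite yx xA.
    exact: lPinj.
  pose tail i := if lP i == x then y :: (Q (j i)).2 else (Q (j i)).2.
  have tailQ i : {subset tail i <= (Q (j i)).1 :: (Q (j i)).2}.
    move=> z; rewrite /tail; case: eqP => [e1|_] zt; last by rewrite inE zt orbT.
    by rewrite hj /t e1 eqxx.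
  have cross i i' z : z \in (P i).1 :: (P i).2 -> z \in tail i' -> z = lP i /\ z = lP i' /\ i' = i.
    move=> zP zt; have zA := PA i z zP; have zB := QB _ z (tailQ _ z zt).
    have zS : z \in S by rewrite inE zA.
    have e1 : z = lP i by apply: Pend; rewrite // inE zS orbT.
    have e2 : z = t (lP i').
      by rewrite -hj; apply: Qend; [exact: tailQ | rewrite inE zS orbT].
    have e3 : z = lP i'.
      rewrite e2 /t; case: eqP => // e3; exfalso; move: yA.
      by move: e2; rewrite /t e3 eqxx => <-; rewrite zA.
    by split=> //; split=> //; apply: lPinj; rewrite -e1 -e3.
  exists (fun i => ((P i).1, (P i).2 ++ tail i)); split=> /=.
    move=> i; have [h1 h2 h3 h4] := P1 i; have [g1 g2 g3 g4] := Q1 (j i); split=> //.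
    - rewrite cat_path (sub_path e'e h2) /= /tail -/(lP i).
      have := hj i; rewrite /t; case: eqP => [->|_] hq /=.
        by rewrite exy -hq (sub_path e'e g2).
      by rewrite -hq (sub_path e'e g2).
    - rewrite last_cat -/(lP i) /tail.
      by have := hj i; rewrite /t; case: eqP => [->|_] hq /=; rewrite -hq.
    change (uniq (((P i).1 :: (P i).2) ++ tail i)); rewrite cat_uniq h4 andTb; apply/andP; split.
      apply/hasPn => z zt; apply/negP => zP.
      have [e1 _] := cross i i z zP zt.
      have := hj i; move: zt; rewrite /t /tail -e1; case: eqP => [zx|_] zt hq.
        by move: xB; rewrite -zx (QB _ z (tailQ i z _)) // /tail -e1 zx eqxx -zx.
      by move: g4; rewrite /= hq zt.
    have := hj i; rewrite /t /tail; case: eqP => [_|_] hq; first by rewrite -hq.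
    by move: g4 => /= /andP[].
  move=> i i' z ii'; rewrite -!cat_cons !mem_cat => /orP[z1|z1] /orP[z2|z2].
  - exact: (P2 i i' z).
  - by have [_ [_ e1]] := cross i i' z z1 z2; rewrite e1 eqxx in ii'.
  - by have [_ [_ e1]] := cross i' i z z2 z1; rewrite e1 eqxx in ii'.
  apply: (Q2 (j i) (j i') z) => //; try exact: tailQ.
  by apply: contra ii' => /eqP jj; apply/eqP/tinj; rewrite -!hj jj.
have e0 u v : e u v = false.
  move: hn; rewrite leqn0 cards_eq0 => /eqP/setP/(_ (u, v)); by rewrite !inE.
(* Without edges all vertices outside [X] may be put on the side of [Y], so the hypothesis says that
   [X] and [Y] have [k] common vertices, which are the paths. *)
have sp : separates e X Y X (Y :|: ~: X).
  split=> //; first by apply/setP => z; rewrite !inE; case: (z \in X); rewrite ?orbT.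
  exact: subsetUl.
have := hsep _ _ sp.
have -> : X :&: (Y :|: ~: X) = X :&: Y.
  by apply/setP => z; rewrite !inE; case: (z \in X); rewrite ?orbF.
move=> cXY; have [B sB cB] := exists_subset_card cXY.
exists (fun i => (enum_val (cast_ord (esym cB) i), [::])); split.
  move=> i /=; have := enum_valP (cast_ord (esym cB) i) => /(subsetP sB).
  by rewrite inE => /andP[].
move=> i i' z ii' /=; rewrite !inE => /eqP-> /eqP/enum_val_inj/cast_ord_inj e1.
by rewrite e1 eqxx in ii'.
Qed.

(** The path is started afresh at its last visit to [X]. *)
Lemma trim_left e X x p : path e x p -> (exists2 z, z \in x :: p & z \in X) ->
  exists x' p', [/\ path e x' p', x' \in X, last x' p' = last x p,
    {subset x' :: p' <= x :: p} & forall z, z \in p' -> z \notin X].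
Proof.
elim: p x => [|y p IH] x /=.
  by move=> _ [z]; rewrite inE => /eqP-> xX; exists x, [::]; split.
move=> /andP[xy pp] hX.
have [h|no] := pselect (exists2 z, z \in y :: p & z \in X).
  have [x' [p' [h1 h2 h3 h4 h5]]] := IH y pp h; exists x', p'; split=> // z /h4 zp.
  by rewrite inE zp orbT.
exists x, (y :: p); split=> //=; first by rewrite xy.
  case: hX => z; rewrite inE => /orP[/eqP->//|zp zX]; case: no; by exists z.
by move=> z zp; apply/negP => zX; apply: no; exists z.
Qed.

(** The path is stopped at its first visit to [Y]. *)
Lemma trim_right e Y x p : path e x p -> last x p \in Y ->
  exists p', [/\ path e x p', last x p' \in Y, {subset p' <= p}
    & forall z, z \in x :: p' -> z \in Y -> z = last x p'].
Proof.
elim: p x => [|y p IH] x /=.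
  by move=> _ xY; exists [::]; split=> // z; rewrite inE => /eqP.
move=> /andP[xy pp] lY.
have [xY|xY] := boolP (x \in Y).
  by exists [::]; split=> // z; rewrite inE => /eqP.
have [p' [h1 h2 h3 h4]] := IH y pp lY.
exists (y :: p'); split=> //=; first by rewrite xy.
  by move=> z; rewrite !inE => /orP[->//|/h3->]; rewrite orbT.
move=> z; rewrite inE => /orP[/eqP-> xY'|]; last exact: h4.
by rewrite xY' in xY.
Qed.

End Menger.

(** Paths are recorded as connected vertex sets with two marked ends. They meet [X] and [Y] in these
    ends only, so that the rest of both sets stays free for blocks and reservoirs. *)
Definition linked_by (G : sgraph) (X Y : {set G}) (k : nat) : Prop :=
  exists (p : 'I_k -> {set G}) (a b : 'I_k -> G), [/\
    forall i, [/\ connected_in (p i), a i \in p i, b i \in p i, a i \in X & b i \in Y],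
    forall i z, z \in p i -> z \in X -> z = a i,
    forall i z, z \in p i -> z \in Y -> z = b i
    & forall i j, i != j -> [disjoint p i & p j]].

Lemma linking_paths (G : sgraph) (X Y : {set G}) (k : nat) :
  (forall A B : {set G}, A :|: B = [set: G] ->
    (forall u v, u \in A -> u \notin B -> v \in B -> v \notin A -> edge u v = false) ->
    A :\: B != set0 -> B :\: A != set0 -> (k <= #|A :&: B|)%N) ->
  (k <= #|X|)%N -> (k <= #|Y|)%N -> linked_by X Y k.
Proof.
move=> hsep cX cY.
have [A B [AB sX sY sep]|s [s1 s2]] := @menger G (@edge G) X Y k (@edge_sym G) (@edge_irr G).
  have [/eqP|n1] := boolP (A :\: B == set0).
    rewrite -/(_ = _) => /eqP; rewrite setD_eq0 => sAB.
    by apply: leq_trans cX _; rewrite subset_leq_card // subsetI sX (subset_trans sX).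
  have [/eqP|n2] := boolP (B :\: A == set0).
    rewrite -/(_ = _) => /eqP; rewrite setD_eq0 => sBA.
    by apply: leq_trans cY _; rewrite subset_leq_card // subsetI sY andbT (subset_trans sY).
  exact: hsep.
have ex i : exists t : G * seq G, [/\ path (@edge G) t.1 t.2, t.1 \in X, last t.1 t.2 \in Y,
    {subset t.1 :: t.2 <= (s i).1 :: (s i).2}
    & (forall z, z \in t.2 -> z \notin X) /\
      (forall z, z \in t.1 :: t.2 -> z \in Y -> z = last t.1 t.2)].
  have [h1 h2 h3 h4] := s1 i.
  have [|x' [p' [g1 g2 g3 g4 g5]]] := @trim_left G (@edge G) X _ _ h2.
    by exists (s i).1 => //; rewrite mem_head.
  have [|p [k1 k2 k3 k4]] := @trim_right G (@edge G) Y x' p' g1; first by rewrite g3.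
  exists (x', p); split=> //=; last by split=> // z /k3; apply: g5.
  by move=> z zp; apply: g4; move: zp; rewrite !inE => /orP[->//|/k3->]; rewrite orbT.
have [t ht] := choice ex.
exists (fun i => [set z in (t i).1 :: (t i).2]), (fun i => (t i).1), (fun i => last (t i).1 (t i).2).
split.
- move=> i; have [h1 h2 h3 h4 [h5 h6]] := ht i; split=> //; try by rewrite inE ?mem_head ?mem_last.
  set A := [set z in _].
  have pin x p : {subset x :: p <= A} -> path (@edge G) x p -> path (edge_in A) x p.
    elim: p x => //= y p IH x sub /andP[xy yp]; rewrite IH //; last first.
      by move=> z zp; apply: sub; rewrite inE zp orbT.
    by rewrite andbT /edge_in /= xy !sub ?inE ?eqxx ?orbT.
  apply: (@connected_in_root _ _ (t i).1) => z; rewrite inE => zin.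
  by apply: path_connect zin; apply: pin h1 => w win; rewrite inE.
- move=> i z; have [h1 h2 h3 h4 [h5 h6]] := ht i; rewrite inE => zin zX.
  move: zin; rewrite inE => /orP[/eqP//|/h5]; by rewrite zX.
- by move=> i z; have [h1 h2 h3 h4 [h5 h6]] := ht i; rewrite inE; apply: h6.
move=> i j ij; have [_ _ _ hi _] := ht i; have [_ _ _ hj _] := ht j.
by apply: disjointI' => z; rewrite !inE -!in_cons => /hi zi /hj zj; apply: (s2 i j z).
Qed.

(** * Minimal dense minors *)

Section Minors.

Lemma minor_refl (G : sgraph) : minor G G.
Proof.
exists (fun x => [set x]); split.
- move=> x; split; first by apply/set0Pn; exists x; rewrite inE.
  by move=> u v; rewrite !inE => /eqP-> /eqP->; apply: connect0.
- by move=> x y xy; rewrite disj1 inE.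
by move=> x y xy; exists x, y; rewrite !inE.
Qed.

Lemma minor_trans (H G' G : sgraph) : minor H G' -> minor G' G -> minor H G.
Proof.
move=> [B1 [c1 d1 e1]] [B2 [c2 d2 e2]].
pose B x := \bigcup_(y in B1 x) B2 y.
have sB x y : y \in B1 x -> B2 y \subset B x by move=> yB; apply: (bigcup_sup y).
exists B; split.
- move=> x; split.
    have [/set0Pn[y yB] _] := c1 x; have [/set0Pn[z zB] _] := c2 y.
    by apply/set0Pn; exists z; apply: (subsetP (sB x y yB)).
  have walk p : forall y u v, y \in B1 x -> path (edge_in (B1 x)) y p ->
      u \in B2 y -> v \in B2 (last y p) -> connect (edge_in (B x)) u v.
    elim: p => [|y' p IH] y u v yB /=.
      by move=> _ uB vB; have [_ cB] := c2 y; apply: (connected_inP cB) => //; apply: sB.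
    rewrite {1}/edge_in /= => /andP[/and3P[_ y'B yy'] py'] uB vB.
    have [a [b [aB bB ab]]] := e2 y y' yy'; have [_ cB] := c2 y.
    apply: (@connect_trans _ _ a); first by apply: (connected_inP cB) => //; apply: sB.
    apply: (@connect_trans _ _ b); last by apply: (IH y').
    apply: connect1; rewrite /edge_in /= ab andbT.
    by rewrite (subsetP (sB x y yB)) // (subsetP (sB x y' y'B)).
  move=> u v /bigcupP[y yB uB] /bigcupP[y' y'B].
  have [_ cB] := c1 x; have /connectP[p pp ->] := cB y y' yB y'B => vB.
  exact: (walk p y).
- move=> x x' xx'; apply: disjointI' => z /bigcupP[y yB zy] /bigcupP[y' y'B zy'].
  have [e|ne] := eqVneq y y'.
    by apply: (@disjoint_false _ _ _ y (d1 x x' xx')) => //; rewrite e.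
  exact: (@disjoint_false _ _ _ z (d2 y y' ne)).
move=> x x' /e1[y [y' [yB y'B /e2[u [v [uB vB uv]]]]]]; exists u, v; split=> //.
  exact: (subsetP (sB x y yB)).
exact: (subsetP (sB x' y' y'B)).
Qed.

Definition arcs (G : sgraph) : nat := ar [set: G] [set: G].

Lemma arcsE (G : sgraph) : arcs G = (\sum_(x : G) \sum_(y : G) edge x y)%N.
Proof.
rewrite /arcs arE; apply: eq_big => x; first by rewrite inE.
by move=> _; apply: eq_bigl => y; rewrite inE.
Qed.

Lemma arcs_le (G : sgraph) : (arcs G <= #|G| * #|G|)%N.
Proof. by apply: leq_trans (ar_le _ _) _; rewrite cardsT. Qed.

Lemma arcs_nb_edges (G : sgraph) : arcs G = (2 * nb_edges G)%N.
Proof.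
pose P := [set p : G * G | edge p.1 p.2].
pose f (p : G * G) := [set p.1; p.2].
have -> : arcs G = #|P|.
  rewrite arcsE card_fibers; apply: eq_bigr => x _.
  by rewrite -sum1_card [RHS]big_mkcond /=; apply: eq_bigr => y _; rewrite !inE /=; case: edge.
have -> : nb_edges G = #|f @: P|.
  by rewrite /nb_edges /edges; congr #|pred_of_set _|.
rewrite -sum1_card (partition_big_imset f) /= mulnC -sum_nat_const.
apply: eq_bigr => E /imsetP[[a b]]; rewrite inE /= => ab ->.
have anb : a != b by apply/eqP => e; move: ab; rewrite e edge_irr.
have -> : (\sum_(p in P | f p == f (a, b)) 1)%N = #|[set (a, b); (b, a)]|.
  rewrite -sum1_card; apply: eq_bigl => -[u v]; rewrite !inE /= !xpair_eqE.
  apply/andP/orP => [[uv /eqP/setP e]|].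
    have := e u; have := e v; rewrite !inE !eqxx !orbT /=.
    have nuv : u != v by apply/eqP => e'; move: uv; rewrite e' edge_irr.
    move=> /esym/orP[] /eqP ev /esym/orP[] /eqP eu.
    - by rewrite eu ev eqxx in nuv.
    - by right; rewrite eu ev !eqxx.
    - by left; rewrite eu ev !eqxx.
    - by rewrite eu ev eqxx in nuv.
  case=> /andP[/eqP-> /eqP->]; first by rewrite ab.
  by rewrite edge_sym ab; split=> //; apply/eqP; rewrite /f /= setUC.
by rewrite cards2 xpair_eqE (negbTE anb).
Qed.

Definition induced_subgraph (G : sgraph) (S : {set G}) : sgraph.
Proof.
refine (@SGraph {x : G | x \in S} (fun u v => edge (val u) (val v)) _ _).
- by move=> u v; apply: edge_sym.
- by move=> u; apply: edge_irr.
Defined.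

Lemma card_induced (G : sgraph) (S : {set G}) : #|induced_subgraph S| = #|S|.
Proof. by rewrite /= card_sig; apply: eq_card => x; rewrite inE. Qed.

Lemma sum_induced (G : sgraph) (S : {set G}) (F : G -> nat) :
  (\sum_(u : induced_subgraph S) F (val u) = \sum_(x in S) F x)%N.
Proof. by rewrite [RHS]big_sub. Qed.

Lemma arcs_induced (G : sgraph) (S : {set G}) : arcs (induced_subgraph S) = ar S S.
Proof.
rewrite arcsE arE -sum_induced; apply: eq_bigr => u _.
by rewrite -(sum_induced S (fun y => edge (val u) y)).
Qed.

Lemma minor_induced (G : sgraph) (S : {set G}) : minor (induced_subgraph S) G.
Proof.
exists (fun x => [set val x]); split.
- move=> x; split; first by apply/set0Pn; exists (val x); rewrite inE.
  by move=> u v; rewrite !inE => /eqP-> /eqP->; apply: connect0.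
- by move=> x y xy; rewrite disj1 inE (inj_eq val_inj).
by move=> x y xy; exists (val x), (val y); rewrite !inE.
Qed.

Definition delete_edge (G : sgraph) (a b : G) : sgraph.
Proof.
refine (@SGraph G (fun u v => edge u v && ~~ ((u == a) && (v == b) || (u == b) && (v == a))) _ _).
- by move=> u v; rewrite edge_sym orbC; congr (_ && ~~ (_ || _)); rewrite andbC.
- by move=> u; rewrite edge_irr.
Defined.

Lemma minor_delete_edge (G : sgraph) (a b : G) : minor (delete_edge a b) G.
Proof.
exists (fun x : G => [set x]); split.
- move=> x; split; first by apply/set0Pn; exists x; rewrite inE.
  by move=> u v; rewrite !inE => /eqP-> /eqP->; apply: connect0.
- by move=> x y xy; rewrite disj1 inE.
by move=> x y /andP[xy _]; exists x, y; rewrite !inE.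
Qed.

Lemma arcs_delete_edge (G : sgraph) (a b : G) : edge a b ->
  arcs G = (arcs (delete_edge a b) + 2)%N.
Proof.
move=> ab; have anb : a != b by apply/eqP => e; move: ab; rewrite e edge_irr.
have one (c d : G) : (\sum_(u : G) \sum_(v : G) ((u == c) && (v == d)) = 1)%N.
  rewrite (bigD1 c) //= [X in (_ + X)%N]big1 ?addn0; last first.
    by move=> u /negbTE un; rewrite big1 // => v _; rewrite un.
  by rewrite (bigD1 d) //= !eqxx big1 // => v /negbTE ->; rewrite andbF.
rewrite !arcsE -[2%N]/(1 + 1)%N -{1}(one a b) -(one b a) -!big_split /=.
apply: eq_bigr => u _; rewrite -!big_split /=; apply: eq_bigr => v _.
have [->|ua] := eqVneq u a; have [->|vb] := eqVneq v b; rewrite /= ?eqxx ?(negbTE anb) /= ?ab //=.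
- by rewrite andbT !addn0.
- have [->|ub] := eqVneq u b; rewrite ?addn0 ?andbT //=.
  by rewrite eq_sym (negbTE anb) andbT !addn0.
have [->|ub] := eqVneq u b; have [->|va] := eqVneq v a => //=; rewrite ?andbT ?addn0 //.
by rewrite edge_sym ab.
Qed.

Definition contract (G : sgraph) (a b : G) : sgraph.
Proof.
refine (@SGraph {x : G | x \in [set~ b]} (fun u v => (val u != val v) &&
  [|| edge (val u) (val v), (val u == a) && edge b (val v) | (val v == a) && edge b (val u)]) _ _).
- by move=> u v; rewrite eq_sym edge_sym [in RHS]orbA [in RHS](orbC (edge _ _)) -!orbA;
     congr (_ && _); case: edge; case: (val u == a); case: (val v == a); case: edge; case: edge.
- by move=> u; rewrite eqxx.
Defined.

Lemma minor_contract (G : sgraph) (a b : G) : edge a b -> minor (contract a b) G.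
Proof.
move=> ab.
pose B (x : contract a b) : {set G} := if val x == a then [set a; b] else [set val x].
have nb (x : contract a b) : val x != b by have := valP x; rewrite !inE.
have xB x : val x \in B x by rewrite /B; case: eqP => [->|_]; rewrite !inE eqxx.
have Bx x z : z \in B x -> z = val x \/ (z = b /\ val x = a).
  by rewrite /B; case: eqP => [e|_]; rewrite !inE; [case/orP|] => /eqP->; auto; left.
exists B; split.
- move=> x; split; first by apply/set0Pn; exists (val x).
  apply: (@connected_in_root _ _ (val x)) => z zB.
  have [->|[-> xa]] := Bx x z zB; first exact: connect0.
  have bB : b \in B x by rewrite /B xa eqxx !inE eqxx orbT.
  by apply: connect1; rewrite /edge_in /= xB bB xa ab.
- move=> x y xy; apply: disjointI' => z /Bx[->|[-> xa]] /Bx[e|[e ya]].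
  + by move/val_inj: e xy => ->; rewrite eqxx.
  + by have := nb x; rewrite e eqxx.
  + by have := nb y; rewrite -e eqxx.
  by move: xy; rewrite -(inj_eq val_inj) xa ya eqxx.
move=> x y /andP[_ /or3P[xy|/andP[/eqP xa yb]|/andP[/eqP ya xb]]].
- by exists (val x), (val y).
- by exists b, (val y); split=> //; rewrite /B xa eqxx !inE eqxx orbT.
by exists (val x), b; split; rewrite // 1?edge_sym // /B ya eqxx !inE eqxx orbT.
Qed.

Lemma card_contract (G : sgraph) (a b : G) : (#|contract a b|.+1 = #|G|)%N.
Proof.
rewrite (_ : #|contract a b| = #|[set~ b]|); last first.
  by rewrite /= card_sig; apply: eq_card => x; rewrite inE.
by rewrite cardsC1 prednK //; apply/card_gt0P; exists b.
Qed.

Definition codegree (G : sgraph) (a b : G) : nat := dg a [set y | edge b y].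

(** Contraction loses the edge [ab] and merges two edges at each common neighbour. In the proof,
    [n v] marks the neighbours that [a] takes over from [b]. *)
Lemma arcs_contract (G : sgraph) (a b : G) : edge a b ->
  (arcs G <= arcs (contract a b) + 2 * (codegree a b).+1)%N.
Proof.
move=> ab; pose V' := [set~ b].
pose n (v : G) : nat := [&& edge b v, ~~ edge a v & v != a].
have sum_c (F : G -> nat) : (\sum_(u : contract a b) F (val u) = \sum_(x in V') F x)%N.
  by rewrite [RHS]big_sub.
have aV : a \in V' by rewrite !inE; apply/eqP => e; move: ab; rewrite e edge_irr.
have e1 : (ar V' V' + 2 * \sum_(v in V') n v <= arcs (contract a b))%N.
  rewrite arcsE.
  under [X in (_ <= X)%N]eq_bigr => u _ do
    rewrite -/(fun u : G => _) (sum_c (fun v => (val u != v) &&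
      [|| edge (val u) v, (val u == a) && edge b v | (v == a) && edge b (val u)])).
  rewrite (sum_c (fun u => \sum_(v in V') (u != v) &&
      [|| edge u v, (u == a) && edge b v | (v == a) && edge b u])%N).
  have s1 : (\sum_(u in V') \sum_(v in V') (u == a) * n v = \sum_(v in V') n v)%N.
    rewrite (bigD1 a) //= eqxx [X in (_ + X)%N]big1 ?addn0; last first.
      by move=> u /andP[_ /negbTE ua]; rewrite ua big1.
    by apply: eq_bigr => v _; rewrite mul1n.
  have s2 : (\sum_(u in V') \sum_(v in V') (v == a) * n u = \sum_(v in V') n v)%N.
    by rewrite exchange_big.
  rewrite mul2n -addnn -{1}s1 -s2 arE addnA -!big_split /=; apply: leq_sum => u _.
  rewrite -!big_split /=; apply: leq_sum => v _; rewrite /n.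
  have [->|uv] /= := eqVneq u v; first by rewrite edge_irr; case: eqP => //= _; rewrite !andbF.
  have [ua|ua] := eqVneq u a; have [va|va] := eqVneq v a; rewrite /= ?mul1n ?mul0n ?addn0 ?add0n ?orbF ?andbT //.
  - by rewrite ua va eqxx in uv.
  - by rewrite ua; case: (edge a v); case: (edge b v).
  - by rewrite va [edge u a]edge_sym; case: (edge a u); case: (edge b u).
have e2 : (dg b V' <= \sum_(v in V') n v + (codegree a b).+1)%N.
  rewrite dgE -addn1 /codegree dgE.
  have -> : (\sum_(y in [set y | edge b y]) edge a y = \sum_(v in V') (edge a v && edge b v))%N.
    rewrite big_mkcond [RHS]big_mkcond; apply: eq_bigr => v _; rewrite !inE.
    have [->|vb] := eqVneq v b; first by rewrite edge_irr.
    by case: (edge b v); rewrite ?andbT ?andbF.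
  have -> : 1%N = (\sum_(v in V') (v == a))%N.
    by rewrite (bigD1 a) //= eqxx big1 // => v /andP[_ /negbTE->].
  rewrite -!big_split /=; apply: leq_sum => v _; rewrite /n.
  by case: (edge b v); case: (edge a v); case: (v == a).
have U : [set b] :|: V' = [set: G] by rewrite setUCr.
have dU : [disjoint [set b] & V'] by rewrite disj1 !inE eqxx.
rewrite /arcs (ar_split U dU) !ar1 dgE big_set1 edge_irr add0n.
by move: e1 e2; rewrite /arcs; clear; lia.
Qed.

End Minors.

(** * Graphs minimal among the dense minors *)

Section MinimalMinor.
Variables (R : realType) (d k : R).

(** The bound on the order excludes graphs with at most [k] vertices, for which the second
    inequality would be void. *)
Definition dense_class (G : sgraph) : Prop :=
  d <= #|G|%:R /\ 2 * d * (#|G|%:R - k) <= (arcs G)%:R.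

(** Encodes the lexicographic order on (order, arcs): [arcs G] is at most |G|^2, less than the gap
    between consecutive cubes. *)
Definition weight (G : sgraph) : nat := (#|G| ^ 3 + arcs G)%N.

Lemma weight_lt (G G' : sgraph) : (#|G'| < #|G|)%N -> (weight G' < weight G)%N.
Proof.
move=> lt; rewrite /weight; apply: leq_trans (_ : #|G| ^ 3 <= _)%N; last exact: leq_addr.
have := arcs_le G'; move: (arcs G') lt => m; move: #|G'| #|G| => x y lt hm.
have : (x.+1 ^ 3 <= y ^ 3)%N by rewrite leq_exp2r.
apply: leq_trans; rewrite !expnS !expn0 !muln1; nia.
Qed.

Lemma minimal_in_class (G : sgraph) : dense_class G -> exists G' : sgraph,
  [/\ minor G' G, dense_class G'
    & forall G'' : sgraph, minor G'' G' -> dense_class G'' -> (weight G' <= weight G'')%N].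
Proof.
move: {2}(weight G) (leqnn (weight G)) => n; elim: n G => [|n IH] G hn cG.
  exists G; split=> //; first exact: minor_refl.
  by move=> G'' _ _; apply: leq_trans hn _.
have [[G'' [m c lt]]|no] := pselect (exists G'', [/\ minor G'' G, dense_class G''
    & (weight G'' < weight G)%N]).
  have [G' [m' c' mn]] := IH G'' ltac:(by rewrite -ltnS (leq_trans lt)) c.
  by exists G'; split=> //; apply: minor_trans m' m.
exists G; split=> //; first exact: minor_refl.
move=> G'' m c; rewrite leqNgt; apply/negP => lt; apply: no; by exists G''.
Qed.

Definition critical (G : sgraph) : Prop :=
  [/\ [/\ d + 1 <= #|G|%:R, 2 * d * (#|G|%:R - k) <= (arcs G)%:R
       & (arcs G)%:R <= 2 * d * (#|G|%:R - k) + 2],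
      forall a b : G, edge a b -> d - 1 <= (codegree a b)%:R,
      forall x : G, d <= (dg x [set: G])%:R
    & forall A B : {set G}, A :|: B = [set: G] ->
      (forall u v, u \in A -> u \notin B -> v \in B -> v \notin A -> edge u v = false) ->
      A :\: B != set0 -> B :\: A != set0 -> k <= #|A :&: B|%:R].

(* Mader's trick: the offset [k] in [d (|G| - k)] makes minimal graphs highly
   connected. *)
Lemma minimal_minor (G : sgraph) : 5 <= d -> 0 <= k -> k <= d / 4 ->
  (0 < #|G|)%N -> 2 * d * #|G|%:R <= (arcs G)%:R ->
  exists G' : sgraph, minor G' G /\ critical G'.
Proof.
move=> d5 k0 kd G0 hG.
have cG : dense_class G.
  have n0 : 0 < #|G|%:R :> R by rewrite ltr0n.
  have h : (arcs G)%:R <= #|G|%:R * #|G|%:R :> R by rewrite -natrM ler_nat arcs_le.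
  have dk : 0 <= d * k by rewrite mulr_ge0 //; lra.
  split; last lra.
  have : 2 * d <= #|G|%:R by rewrite -(ler_pM2r n0); lra.
  lra.
have {cG} [G' [mG [c1 c2] mn]] := minimal_in_class cG.
exists G'; split=> //; rewrite /critical.
set N : R := #|G'|%:R in c1 c2 *.
(* If d <= N < d + 1, there would be at least 2d (d - d / 4) = 3/2 d^2 arcs, more than (d + 1)^2 as
   d >= 5. With N >= d + 1, losing one vertex keeps the order at least [d]. *)
have N1 : d + 1 <= N.
  have h : (arcs G')%:R <= N * N by rewrite -natrM ler_nat arcs_le.
  rewrite leNgt; apply/negP => lt.
  have h1 : 2 * d * (N - k) <= N * N by lra.
  have h2 : N * N <= (d + 1) * (d + 1) by apply: ler_pM; lra.
  have h3 : 2 * d * (d - d / 4) <= 2 * d * (N - k) by apply: ler_wpM2l; lra.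
  nra.
have small (G'' : sgraph) : minor G'' G' -> (#|G''| < #|G'|)%N -> d <= #|G''|%:R ->
    (arcs G'')%:R < 2 * d * (#|G''|%:R - k).
  move=> m lt hd; rewrite ltNge; apply/negP => h.
  by have := mn G'' m (conj hd h); rewrite leqNgt weight_lt.
have ub : (arcs G')%:R <= 2 * d * (N - k) + 2.
  rewrite leNgt; apply/negP => gt.
  have [[a b] /= ab|no] := pickP [pred p : G' * G' | edge p.1 p.2]; last first.
    have a0 : arcs G' = 0%N.
      by rewrite arcsE big1 // => x _; rewrite big1 // => y _; have /= -> := no (x, y).
    move: gt; rewrite a0; have : 0 <= d * (N - k) by apply: mulr_ge0; lra.
    lra.
  have e := arcs_delete_edge ab.
  have c : dense_class (delete_edge a b).
    by split=> //; move: gt; rewrite e natrD -/N /=; lra.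
  have := mn _ (minor_delete_edge a b) c; rewrite /weight e /=.
  by rewrite leqNgt ltn_add2l addn2 ltnS leqnSn.
have mindeg x : d <= (dg x [set: G'])%:R.
  have cS : #|induced_subgraph [set~ x]|%:R = N - 1 :> R.
    rewrite card_induced /N cardsC1 -subn1 natrB //; apply/card_gt0P; by exists x.
  have lt : (#|induced_subgraph [set~ x]| < #|G'|)%N by rewrite -(ltr_nat R) cS -/N; lra.
  have := small _ (minor_induced [set~ x]) lt; rewrite cS => /(_ ltac:(lra)).
  rewrite arcs_induced; have sx : [set x] \subset [set: G'] by rewrite subsetT.
  have := ar_setD sx; rewrite ar1 (_ : [set: G'] :\: [set x] = [set~ x]); last first.
    by apply/setP => y; rewrite !inE andbT.
  rewrite -(ler_nat R) natrD natrM -/(arcs G'); lra.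
split=> //.
  move=> a b ab; have := arcs_contract ab; rewrite -(ler_nat R) natrD natrM => h.
  have cc : #|contract a b|%:R = N - 1 :> R by rewrite /N -(card_contract a b) -natr1 addrK.
  have lt : (#|contract a b| < #|G'|)%N by rewrite -(card_contract a b).
  have := small _ (minor_contract ab) lt; rewrite cc => /(_ ltac:(lra)).
  move: h; rewrite -[(codegree a b).+1%:R]natr1; lra.
move=> A B AB sep nA nB.
have lt (X : {set G'}) x : x \notin X -> (#|X| < #|G'|)%N.
  move=> xX; rewrite -cardsT; apply: proper_card; apply/properP; split.
    exact: subsetT.
  by exists x; rewrite ?inE.
have big (X Y : {set G'}) : X :|: Y = [set: G'] -> X :\: Y != set0 ->
    (forall u v, u \in X -> u \notin Y -> v \in Y -> v \notin X -> edge u v = false) ->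
    d <= #|X|%:R.
  move=> XY /set0Pn[x]; rewrite inE => /andP[xY xX] sp.
  apply: le_trans (mindeg x) _; rewrite ler_nat; apply: subset_leq_card.
  apply/subsetP => y; rewrite inE => /andP[_ xy].
  have := inAB y XY; case: (boolP (y \in X)) => //= yX yY.
  by rewrite sp in xy.
have [x /andP[xA xB]] : exists x, (x \notin A) && (x \in B).
  by have /set0Pn[x] := nB; rewrite inE; exists x.
have [y /andP[yB yA]] : exists y, (y \notin B) && (y \in A).
  by have /set0Pn[y] := nA; rewrite inE; exists y.
have hA := small _ (minor_induced A); rewrite card_induced arcs_induced in hA.
have {}hA := hA (lt A x xA) (big A B AB nA sep).
have hB := small _ (minor_induced B); rewrite card_induced arcs_induced in hB.
have {}hB : (ar B B)%:R < 2 * d * (#|B|%:R - k).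
  apply: hB; first exact: (lt B y).
  apply: (big B A) => //; first by rewrite setUC.
  by move=> u v uB uA vA vB; rewrite edge_sym; apply: sep.
have cAB : #|A|%:R + #|B|%:R = N + #|A :&: B|%:R :> R.
  by rewrite /N -natrD -cardsUI AB cardsT natrD.
have har : (arcs G' <= ar A A + ar B B)%N.
  rewrite arcsE !arE.
  have e (X : {set G'}) : (\sum_(x in X) \sum_(y in X) edge x y
      = \sum_(x : G') \sum_(y : G') [&& x \in X, y \in X & edge x y])%N.
    rewrite big_mkcond; apply: eq_bigr => u _; case: (u \in X) => /=; last by rewrite big1.
    by rewrite big_mkcond; apply: eq_bigr => v _; case: (v \in X).
  rewrite !e -big_split; apply: leq_sum => u _; rewrite -big_split; apply: leq_sum => v _ /=.
  case uv : (edge u v) => //; rewrite !andbT.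
  have := inAB u AB; have := inAB v AB.
  case uA : (u \in A); case uB : (u \in B); case vA : (v \in A); case vB : (v \in B) => //= _ _.
    by rewrite (sep u v) ?uA ?uB ?vA ?vB // in uv.
  by rewrite edge_sym (sep v u) ?uA ?uB ?vA ?vB // in uv.
move: har; rewrite -(ler_nat R) natrD => har.
have dp : 0 < 2 * d by lra.
(* Both sides of the separation pay the offset [k], the whole graph only once, and the orders of the
   sides add up to N + |A :&: B|. *)
have : 2 * d * (N - k) < 2 * d * (#|A|%:R + #|B|%:R - 2 * k) by lra.
rewrite ltr_pM2l //; lra.
Qed.

End MinimalMinor.

(** * Dense sets of bounded size *)

Section Linking.
Variable R : realType.

Lemma greedy_sets (V L : finType) (good : L -> {set V} -> Prop) (w : R) (ell : nat) :
  (forall l (W : {set V}), #|W|%:R <= w ->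
    exists X : {set V}, [/\ good l X, [disjoint X & W] & (#|X| <= ell)%N]) ->
  (#|L| * ell)%:R <= w ->
  exists X : L -> {set V}, (forall l, good l (X l)) /\
    forall l l', l != l' -> [disjoint X l & X l'].
Proof.
move=> step hw.
suff : forall s : seq L, uniq s -> exists X : L -> {set V},
    [/\ forall l, l \in s -> good l (X l),
        forall l l', l \in s -> l' \in s -> l != l' -> [disjoint X l & X l']
      & (#|\bigcup_(l in s) X l| <= size s * ell)%N].
  move=> /(_ (enum L) (enum_uniq _)) [X [h1 h2 _]].
  by exists X; split=> [l|l l']; [apply: h1 | apply: h2]; rewrite mem_enum.
elim=> [|l s IH] /=.
  move=> _; exists (fun=> set0); split=> //.
  by rewrite big1 ?cards0 // => l; rewrite in_nil.
move=> /andP[ls us]; have [X [h1 h2 h3]] := IH us.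
have ss : (size s <= #|L|)%N by rewrite -(card_uniqP us) max_card.
have [|Y [gY dY cY]] := step l (\bigcup_(l' in s) X l').
  apply: le_trans hw; rewrite ler_nat; apply: leq_trans h3 _.
  by rewrite leq_mul2r ss orbT.
pose X' l' := if l' == l then Y else X l'.
have X's l' : l' \in s -> X' l' = X l'.
  by rewrite /X'; case: eqP => // -> h; rewrite h in ls.
have XU l' : l' \in s -> X l' \subset \bigcup_(l' in s) X l'.
  by move=> h; apply: (bigcup_sup l').
exists X'; split.
- move=> l'; rewrite inE => /orP[/eqP->|l's]; first by rewrite /X' eqxx.
  by rewrite X's //; apply: h1.
- move=> a b; rewrite !inE => /orP[/eqP->|sa] /orP[/eqP->|sb] ab.
  + by rewrite eqxx in ab.
  + by rewrite (X's b sb) /X' eqxx; apply: disjointWr (XU b sb) dY.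
  + by rewrite (X's a sa) /X' eqxx disjoint_sym; apply: disjointWr (XU a sa) dY.
  by rewrite !X's //; apply: h2.
have sub : \bigcup_(l' in l :: s) X' l' \subset Y :|: \bigcup_(l' in s) X l'.
  apply/bigcupsP => l'; rewrite inE => /orP[/eqP->|l's].
    by rewrite /X' eqxx subsetUl.
  by rewrite X's //; apply: subset_trans (XU l' l's) (subsetUr _ _).
apply: leq_trans (subset_leq_card sub) _; apply: leq_trans (leq_card_setU _ _) _.
by rewrite mulSn leq_add.
Qed.

Lemma linkable_reservoir (G : sgraph) (S Q T : {set G}) (w : R) (ell J : nat) :
  reservoir S Q w ell -> T \subset S -> [disjoint T & Q] -> (J * ell)%:R <= w ->
  linkable T J.
Proof.
move=> [sQ res] sT dT hw L f cL fT.
have [||X [X1 X2]] := @greedy_sets G L (fun l X => X \subset Q /\ joined X (f l).1 (f l).2) w ell.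
- move=> l W hW; have [f1 f2] := fT l.
  have [X [X1 X2 X3 X4]] := res W hW (f l).1 (f l).2 (subsetP sT _ f1) (subsetP sT _ f2).
  by exists X.
- by apply: le_trans hw; rewrite ler_nat leq_mul2r cL orbT.
exists X; split=> // l; have [s j] := X1 l; split=> //.
by rewrite disjoint_sym; apply: disjointWr s dT.
Qed.

(** Collects all that the upper bound uses about [H]. Here [d] is an upper bound for max (n / 2,
    tau), and [dl] bounds the proportion of repeated vertices. *)
Definition hostable (H : sgraph) (d dl : R) (K : nat) : Prop :=
  exists (I : finType) (P : I -> {set H}) (C : {set H}) (col : H -> 'I_4),
  [/\ [/\ forall i, (#|P i| <= K)%N, forall x, exists i, x \in P i
        & forall x y, edge x y -> exists i, x \in P i /\ y \in P i],
      vertex_cover C, forall x y, edge x y -> col x != col y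
    & [/\ #|H|%:R <= 2 * d, #|C|%:R <= d & (\sum_i #|P i|)%:R <= (1 + dl) * #|H|%:R]].

Lemma hostable_mono (H : sgraph) (d dl dl' : R) (K : nat) : dl <= dl' ->
  hostable H d dl K -> hostable H d dl' K.
Proof.
move=> h [I [P [C [col [h1 h2 h3 [h4 h5 h6]]]]]]; exists I, P, C, col; split=> //; split=> //.
by apply: le_trans h6 _; rewrite ler_wpM2r // lerD2l.
Qed.

(** Only a repetition of a vertex can add to the number of cover copies beyond |C|. *)
Lemma cover_copies (H : sgraph) (I : finType) (P : I -> {set H}) (C : {set H}) :
  (forall x, exists i, x \in P i) ->
  (\sum_i #|P i :&: C| + #|H| <= #|C| + \sum_i #|P i|)%N.
Proof.
move=> PH.
have sw (Z : I -> {set H}) : (\sum_i #|Z i| = \sum_x \sum_i (x \in Z i))%N.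
  rewrite exchange_big; apply: eq_bigr => i _.
  by rewrite -sum1_card big_mkcond /=; apply: eq_bigr => x _; case: (x \in Z i).
rewrite !sw -[#|H|]sum1_card -[#|C|]sum1_card [X in (_ <= X + _)%N]big_mkcond -!big_split /=.
apply: leq_sum => x _; have [xC|xC] := boolP (x \in C).
  by rewrite addnC leq_add2l; apply: leq_sum => i _; rewrite inE xC andbT.
rewrite big1 ?add0n ?addn0; last by move=> i _; rewrite inE (negbTE xC) andbF.
by have [i xi] := PH x; rewrite (bigD1 i) //= xi.
Qed.

Lemma embed_hostable (H G : sgraph) (d dl : R) (K q r J : nat) (T : nat -> {set G}) :
  0 <= dl -> 0 <= d -> hostable H d dl K -> (0 < q)%N -> (0 < r)%N ->
  (forall b, (b < r)%N -> block q (T b)) ->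
  (forall b b', (b < b')%N -> (b' < r)%N -> [disjoint T b & T b']) ->
  linkable (\bigcup_(b < r) T b) J ->
  (1 + 2 * dl) * (2 * d) + 8 * r%:R * (type_bound K)%:R <= 4 * r%:R * q%:R ->
  2 * dl * d <= J%:R -> minor H G.
Proof.
move=> dl0 d0 [I [P [C [col [[h1 h2 h3] h4 h5 [h6 h7 h8]]]]]] q0 r0 bT dT lk hr hJ.
have cc := cover_copies C h2; rewrite -(ler_nat R) !natrD in cc.
have p1 : 0 <= dl * d by rewrite mulr_ge0.
have p2 : dl * #|H|%:R <= dl * (2 * d) by rewrite ler_wpM2l.
have p3 : 0 <= r%:R * (type_bound K)%:R :> R by rewrite mulr_ge0.
apply: (@embedding H G I P K C col q r J T) => //.
- by move: (type_bound K) p3 hr => c p3 hr; rewrite -(ler_nat R) natrD !natrM; lra.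
- by move: (type_bound K) p3 hr => c p3 hr; rewrite -(ler_nat R) natrD !natrM; lra.
by rewrite -(ler_nat R) natrD; lra.
Qed.

(** The number of blocks is even because [two_pieces] splits them between two sets. The first
    inequality is the capacity needed for all copies, with [c] the rounding error per bin; the
    second is the cost of half of the blocks in [pack]. They are compatible since [q] is so large
    that 8c is small against 4q. *)
Lemma choose_blocks (ep : R) (c : nat) : 0 < ep -> ep <= 1 ->
  exists (q : nat) (d0 : R), [/\ (0 < q)%N, 1 <= d0 & forall (d dl : R), d0 <= d ->
    0 <= dl -> dl <= ep / 100 -> exists r1 : nat, [/\ (0 < r1)%N,
      (1 + 2 * dl) * (2 * d) + 8 * (2 * r1)%:R * c%:R <= 4 * (2 * r1)%:R * q%:R :> R
    & r1%:R * (4 * q%:R * (1 + ep / 100)) <= d * (1 + ep / 10) :> R]].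
Proof.
move=> ep0 ep1; have [q' hq'] := exists_nat_ge (200 * c%:R / ep : R).
pose q := q'.+1; exists q, (160 * q%:R / ep); split=> //.
  have : 1 <= q%:R :> R by rewrite ler1n.
  by move=> h; rewrite ler_pdivlMr //; lra.
move=> d dl hd dl0 dl1.
have q1 : 1 <= q%:R :> R by rewrite ler1n.
have hq : 200 * c%:R <= ep * q%:R.
  move: hq'; rewrite ler_pdivrMr // => h; rewrite /q -natr1; lra.
have {}hd : 160 * q%:R <= ep * d by move: hd; rewrite ler_pdivrMr // [d * ep]mulrC.
have c0 : 0 <= c%:R :> R by [].
have d0 : 0 < d by nra.
pose D : R := 4 * q%:R - 8 * c%:R.
have Dq : 4 * q%:R * (1 - ep / 100) <= D by rewrite /D; lra.
have D0 : 0 < D by apply: lt_le_trans Dq; rewrite mulr_gt0; lra.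
have [m [m1 m2]] := @truncn_bounds R ((1 + 2 * dl) * d / D) ltac:(by rewrite divr_ge0 ?mulr_ge0 //; lra).
exists m.+1; split=> //; rewrite ?natrM -[m.+1%:R]natr1.
  move: m2; rewrite ltr_pdivrMr // /D; lra.
move: m1; rewrite ler_pdivlMr // => m1.
have m0 : 0 <= m%:R :> R by [].
have a1 : m%:R * (4 * q%:R * (1 - ep / 100)) <= (1 + 2 * dl) * d.
  by apply: le_trans m1; rewrite ler_wpM2l.
have a2 : (1 + 2 * dl) * d <= (1 + ep / 50) * d by rewrite ler_pM2r //; lra.
have a3 : m%:R * (4 * q%:R) * (1 - ep / 100) <= (1 + ep / 50) * d by lra.
have a4 : m%:R * (4 * q%:R) <= (1 + ep / 50) * d + ep / 50 * d.
  have x0 : 0 <= m%:R * (4 * q%:R) :> R by rewrite mulr_ge0 //; lra.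
  have : m%:R * (4 * q%:R) <= (1 + ep / 25) * d.
    rewrite -(@ler_pM2r _ (1 - ep / 100)); last lra.
    apply: le_trans a3 _; rewrite mulrAC ler_pM2r //; nra.
  lra.
have a5 : m%:R * (4 * q%:R) * (ep / 100) <= 2 * d * (ep / 100).
  apply: ler_wpM2r; first lra.
  apply: le_trans a4 _; nra.
have a6 : q%:R * ep <= q%:R by nra.
lra.
Qed.

(* [dl] depends on the capacity of the reservoir only, so that the sublinear
   separators of [H] can be used to choose the size [K] of the pieces after it. *)
Lemma dense_minor (ep Cc : R) : 0 < ep -> ep <= 1 -> 1 <= Cc ->
  exists dl : R, 0 < dl /\ forall K, exists d0 : R, forall d, d0 <= d ->
  forall H, hostable H d dl K -> forall (G : sgraph) (S : {set G}),
  S != set0 -> #|S|%:R <= Cc * d ->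
  2 * (1 + ep) * d * #|S|%:R <= (ar S S)%:R -> minor H G.
Proof.
move=> ep0 ep1 Cc1.
(* The penalty lam |S|^2 is then at most ep d |S|, half of the excess over the average degree 2d. *)
pose lam := ep / Cc.
have lam0 : 0 < lam by rewrite divr_gt0 //; lra.
have lam1 : lam <= 1 by rewrite ler_pdivrMr; lra.
have lamC : lam * Cc = ep by rewrite /lam mulfVK //; lra.
(* The reservoir will have at most Cc d / M <= ep d / 8 vertices. *)
have [M' hM'] := exists_nat_ge (8 * Cc / ep); pose M := (M'.+2)%N.
have hM : 8 * Cc <= ep * M%:R.
  move: hM'; rewrite ler_pdivrMr // => h; rewrite /M -addn2 natrD; lra.
have M2 : 2 <= M%:R :> R by rewrite (ler_nat R 2).
have [ell [N0 [c [c0 res]]]] := @reservoir_exists R lam M lam0 lam1 isT.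
(* About 2 dl d links of at most [ell] vertices each have to fit into the capacity c |S1| >= 2 c d
   of the reservoir. *)
pose dl : R := Num.min (ep / 100) (c / (2 * ell.+1%:R)).
have l1 : 1 <= ell.+1%:R :> R by rewrite ler1n.
have dl0 : 0 < dl by rewrite lt_min divr_gt0 // divr_gt0 // mulr_gt0 //; lra.
have dl1 : dl <= ep / 100 by rewrite ge_min lexx.
have dl2 : 2 * dl * ell.+1%:R <= c.
  have : dl <= c / (2 * ell.+1%:R) by rewrite ge_min lexx orbT.
  rewrite ler_pdivlMr; lra.
exists dl; split=> // K.
have [q [dq [q0 dq1 hq]]] := @choose_blocks ep (type_bound K) ep0 ep1.
have e1 : 0 < ep / 100 by lra.
have e2 : ep / 100 <= 1 by lra.
pose eta := ep / (10 * Cc).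
have eta0 : 0 < eta by rewrite divr_gt0 //; lra.
have eta1 : eta <= 1 by rewrite ler_pdivrMr; lra.
have etaC : eta * Cc = ep / 10 by rewrite /eta; field; lra.
have [Np hpack] := @pack R (ep / 100) eta q e1 e2 eta0 eta1 q0.
exists (dq + N0%:R + `|Np| + ell.+1%:R / c) => d hd H hH G S S0 cS hS.
have hNp := ler_norm Np; have hNp0 := normr_ge0 Np.
have N00 : 0 <= N0%:R :> R by [].
have lc0 : 0 < ell.+1%:R / c by rewrite divr_gt0 //; lra.
have d1 : 1 <= d by lra.
have [S1 [sS1 S10 rS1 hS1]] := @robust_subset R G lam (fun=> 0) S (ltW lam0) S0.
rewrite !big1 // !subr0 in hS1.
set s : R := #|S|%:R in cS hS hS1; set s1 : R := #|S1|%:R in hS1.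
have s0 : 0 < s by rewrite ltr0n card_gt0.
have s10 : 0 < s1 by rewrite ltr0n card_gt0.
have s1s : s1 <= s by rewrite ler_nat subset_leq_card.
have ar1 : (2 + ep) * d * s1 <= (ar S1 S1)%:R.
  rewrite -(ler_pM2r s0).
  have a1 : 2 * (1 + ep) * d * s * s1 <= (ar S S)%:R * s1 by rewrite ler_pM2r.
  have a2 : lam * s ^+ 2 * s1 <= ep * d * s * s1.
    rewrite ler_pM2r // expr2 mulrA ler_pM2r // -lamC -mulrA ler_pM2l //; lra.
  have a3 : 0 <= lam * s1 ^+ 2 * s 
    by apply: mulr_ge0; [apply: mulr_ge0; [exact: ltW | rewrite exprn_ge0 // ltW] | exact: ltW].
  lra.
have s1d : (2 + ep) * d <= s1.
  rewrite -(ler_pM2r s10); apply: le_trans ar1 _.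
  by rewrite -natrM ler_nat ar_le.
have [|Q [cQ rQ]] := res G S1 rS1.
  rewrite -(ler_nat R); apply: le_trans s1d; nra.
have {}cQ : #|Q|%:R * M%:R <= s1 by rewrite -natrM ler_nat.
have q00 : 0 <= #|Q|%:R :> R by [].
have sQ : Q \subset S1 by case: rQ.
pose S2 := S1 :\: Q.
have cS2 : #|S2|%:R = s1 - #|Q|%:R.
  by rewrite /s1 -(cardsID Q S1) (setIidPr sQ) natrD addrAC subrr add0r.
have cQ' : 8 * #|Q|%:R <= ep * d.
  have Cc0 : 0 < Cc by lra.
  have b1 : ep * (#|Q|%:R * M%:R) <= ep * (Cc * d) by rewrite ler_pM2l //; lra.
  have b2 : 8 * Cc * #|Q|%:R <= ep * M%:R * #|Q|%:R by rewrite ler_wpM2r.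
  rewrite -(ler_pM2l Cc0); lra.
have ar2 : (2 + 3 / 4 * ep) * d * #|S2|%:R <= (ar S2 S2)%:R.
  have := ar_setD sQ; have := ar_le Q S1; rewrite -!(ler_nat R) natrD !natrM -/s1 -/S2.
  move=> h1 h2.
  have h3 : 8 * #|Q|%:R * s1 <= ep * d * s1 by rewrite ler_pM2r.
  have h4 : (2 + 3 / 4 * ep) * d * #|S2|%:R <= (2 + 3 / 4 * ep) * d * s1.
    apply: ler_wpM2l; last by rewrite cS2 gerBl.
      by apply: mulr_ge0; clear -d1 ep0; lra.
  lra.
have S20 : S2 != set0.
  by rewrite -card_gt0 -(ltr0n R) cS2; nra.
have [r1 [r10 hr1 hr2]] := hq d dl ltac:(lra) (ltW dl0) dl1.
have [||||T [T1 T2]] := hpack (2 * r1)%N G S2 ((2 + 3 / 4 * ep) * d) (Cc * d) S20.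
- by rewrite cS2; lra.
- nra.
- rewrite natrM mulrA etaC -[2 * r1%:R * _]mulrA; nra.
- by [].
have dp : 0 < d by clear -d1; lra.
have dd0 : 0 <= 2 * dl * d by rewrite !mulr_ge0 // ltW.
have [J [J1 J2]] := @truncn_bounds R (2 * dl * d) dd0.
have lcd : ell.+1%:R <= c * d.
  rewrite [c * d]mulrC -ler_pdivrMr //; clear -hd N00 hNp0 dq1; lra.
have dpe : ell%:R <= ell.+1%:R :> R by rewrite ler_nat.
have wJ : (J.+1 * ell)%:R <= c * s1.
  rewrite natrM -[J.+1%:R]natr1.
  have h2 : 2 * dl * ell.+1%:R * d <= c * d by rewrite ler_pM2r.
  have h3 : (J%:R + 1) * ell%:R <= (2 * dl * d + 1) * ell.+1%:R.
    apply: ler_pM; [by clear; have : 0 <= J%:R :> R by []; lra | by [] | by rewrite lerD2r | by []].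
  have h4 : c * (2 * d) <= c * s1.
    by rewrite ler_pM2l //; apply: le_trans s1d; rewrite ler_pM2r //; clear -ep0; lra.
  clear -h2 h3 h4 lcd; lra.
apply: (@embed_hostable H G d dl K q (2 * r1) J.+1 T) => //.
- exact: ltW.
- exact: ltW.
- by rewrite muln_gt0.
- by move=> b /T1[].
- apply: (@linkable_reservoir G S1 Q _ (c * s1) ell) => //.
  + apply/bigcupsP => b _; have [_ h] := T1 b (ltn_ord b).
    exact: subset_trans h (subsetDl _ _).
  rewrite disjoint_sym disjoints_subset; apply/subsetP => z zQ; rewrite inE.
  apply/negP => /bigcupP[b _ zT]; have [_ h] := T1 b (ltn_ord b).
  by have := subsetP h z zT; rewrite inE zQ.
by rewrite -[J.+1%:R]natr1; clear -J2; lra.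
Qed.

End Linking.

(** * Two robust sets *)

Section TwoPieces.
Variable R : realType.

(** Two vertices on the same side are joined inside one reservoir. Otherwise the link follows its
    own path [p (idx l)] and reaches the two ends of that path through the reservoirs. The paths
    meet [R1 :|: R2] only in their ends [W0], so reservoir vertices outside [W0] avoid all paths. *)
Lemma linkable_two (G : sgraph) (R1 R2 Q1 Q2 T1 T2 : {set G}) (w : R) (ell J : nat)
    (p : 'I_J -> {set G}) (a b : 'I_J -> G) :
  (forall i, [/\ connected_in (p i), a i \in p i, b i \in p i, a i \in R1 & b i \in R2]) ->
  (forall i z, z \in p i -> z \in R1 -> z = a i) ->
  (forall i z, z \in p i -> z \in R2 -> z = b i) ->
  (forall i j, i != j -> [disjoint p i & p j]) ->
  reservoir R1 Q1 w ell -> reservoir R2 Q2 w ell ->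
  T1 \subset R1 -> T2 \subset R2 -> [disjoint T1 :|: T2 & Q1 :|: Q2] ->
  (forall i, a i \notin T1 :|: T2) -> (forall i, b i \notin T1 :|: T2) ->
  (J * (2 * ell) + 2 * J + ell)%:R <= w ->
  linkable (T1 :|: T2) J.
Proof.
move=> hp pa pb dp [sQ1 res1] [sQ2 res2] sT1 sT2 dTQ aT bT hw L f cL fT.
pose W0 := [set a i | i in 'I_J] :|: [set b i | i in 'I_J].
have cW0 : (#|W0| <= 2 * J)%N.
  apply: leq_trans (leq_card_setU _ _) _; rewrite mul2n -addnn.
  by apply: leq_add; apply: leq_trans (leq_imset_card _ _) _; rewrite card_ord.
have aW i : a i \in W0 by rewrite inE imset_f.
have bW i : b i \in W0 by rewrite inE orbC imset_f.
pose idx (l : L) : 'I_J := widen_ord cL (enum_rank l).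
have idxI : injective idx by move=> l l' /(congr1 val) /= h; apply/enum_rank_inj/val_inj.
have side u : u \in T1 :|: T2 -> u \in R1 \/ u \in R2.
  by rewrite inE => /orP[/(subsetP sT1)|/(subsetP sT2)]; auto.
have cUle (X Y : {set G}) (m n : nat) : (#|X| <= m)%N -> (#|Y| <= n)%N -> (#|X :|: Y| <= m + n)%N.
  by move=> h1 h2; apply: leq_trans (leq_card_setU _ _) _; apply: leq_add.
pose good l (X : {set G}) := [/\ X \subset Q1 :|: Q2, [disjoint X & W0]
   & joined X (f l).1 (f l).2 \/ joined (X :|: p (idx l)) (f l).1 (f l).2].
have cross l (X1 X2 : {set G}) u v : joined X1 u (a (idx l)) -> joined X2 (b (idx l)) v ->
    joined ((X1 :|: X2) :|: p (idx l)) u v.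
  move=> j1 j2; have [cp ap bp _ _] := hp (idx l).
  have jp : joined (p (idx l)) (a (idx l)) (b (idx l)).
    by rewrite /joined !(setUidPr _) ?sub1set // inE ?ap ?orbT.
  have := joined_cat (joined_cat j1 jp) j2.
  congr joined; apply/setP => z; rewrite !inE.
  have [->|_] := eqVneq z (b (idx l)); first by rewrite bp !orbT.
  have [->|_] := eqVneq z (a (idx l)); first by rewrite ap !orbT.
  by rewrite /= -!orbA; congr (_ || _); rewrite orbC.
have [||X [X1 X2]] := @greedy_sets R G L good (J * (2 * ell))%:R (2 * ell).
- move=> l W; rewrite ler_nat => hW; have [f1 f2] := fT l.
  set u := (f l).1; set v := (f l).2.
  have w1 : #|W :|: W0|%:R <= w.
    apply: le_trans hw; rewrite ler_nat; apply: leq_trans (cUle _ _ _ _ hW cW0) _.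
    exact: leq_addr.
  have w2 (X : {set G}) : (#|X| <= ell)%N -> #|(W :|: W0) :|: X|%:R <= w.
    move=> cX; apply: le_trans hw; rewrite ler_nat.
    exact: (cUle _ _ _ _ (cUle _ _ _ _ hW cW0) cX).
  have l2 : (ell <= 2 * ell)%N by rewrite leq_pmull.
  have single (X : {set G}) : X \subset Q1 :|: Q2 -> [disjoint X & W :|: W0] -> (#|X| <= ell)%N ->
      joined X u v -> exists X : {set G}, [/\ good l X, [disjoint X & W] & (#|X| <= 2 * ell)%N].
    move=> sX; rewrite disjoint_sym disjUl => /andP[dW dW0] cX jX.
    exists X; split; [split=> // | | exact: leq_trans cX l2]; rewrite ?[[disjoint X & _]]disjoint_sym //.
    by left.
  have double (X Y : {set G}) : X \subset Q1 :|: Q2 -> Y \subset Q1 :|: Q2 ->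
      [disjoint X & W :|: W0] -> [disjoint Y & W :|: W0] -> (#|X| <= ell)%N -> (#|Y| <= ell)%N ->
      joined ((X :|: Y) :|: p (idx l)) u v ->
      exists X : {set G}, [/\ good l X, [disjoint X & W] & (#|X| <= 2 * ell)%N].
    move=> sX sY; rewrite disjoint_sym disjUl => /andP[dW dW0].
    rewrite disjoint_sym disjUl => /andP[dW' dW0'] cX cY jX.
    exists (X :|: Y); split; last by rewrite mul2n -addnn; apply: cUle.
      split; first by rewrite subUset sX.
        by rewrite disjUl ![[disjoint _ & W0]]disjoint_sym dW0.
      by right.
    by rewrite disjUl ![[disjoint _ & W]]disjoint_sym dW.
  have [_ _ _ aR bR] := hp (idx l).
  have [uR|uR] := side u f1; have [vR|vR] := side v f2.
  + have [X [s1 d1 c1 j1]] := res1 _ w1 u v uR vR.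
    by apply: (single X) => //; apply: subset_trans s1 (subsetUl _ _).
  + have [X [s1 d1 c1 j1]] := res1 _ w1 u (a (idx l)) uR aR.
    have [Y [s2 d2 c2 j2]] := res2 _ w1 (b (idx l)) v bR vR.
    apply: (double X Y) => //; last exact: cross.
      exact: subset_trans s1 (subsetUl _ _).
    exact: subset_trans s2 (subsetUr _ _).
  + have [X [s1 d1 c1 j1]] := res1 _ w1 v (a (idx l)) vR aR.
    have [Y [s2 d2 c2 j2]] := res2 _ w1 (b (idx l)) u bR uR.
    apply: (double X Y) => //; last by apply/joined_sym/cross.
      exact: subset_trans s1 (subsetUl _ _).
    exact: subset_trans s2 (subsetUr _ _).
  have [X [s1 d1 c1 j1]] := res2 _ w1 u v uR vR.
  by apply: (single X) => //; apply: subset_trans s1 (subsetUr _ _).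
- by rewrite ler_nat leq_mul2r cL orbT.
have exY l : exists Y, (Y = X l \/ Y = X l :|: p (idx l)) /\ joined Y (f l).1 (f l).2.
  by have [_ _ [j|j]] := X1 l; [exists (X l) | exists (X l :|: p (idx l))]; auto.
have [Y hY] := choice exY.
have inY l z : z \in Y l -> z \in X l \/ z \in p (idx l).
  by have [[->|->] _] := hY l; [left | rewrite inE => /orP[]; auto].
have Qsub : Q1 :|: Q2 \subset R1 :|: R2 by apply: setUSS.
have pW l z : z \in p l -> z \in R1 :|: R2 -> z \in W0.
  by move=> zp; rewrite inE => /orP[/(pa l z zp)->|/(pb l z zp)->].
have Xp l l' z : z \in X l -> z \in p l' -> False.
  move=> zX zp; have [sX dX _] := X1 l.
  apply: (disjoint_false dX zX); apply: pW zp _.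
  by apply: (subsetP Qsub); apply: (subsetP sX).
exists Y; split.
  move=> l; split; last by case: (hY l).
  apply: disjointI' => z /inY[zX|zp] zT.
    have [sX _ _] := X1 l; apply: (disjoint_false dTQ zT).
    exact: (subsetP sX).
  have zR : z \in R1 :|: R2 by apply: (subsetP (setUSS sT1 sT2)).
  move: zR zT; rewrite inE => /orP[/(pa _ _ zp)->|/(pb _ _ zp)->].
    by rewrite (negbTE (aT _)).
  by rewrite (negbTE (bT _)).
move=> l l' ll'; apply: disjointI' => z /inY[z1|z1] /inY[z2|z2].
- exact: (disjoint_false (X2 l l' ll')) z1 z2.
- exact: Xp z1 z2.
- exact: Xp z2 z1.
apply: (disjoint_false (dp _ _ (_ : idx l != idx l')) z1 z2).
by apply: contra ll' => /eqP/idxI->.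
Qed.

Lemma setDD_cap (T : finType) (X Z : {set T}) : X :\: (X :\: Z) = X :&: Z.
Proof. by rewrite setDDr setDv set0U. Qed.

Lemma pieces_setup (ep d : R) (G : sgraph) (X Y : {set G}) (x : R) :
  Y \subset X -> (1 + ep) * d * #|X|%:R <= (ar X X)%:R ->
  #|X :\: Y|%:R <= x -> 0 <= d -> 0 <= ep ->
  8 * x <= ep * d -> (1 + ep / 2) * d * #|Y|%:R <= (ar Y Y)%:R.
Proof.
move=> sYX h1 h2 d0 ep0 h3.
have sD : X :\: Y \subset X by exact: subsetDl.
have := ar_setD sD; have := ar_le (X :\: Y) X.
rewrite setDD_cap (setIidPr sYX) -!(ler_nat R) natrD !natrM => h4 h5.
have X0 : 0 <= #|X|%:R :> R by [].
have h6 : #|X :\: Y|%:R * #|X|%:R <= x * #|X|%:R by rewrite ler_wpM2r.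
have h7 : 8 * x * #|X|%:R <= ep * d * #|X|%:R by rewrite ler_wpM2r.
have h8 : (1 + ep / 2) * d * #|Y|%:R <= (1 + ep / 2) * d * #|X|%:R.
  rewrite ler_wpM2l ?mulr_ge0 //; first lra.
  by rewrite ler_nat subset_leq_card.
have h9 : 0 <= ep * d * #|X|%:R by rewrite !mulr_ge0.
clear -h1 h5 h4 h6 h7 h8 h9; lra.
Qed.

(* The pieces have half the density that [dense_minor] asks for, but each one only
   has to provide half of the blocks. *)
Lemma two_pieces (ep Cc lam : R) : 0 < ep -> ep <= 1 -> 1 <= Cc -> 0 < lam -> lam <= 1 ->
  exists dl : R, [/\ 0 < dl, dl <= ep / 400 & forall K, exists d0 : R, forall d, d0 <= d ->
  forall H, hostable H d dl K -> forall (G : sgraph) (R1 R2 : {set G}),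
  robust lam R1 -> robust lam R2 -> R1 != set0 -> R2 != set0 ->
  #|R1|%:R <= Cc * d -> #|R2|%:R <= Cc * d ->
  (1 + ep) * d * #|R1|%:R <= (ar R1 R1)%:R -> (1 + ep) * d * #|R2|%:R <= (ar R2 R2)%:R ->
  #|R1 :&: R2|%:R <= ep / 20 * d ->
  (forall J : nat, J%:R <= 2 * dl * d + 1 -> linked_by R1 R2 J) -> minor H G].
Proof.
move=> ep0 ep1 Cc1 lam0 lam1.
have [M' hM'] := exists_nat_ge (80 * Cc / ep); pose M := (M'.+2)%N.
have hM : 80 * Cc <= ep * M%:R.
  move: hM'; rewrite ler_pdivrMr // => h; rewrite /M -addn2 natrD; lra.
have [ell [N0 [c [c0 res]]]] := @reservoir_exists R lam M lam0 lam1 isT.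
have l1 : 1 <= ell.+1%:R :> R by rewrite ler1n.
pose dl : R := Num.min (ep / 400) (c / (8 * ell.+1%:R)).
have dl0 : 0 < dl.
  rewrite lt_min; apply/andP; split; first lra.
  by apply: divr_gt0; [exact: c0 | apply: mulr_gt0; lra].
have dl1 : dl <= ep / 400 by rewrite /dl ge_min lexx.
have dl2 : 8 * dl * ell.+1%:R <= c.
  have : dl <= c / (8 * ell.+1%:R) by rewrite ge_min lexx orbT.
  rewrite ler_pdivlMr; lra.
exists dl; split=> // K.
have [q [dq [q0 dq1 hq]]] := @choose_blocks R ep (type_bound K) ep0 ep1.
have e1 : 0 < ep / 100 by lra.
have e2 : ep / 100 <= 1 by lra.
pose eta := ep / (10 * Cc).
have eta0 : 0 < eta by rewrite divr_gt0 //; lra.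
have eta1 : eta <= 1 by rewrite ler_pdivrMr; lra.
have etaC : eta * Cc = ep / 10 by rewrite /eta; field; lra.
have [Np hpack] := @pack R (ep / 100) eta q e1 e2 eta0 eta1 q0.
exists (dq + N0%:R + `|Np| + (10 * ell.+1%:R) / c + 1000 / ep).
move=> d hd H hH G R1 R2 rR1 rR2 R10 R20 cR1 cR2 aR1 aR2 cI hlink.
have hNp := ler_norm Np; have hNp0 := normr_ge0 Np.
have N00 : 0 <= N0%:R :> R by [].
have lc0 : 0 < (10 * ell.+1%:R) / c by apply: divr_gt0; [lra | exact: c0].
have ep1000 : 0 < 1000 / ep by apply: divr_gt0; [lra | exact: ep0].
have hdq : dq <= d by clear -hd N00 hNp0 lc0 ep1000; lra.
have hdN : N0%:R <= d by clear -hd N00 hNp0 lc0 ep1000 dq1; lra.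
have hdNp : Np <= d by clear -hd N00 hNp0 hNp lc0 ep1000 dq1; lra.
have hdl : 10 * ell.+1%:R <= c * d.
  by rewrite [c * d]mulrC -ler_pdivrMr //; clear -hd N00 hNp0 dq1 ep1000; lra.
have hde : 1000 <= ep * d.
  by rewrite [ep * d]mulrC -(ler_pdivrMr _ _ ep0); clear -hd N00 hNp0 dq1 lc0; lra.
have d1 : 1 <= d by apply: le_trans dq1 hdq.
clear hd hNp hNp0 lc0 ep1000.
have dp : 0 < d by clear -d1; lra.
have big (X : {set G}) : X != set0 -> (1 + ep) * d * #|X|%:R <= (ar X X)%:R ->
    d <= #|X|%:R.
  move=> X0 hX; have x0 : 0 < #|X|%:R :> R by rewrite ltr0n card_gt0.
  have : (1 + ep) * d <= #|X|%:R.
    rewrite -(ler_pM2r x0); apply: le_trans hX _; by rewrite -natrM ler_nat ar_le.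
  have : 0 < ep * d by rewrite mulr_gt0.
  clear; lra.
have b1 := big R1 R10 aR1; have b2 := big R2 R20 aR2.
have [|Q1 [cQ1 rQ1]] := res G R1 rR1.
  by rewrite -(ler_nat R); apply: le_trans b1.
have [|Q2 [cQ2 rQ2]] := res G R2 rR2.
  by rewrite -(ler_nat R); apply: le_trans b2.
have smallQ (Q X : {set G}) : (#|Q| * M <= #|X|)%N -> #|X|%:R <= Cc * d ->
    80 * #|Q|%:R <= ep * d.
  rewrite -(ler_nat R) natrM => h1 h2.
  have Cc0 : 0 < Cc by clear -Cc1; lra.
  have q00 : 0 <= #|Q|%:R :> R by [].
  have a1 : ep * (#|Q|%:R * M%:R) <= ep * (Cc * d).
    by rewrite ler_pM2l //; apply: le_trans h1 h2.
  have a2 : 80 * Cc * #|Q|%:R <= ep * M%:R * #|Q|%:R by rewrite ler_wpM2r.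
  rewrite -(ler_pM2l Cc0); clear -a1 a2; lra.
have {}cQ1 := smallQ Q1 R1 cQ1 cR1; have {}cQ2 := smallQ Q2 R2 cQ2 cR2.
have dd0 : 0 <= 2 * dl * d by rewrite !mulr_ge0 // ltW.
have [J [J1 J2]] := @truncn_bounds R (2 * dl * d) dd0.
have [p [a [b [hp pa pb dp']]]] := hlink J.+1 ltac:(rewrite -[J.+1%:R]natr1 lerD2r //).
pose W0 := [set a i | i in 'I_J.+1] :|: [set b i | i in 'I_J.+1].
have cW0 : #|W0|%:R <= 2 * (2 * dl * d + 1).
  apply: le_trans (_ : (2 * J.+1)%:R <= _); last first.
    rewrite natrM -[J.+1%:R]natr1; clear -J1; lra.
  rewrite ler_nat; apply: leq_trans (leq_card_setU _ _) _; rewrite mul2n -addnn.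
  by apply: leq_add; apply: leq_trans (leq_imset_card _ _) _; rewrite card_ord.
have dld : 4 * dl * d <= ep / 100 * d.
  by rewrite ler_pM2r //; clear -dl1; lra.
(* Besides the reservoirs, the other robust set and the ends of all linking paths are removed: the
   two packings become disjoint and no path enters a block. *)
pose S1 := R1 :\: (Q1 :|: Q2 :|: R2 :|: W0).
pose S2 := R2 :\: (Q1 :|: Q2 :|: R1 :|: W0).
have cD (X Y : {set G}) : #|X :&: Y|%:R <= ep / 20 * d ->
    #|X :\: (X :\: (Q1 :|: Q2 :|: Y :|: W0))|%:R <= ep * d / 10.
  move=> cXY; rewrite setDD_cap.
  have sub : X :&: (Q1 :|: Q2 :|: Y :|: W0) \subset (Q1 :|: Q2) :|: ((X :&: Y) :|: W0).
    apply/subsetP => z; rewrite !inE => /andP[-> /orP[/orP[->|->]|->]] /=;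
      by rewrite ?orbT.
  have : #|X :&: (Q1 :|: Q2 :|: Y :|: W0)|%:R <= #|Q1|%:R + #|Q2|%:R + (#|X :&: Y|%:R + #|W0|%:R) :> R.
    rewrite -!natrD ler_nat; apply: leq_trans (subset_leq_card sub) _.
    apply: leq_trans (leq_card_setU _ _) _; apply: leq_add; exact: leq_card_setU.
  clear -cXY cQ1 cQ2 cW0 dld hde; lra.
have epd : 8 * (ep * d / 10) <= ep * d.
  have h : 0 < ep * d by rewrite mulr_gt0.
  by clear -h; lra.
have aS1 : (1 + ep / 2) * d * #|S1|%:R <= (ar S1 S1)%:R.
  apply: (@pieces_setup ep d G R1 S1 (ep * d / 10)) => //; try exact: ltW.
    exact: subsetDl.
  exact: cD.
have aS2 : (1 + ep / 2) * d * #|S2|%:R <= (ar S2 S2)%:R.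
  apply: (@pieces_setup ep d G R2 S2 (ep * d / 10)) => //; try exact: ltW.
    exact: subsetDl.
  by apply: cD; rewrite setIC.
have nonempty (X Z : {set G}) : d <= #|X|%:R -> #|X :\: (X :\: Z)|%:R <= ep * d / 10 ->
    X :\: Z != set0.
  move=> h1 h2; apply/eqP => e; move: h2; rewrite e setD0.
  have : ep * d <= d by rewrite ler_piMl // ltW.
  clear -h1 dp; lra.
have S10 : S1 != set0 by apply: nonempty => //; apply: cD.
have S20 : S2 != set0 by apply: nonempty => //; apply: cD; rewrite setIC.
have dl100 : dl <= ep / 100 by clear -dl1 ep0; lra.
have [r1 [r10 hr1 hr2]] := hq d dl hdq (ltW dl0) dl100.
have Nmd : Np <= Cc * d by apply: le_trans hdNp _; rewrite ler_peMl // ltW.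
have room : eta * (Cc * d) + r1%:R * (4 * q%:R * (1 + ep / 100)) <= (1 + ep / 2) * d.
  rewrite mulrA etaC; have : 0 < ep * d by rewrite mulr_gt0.
  clear -hr2; lra.
have cS (X Z : {set G}) : #|X|%:R <= Cc * d -> #|X :\: Z|%:R <= Cc * d.
  by move=> h; apply: le_trans h; rewrite ler_nat subset_leq_card ?subsetDl.
have [T1 [hT1 dT1]] := hpack r1 G S1 _ _ S10 (cS _ _ cR1) Nmd room aS1.
have [T2 [hT2 dT2]] := hpack r1 G S2 _ _ S20 (cS _ _ cR2) Nmd room aS2.
have dS : [disjoint S1 & S2].
  by apply: disjointI' => z; rewrite !inE !negb_or => /andP[/andP[/andP[_ z1] _] _] /andP[_ z2];
     rewrite z2 in z1.
pose T bb := if (bb < r1)%N then T1 bb else T2 (bb - r1)%N.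
have lt2 bb : (bb < 2 * r1)%N -> (bb < r1)%N = false -> (bb - r1 < r1)%N.
  by clear; lia.
have TS1 bb : (bb < r1)%N -> T bb \subset S1 by move=> h; rewrite /T h; case: (hT1 _ h).
have TS2 bb : (bb < 2 * r1)%N -> (bb < r1)%N = false -> T bb \subset S2.
  by move=> h h'; rewrite /T h'; case: (hT2 _ (lt2 _ h h')).
have Tsub : \bigcup_(bb < 2 * r1) T bb \subset S1 :|: S2.
  apply/bigcupsP => bb _; case h : (bb < r1)%N.
    by apply: subset_trans (TS1 _ h) (subsetUl _ _).
  by apply: subset_trans (TS2 _ (ltn_ord bb) h) (subsetUr _ _).
have lkS : linkable (S1 :|: S2) J.+1.
  apply: (@linkable_two G R1 R2 Q1 Q2 S1 S2 (c * d) ell J.+1 p a b) => //.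
  - case: rQ1 => sQ1 h1; split=> // W hW; apply: h1; apply: le_trans hW _.
    by rewrite ler_pM2l.
  - case: rQ2 => sQ2 h1; split=> // W hW; apply: h1; apply: le_trans hW _.
    by rewrite ler_pM2l.
  - exact: subsetDl.
  - exact: subsetDl.
  - apply: disjointI' => z; rewrite !inE !negb_or => /orP[] /andP[/andP[/andP[/andP[z1 z2] _] _] _];
      by rewrite (negbTE z1) (negbTE z2).
  - move=> i; have iW : a i \in W0 by rewrite inE imset_f.
    by apply/negP; rewrite in_setU => /orP[]; rewrite in_setD => /andP[/negP h _]; apply: h; rewrite in_setU iW orbT.
  - move=> i; have iW : b i \in W0 by rewrite inE orbC imset_f.
    by apply/negP; rewrite in_setU => /orP[]; rewrite in_setD => /andP[/negP h _]; apply: h; rewrite in_setU iW orbT.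
  have nat_le : (J.+1 * (2 * ell) + 2 * J.+1 + ell <= 2 * (J * ell.+1) + 3 * ell.+1)%N.
    by clear; nia.
  have cast (x y : nat) : (2 * (x * y) + 3 * y)%:R = 2 * (x%:R * y%:R) + 3 * y%:R :> R.
    by rewrite natrD !natrM.
  apply: le_trans (_ : (2 * (J * ell.+1) + 3 * ell.+1)%:R <= _); first by rewrite ler_nat.
  rewrite cast.
  have p1 : 8 * dl * ell.+1%:R * d <= c * d by rewrite ler_pM2r.
  have p2 : J%:R * ell.+1%:R <= 2 * dl * d * ell.+1%:R by rewrite ler_wpM2r.
  clear -p1 p2 hdl l1; lra.
apply: (@embed_hostable R H G d dl K q (2 * r1) J.+1 T) => //.
- exact: ltW.
- exact: ltW.
- by rewrite muln_gt0.
- move=> bb h; rewrite /T; case h' : (bb < r1)%N; first by case: (hT1 _ h').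
  by case: (hT2 _ (lt2 _ h h')).
- move=> bb bb' lt h; case h1 : (bb < r1)%N; case h2 : (bb' < r1)%N.
  + by rewrite /T h1 h2; apply: dT1.
  + by apply: disjointW (TS1 _ h1) (TS2 _ h h2) dS.
  + by move: h1 h2 lt; clear; lia.
  rewrite /T h1 h2; apply: dT2; last exact: lt2.
  by move: h1 h2 lt; clear; lia.
- move=> L f cL fT; have [|X [X1 X2]] := lkS L f cL.
    by move=> l; have [f1 f2] := fT l; split; apply: (subsetP Tsub).
  exists X; split=> // l; have [h1 h2] := X1 l; split=> //.
  exact: disjointWr Tsub h1.
by rewrite -[J.+1%:R]natr1; clear -J2; lra.
Qed.

Lemma card_arcs (G : sgraph) (S : {set G}) :
  #|[set p : G * G | [&& p.1 \in S, p.2 \in S & edge p.1 p.2]]| = ar S S.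
Proof.
rewrite arE card_fibers [RHS]big_mkcond; apply: eq_bigr => x _.
case xS : (x \in S); last by apply/eqP; rewrite cards_eq0; apply/eqP/setP => y; rewrite !inE /= xS.
rewrite -sum1_card big_mkcond [RHS]big_mkcond; apply: eq_bigr => y _.
by rewrite !inE /= xS; case: (y \in S) => //=; case: edge.
Qed.

(** Unlike in [pack], no degrees are controlled: [edge_block] is applied as long as the rest is
    large and denser than [ga], and [Z] is the union of the blocks found. *)
Lemma pack_bipartite (q : nat) (ga : R) : (0 < q)%N -> 0 < ga -> ga <= 1 -> exists N0 : nat,
  forall (r : nat) (G : sgraph) (S : {set G}),
  (exists T : nat -> {set G}, (forall b, (b < r)%N -> [/\ block q (T b), T b \subset S & #|T b| <= 6 * q]%N)
     /\ forall b b', (b < b')%N -> (b' < r)%N -> [disjoint T b & T b']) \/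
  exists Z : {set G}, [/\ Z \subset S, (#|Z| <= 6 * q * r)%N
     & (#|S :\: Z| < N0)%N \/ (ar (S :\: Z) (S :\: Z))%:R <= ga * #|S :\: Z|%:R ^+ 2].
Proof.
move=> q0 ga0 ga1; have [N0 hN0] := @edge_block R q ga ga0 ga1; exists N0.
elim=> [|r IH] G S; first by left; exists (fun=> set0).
have [[T [hT dT]]|[Z [sZ cZ hZ]]] := IH G S; last first.
  by right; exists Z; split=> //; apply: leq_trans cZ _; rewrite leq_mul2l leqnSn orbT.
pose Z := \bigcup_(b < r) T b.
have sZ : Z \subset S by apply/bigcupsP => b _; case: (hT b (ltn_ord b)).
have cZ : (#|Z| <= 6 * q * r)%N.
  apply: leq_trans (_ : (\sum_(b < r) 6 * q <= _)%N); last by rewrite sum_nat_const card_ord mulnC.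
  rewrite /Z; elim/big_rec2: _ => [|b m X _ h]; first by rewrite cards0.
  apply: leq_trans (leq_card_setU _ _) _; apply: leq_add => //.
  by case: (hT b (ltn_ord b)).
have [small|big] := ltnP #|S :\: Z| N0.
  right; exists Z; split=> //; last by left.
  by apply: leq_trans cZ _; rewrite leq_mul2l leqnSn orbT.
have [few|many] := lerP (ar (S :\: Z) (S :\: Z))%:R (ga * #|S :\: Z|%:R ^+ 2).
  right; exists Z; split=> //; last by right.
  by apply: leq_trans cZ _; rewrite leq_mul2l leqnSn orbT.
left; have [||A [B [sA sB cA cB AB]]] := hN0 G (S :\: Z)
    [set p : G * G | [&& p.1 \in S :\: Z, p.2 \in S :\: Z & edge p.1 p.2]] big.
- by move=> p; rewrite inE.
- by rewrite card_arcs ltW.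
have sAB : A :|: B \subset S :\: Z by rewrite subUset sA.
exists (fun b => if b == r then A :|: B else T b); split.
  move=> b; rewrite ltnS leq_eqVlt; case: eqP => [_ _|_ /= /hT//].
  split; last 1 first.
  - by apply: leq_trans (leq_card_setU _ _) _; rewrite cA cB -mulnDl.
  - left; exists A, B; split; rewrite ?subsetUl ?subsetUr // => x y xA yB.
    by have := AB x y xA yB; rewrite inE => /and3P[].
  exact: subset_trans sAB (subsetDl _ _).
move=> b b' bb' b'r; case: eqP => [br|_].
  by move: bb' b'r; rewrite br ltnS => /leq_trans h /h; rewrite ltnn.
case: eqP => [b'r'|b'r']; last by apply: dT => //; rewrite ltn_neqAle -ltnS b'r andbT; apply/eqP.
have br : (b < r)%N by rewrite -b'r'.
apply: disjointI' => z zT /(subsetP sAB); rewrite inE => /andP[/negP nz _].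
by apply: nz; apply/bigcupP; exists (Ordinal br).
Qed.

(* [Z] consists of a reservoir and of a maximal packing of bipartite blocks. *)
Lemma robust_or_sparse (lam ga : R) (M : nat) : 0 < lam -> lam <= 1 -> 0 < ga -> ga <= 1 ->
  (0 < M)%N -> exists dl : R, 0 < dl /\ forall K, exists d0 : R, forall d, d0 <= d ->
  forall H, hostable H d dl K -> forall (G : sgraph) (S : {set G}),
  robust lam S -> 2 * d <= #|S|%:R ->
  minor H G \/ exists Z : {set G}, [/\ Z \subset S, #|Z|%:R <= #|S|%:R / M%:R + 4 * d
    & (ar (S :\: Z) (S :\: Z))%:R <= ga * #|S|%:R ^+ 2].
Proof.
move=> lam0 lam1 ga0 ga1 M0.
have [ell [N0 [c [c0 res]]]] := @reservoir_exists R lam M lam0 lam1 M0.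
have l1 : 1 <= ell.+1%:R :> R by rewrite ler1n.
pose dl : R := Num.min (1 / 100) (c / (2 * ell.+1%:R)).
have dl0 : 0 < dl.
  rewrite lt_min; apply/andP; split; first lra.
  by apply: divr_gt0; [exact: c0 | apply: mulr_gt0; lra].
have dl1 : dl <= 1 / 100 by rewrite ge_min lexx.
have dl2 : 2 * dl * ell.+1%:R <= c.
  have : dl <= c / (2 * ell.+1%:R) by rewrite ge_min lexx orbT.
  rewrite ler_pdivlMr; lra.
exists dl; split=> // K.
have [q [dq [q0 dq1 hq]]] := @choose_blocks R 1 (type_bound K) ltr01 (lexx 1).
have [Np hpack] := @pack_bipartite q ga q0 ga0 ga1.
have MR : 0 < M%:R :> R by rewrite ltr0n.
exists (dq + N0%:R + Np%:R / ga + Np%:R + ell.+1%:R / c) => d hd H hH G S rS hS.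
have N00 : 0 <= N0%:R :> R by [].
have Np0 : 0 <= Np%:R :> R by [].
have Npg : 0 <= Np%:R / ga by rewrite divr_ge0 // ltW.
have lc0 : 0 < ell.+1%:R / c by rewrite divr_gt0 //; lra.
have hdq : dq <= d by clear -hd N00 Np0 Npg lc0; lra.
have d1 : 1 <= d by apply: le_trans dq1 hdq.
have dp : 0 < d by clear -d1; lra.
have hN0 : N0%:R <= d by clear -hd dq1 Np0 Npg lc0; lra.
have hNpg : Np%:R <= ga * d.
  by rewrite [ga * d]mulrC -ler_pdivrMr //; clear -hd dq1 Np0 N00 lc0; lra.
have hNp : Np%:R <= d by clear -hd dq1 N00 Npg lc0; lra.
have hdl : ell.+1%:R <= c * d.
  by rewrite [c * d]mulrC -ler_pdivrMr //; clear -hd N00 Np0 dq1 Npg; lra.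
clear hd Npg lc0.
have [|Q [cQ rQ]] := res G S rS.
  rewrite -(ler_nat R); apply: le_trans hS; clear -hN0 dp; lra.
have sQ : Q \subset S by case: rQ.
have [r1 [r10 hr1 hr2]] := hq d dl hdq (ltW dl0) dl1.
have [[T [hT dT]]|[Z [sZ cZ hZ]]] := hpack (2 * r1)%N G (S :\: Q).
  left.
  have dd0 : 0 <= 2 * dl * d by rewrite !mulr_ge0 // ltW.
  have [J [J1 J2]] := @truncn_bounds R (2 * dl * d) dd0.
  apply: (@embed_hostable R H G d dl K q (2 * r1) J.+1 T) => //.
  - exact: ltW.
  - exact: ltW.
  - by rewrite muln_gt0.
  - by move=> b /hT[].
  - apply: (@linkable_reservoir R G S Q _ (c * #|S|%:R) ell) => //.
    + apply/bigcupsP => b _; have [_ h _] := hT b (ltn_ord b).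
      exact: subset_trans h (subsetDl _ _).
    + rewrite disjoint_sym disjoints_subset; apply/subsetP => z zQ; rewrite inE.
      apply/negP => /bigcupP[b _ zT]; have [_ h _] := hT b (ltn_ord b).
      by have := subsetP h z zT; rewrite inE zQ.
    have h4 : c * (2 * d) <= c * #|S|%:R by rewrite ler_pM2l.
    apply: le_trans h4; rewrite natrM -[J.+1%:R]natr1.
    have p1 : 2 * dl * ell.+1%:R * d <= c * d by rewrite ler_pM2r.
    have p2 : J%:R * ell%:R <= 2 * dl * d * ell.+1%:R.
      by apply: ler_pM => //; rewrite ler_nat.
    have p3 : ell%:R + 1 = ell.+1%:R :> R by rewrite natr1.
    clear -p1 p2 p3 hdl; lra.
  by rewrite -[J.+1%:R]natr1; clear -J2; lra.
right; exists (Q :|: Z); split.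
- by rewrite subUset sQ; apply: subset_trans sZ (subsetDl _ _).
- apply: le_trans (_ : #|Q|%:R + #|Z|%:R <= _); first by rewrite -natrD ler_nat leq_card_setU.
  apply: lerD; first by rewrite ler_pdivlMr // -natrM ler_nat.
  apply: le_trans (_ : (6 * q * (2 * r1))%:R <= _); first by rewrite ler_nat.
  rewrite !natrM; have rq : 0 <= r1%:R * q%:R :> R by rewrite mulr_ge0.
  clear -hr2 rq dp; lra.
have e : S :\: (Q :|: Z) = S :\: Q :\: Z by rewrite setDDl.
rewrite e; have sS : (#|S :\: Q :\: Z| <= #|S|)%N.
  by rewrite subset_leq_card // -e subsetDl.
have [lt|h] := hZ; last first.
  apply: le_trans h _; rewrite ler_pM2l // lerXn2r ?nnegrE //.
  by rewrite ler_nat.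
have h1 : (ar (S :\: Q :\: Z) (S :\: Q :\: Z))%:R <= Np%:R * Np%:R :> R.
  by rewrite -natrM ler_nat; apply: leq_trans (ar_le _ _) (leq_mul (ltnW lt) (ltnW lt)).
apply: le_trans h1 _; apply: le_trans (_ : ga * d * d <= _).
  by apply: ler_pM.
rewrite -mulrA ler_pM2l // expr2; apply: ler_pM; try exact: ltW.
  by clear -hS dp; lra.
by clear -hS dp; lra.
Qed.

End TwoPieces.

(** * Robust sets inside neighbourhoods *)

Section Sparse.
Variable R : realType.

Lemma robust_le (G : sgraph) (lam lam' : R) (S : {set G}) : lam' <= lam ->
  robust lam S -> robust lam' S.
Proof.
move=> h rS A B U dAB; apply: le_trans (rS A B U dAB).
by rewrite -!mulrA ler_wpM2r // mulr_ge0.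
Qed.

(** One of [A], [B] contains half of [X :&: Y], and the other has half of its own vertices in [X] or
    in [Y]. Robustness of that set, which also contains the half intersection, provides the arcs. *)
Lemma robust_union (lam h U : R) (G : sgraph) (X Y : {set G}) : 0 <= lam -> 0 < h ->
  h <= #|X :&: Y|%:R -> #|X :|: Y|%:R <= U -> robust lam X -> robust lam Y ->
  robust (lam * (h / (4 * U))) (X :|: Y).
Proof.
move=> lam0 h0 hI hU rX rY A B UAB dAB.
have sub (Z : {set G}) : Z \subset X :|: Y -> (A :&: Z) :|: (B :&: Z) = Z.
  by move=> sZ; rewrite -setIUl UAB (setIidPr sZ).
have cI (Z : {set G}) : Z \subset X :|: Y -> #|Z|%:R = #|A :&: Z|%:R + #|B :&: Z|%:R :> R.
  move=> sZ; rewrite -natrD; congr _%:R; apply: cards_cup (sub Z sZ) _.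
  exact: disjointW (subsetIl _ _) (subsetIl _ _) dAB.
have inside (Z : {set G}) : Z \subset X :|: Y -> robust lam Z ->
    lam * #|A :&: Z|%:R * #|B :&: Z|%:R <= (ar A B)%:R.
  move=> sZ rZ; apply: le_trans (rZ _ _ (sub Z sZ) _) _.
    exact: disjointW (subsetIl _ _) (subsetIl _ _) dAB.
  by rewrite ler_nat arS // subsetIl.
have sX : X \subset X :|: Y by exact: subsetUl.
have sY : Y \subset X :|: Y by exact: subsetUr.
have half (Z : {set G}) : Z \subset X :|: Y ->
    #|Z|%:R / 2 <= #|Z :&: X|%:R :> R \/ #|Z|%:R / 2 <= #|Z :&: Y|%:R :> R.
  move=> sZ; have : #|Z|%:R <= #|Z :&: X|%:R + #|Z :&: Y|%:R :> R.
    rewrite -natrD ler_nat -{1}(setIidPl sZ) setIUr; exact: leq_card_setU.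
  by case: (lerP (#|Z|%:R / 2) (#|Z :&: X|%:R : R)) => ? ?; [left | right; lra].
have sA : A \subset X :|: Y by rewrite -UAB subsetUl.
have sB : B \subset X :|: Y by rewrite -UAB subsetUr.
have aU : #|A|%:R <= U by apply: le_trans hU; rewrite ler_nat subset_leq_card.
have bU : #|B|%:R <= U by apply: le_trans hU; rewrite ler_nat subset_leq_card.
have U0 : 0 < U.
  by apply: lt_le_trans hU; apply: lt_le_trans h0 _; apply: le_trans hI _;
     rewrite ler_nat subset_leq_card // (subset_trans (subsetIl _ _)).
have goal_le (a b x y : R) : 0 <= a -> 0 <= b -> a <= U -> h / 2 <= x -> b / 2 <= y ->
    lam * (h / (4 * U)) * a * b <= lam * x * y.
  move=> a0 b0 aU' hx hy.
  have e : lam * (h / (4 * U)) * a * b = (a / U) * (lam * (h / 2 * (b / 2))) by field; lra.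
  have p : 0 <= lam * (h / 2 * (b / 2)) by rewrite !mulr_ge0 //; lra.
  rewrite e; apply: le_trans (_ : lam * (h / 2 * (b / 2)) <= _).
    by rewrite ler_piMl // ler_pdivrMr // mul1r.
  rewrite -[leRHS]mulrA; apply: ler_wpM2l => //; apply: ler_pM => //; lra.
have cIXY : h <= #|A :&: (X :&: Y)|%:R + #|B :&: (X :&: Y)|%:R.
  by rewrite -cI //; apply: subset_trans (subsetIl _ _) sX.
have monoI (W Z : {set G}) : X :&: Y \subset Z -> #|W :&: (X :&: Y)|%:R <= #|W :&: Z|%:R :> R.
  by move=> sZ; rewrite ler_nat subset_leq_card // setIS.
have mX (W : {set G}) := monoI W X (subsetIl _ _).
have mY (W : {set G}) := monoI W Y (subsetIr _ _).
have [hA|hA] := lerP (h / 2) (#|A :&: (X :&: Y)|%:R : R).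
  have [hB|hB] := half B sB.
    by apply: le_trans (inside X sX rX); apply: goal_le => //; apply: le_trans hA (mX _).
  by apply: le_trans (inside Y sY rY); apply: goal_le => //; apply: le_trans hA (mY _).
have hB : h / 2 <= #|B :&: (X :&: Y)|%:R by lra.
have sw (x y z : R) : x * y * z = x * z * y by rewrite mulrAC.
have [hA'|hA'] := half A sA.
  apply: le_trans (inside X sX rX); rewrite sw [leRHS]sw.
  by apply: goal_le => //; apply: le_trans hB (mX _).
apply: le_trans (inside Y sY rY); rewrite sw [leRHS]sw.
by apply: goal_le => //; apply: le_trans hB (mY _).
Qed.

Definition low_degree (mu D : R) (G : sgraph) (S : {set G}) : {set G} :=
  [set u in S | (dg u S)%:R < (1 - mu) * D].

(** With [om] the degree into the neighbourhood [B], the whole of [B] scores -lam |B| >= - mu^2 / 2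
    D. The maximizer scores no less, so on average its vertices keep all but mu^2 / 2 D of their
    degree in [B], which is at least D - 1 by the codegree condition. A vertex of low degree loses
    at least mu D / 2, so at most the proportion [mu] is of this kind. *)
Lemma local_piece (mu D : R) (G : sgraph) (v : G) : 0 < mu -> mu <= 1 -> 2 <= mu * D ->
  (forall a b : G, edge a b -> D - 1 <= (codegree a b)%:R) ->
  D <= (dg v [set: G])%:R -> (dg v [set: G])%:R <= 3 * D ->
  exists S : {set G}, [/\ S \subset [set y | edge v y], robust (mu ^+ 2 / 6) S,
    S != set0, (D - 1 - mu ^+ 2 / 2 * D) * #|S|%:R <= (ar S S)%:R
    & #|low_degree mu D S|%:R <= mu * #|S|%:R].
Proof.
move=> mu0 mu1 muD hcod d1 d3.
pose B := [set y | edge v y].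
have cB : #|B| = dg v [set: G] by rewrite /dg; congr #|pred_of_set _|; apply/setP => y; rewrite !inE.
have D0 : 0 < D by rewrite -(pmulr_rgt0 _ mu0); lra.
have B0 : B != set0 by rewrite -card_gt0 cB -(ltr0n R); apply: lt_le_trans d1.
pose om x : R := (dg x B)%:R.
pose lam := mu ^+ 2 / 6.
have lam0 : 0 <= lam by rewrite divr_ge0 // exprn_ge0 // ltW.
have [S [sS S0 rS hS]] := @robust_subset R G lam om B lam0 B0.
have bp : 0 < #|B|%:R :> R by rewrite ltr0n card_gt0.
have sp : 0 < #|S|%:R :> R by rewrite ltr0n card_gt0.
have omB : \sum_(x in B) om x = (ar B B)%:R by rewrite /ar natr_sum.
have omS x : x \in S -> D - 1 <= om x.
  move=> xS; have := subsetP sS x xS; rewrite inE => vx.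
  by apply: hcod; rewrite edge_sym.
have bd : \sum_(x in S) om x - (ar S S)%:R <= mu ^+ 2 / 2 * D * #|S|%:R.
  rewrite omB in hS.
  have h1 : - lam * #|B|%:R ^+ 2 * #|S|%:R
      <= ((ar S S)%:R - lam * #|S|%:R ^+ 2 - \sum_(x in S) om x) * #|B|%:R.
    by apply: le_trans hS; clear; lra.
  have h2 : - lam * #|B|%:R * #|S|%:R <= (ar S S)%:R - lam * #|S|%:R ^+ 2 - \sum_(x in S) om x.
    by rewrite -(ler_pM2r bp); apply: le_trans h1; clear; lra.
  have h3 : 0 <= lam * #|S|%:R ^+ 2 by rewrite mulr_ge0 // exprn_ge0.
  have h4 : lam * #|B|%:R * #|S|%:R <= lam * (3 * D) * #|S|%:R.
    by rewrite ler_pM2r // ler_wpM2l // cB.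
  have e : mu ^+ 2 / 2 * D * #|S|%:R = lam * (3 * D) * #|S|%:R by rewrite /lam; field.
  rewrite e; clear -h2 h3 h4; lra.
exists S; split=> //.
  have : (D - 1) * #|S|%:R <= \sum_(x in S) om x.
    by rewrite mulr_natr -sumr_const; apply: ler_sum.
  clear -bd; lra.
set X := low_degree mu D S.
have sX : X \subset S by apply/subsetP => x; rewrite inE => /andP[].
have hX : (mu * D - 1) * #|X|%:R <= mu ^+ 2 / 2 * D * #|S|%:R.
  apply: le_trans bd; rewrite /ar natr_sum -sumrB.
  rewrite [leRHS](big_setID X) /= (setIidPr sX); apply: ler_wpDr.
    by apply: sumr_ge0 => x _; rewrite subr_ge0 ler_nat dgS.
  rewrite mulr_natr -sumr_const; apply: ler_sum => x xX.
  have := omS x (subsetP sX x xX); move: xX; rewrite inE => /andP[_].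
  clear; lra.
have muD2 : mu * D / 2 * #|X|%:R <= (mu * D - 1) * #|X|%:R.
  by rewrite ler_wpM2r //; clear -muD; lra.
have mD : 0 < mu * D / 2 by clear -muD; lra.
rewrite -(ler_pM2l mD); apply: le_trans muD2 _; apply: le_trans hX _.
by rewrite le_eqVlt; apply/orP; left; apply/eqP; field.
Qed.

Lemma low_degree_union (mu D : R) (G : sgraph) (X Y : {set G}) :
  #|low_degree mu D (X :|: Y)|%:R <= #|low_degree mu D X|%:R + #|low_degree mu D Y|%:R :> R.
Proof.
rewrite -natrD ler_nat; apply: leq_trans (leq_card_setU _ _); apply: subset_leq_card.
apply/subsetP => u; rewrite !inE => /andP[/orP[uX|uY] h]; apply/orP; [left|right].
  by rewrite uX; apply: le_lt_trans h; rewrite ler_nat dgS // subsetUl.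
by rewrite uY; apply: le_lt_trans h; rewrite ler_nat dgS // subsetUr.
Qed.

(** The sets [P v] are added one at a time. Each meets [P v0], hence the current union, in more than
    eta D vertices, so [robust_union] applies with the same factor every time. A step that is not
    stuck gains more than eta D vertices, so boundedly many steps reach size C1 D. *)
Lemma grow_pieces (lam eta mu D C1 : R) (G : sgraph) (L : {set G}) (P : G -> {set G}) (v0 : G) :
  0 <= lam -> 0 < eta -> eta <= 1 -> 0 < D -> 1 <= C1 -> 0 < mu ->
  v0 \in L ->
  (forall v, v \in L -> [/\ robust lam (P v), #|P v|%:R <= 3 * D,
     #|low_degree mu D (P v)|%:R <= mu * (3 * D) & eta * D < #|P v :&: P v0|%:R]) ->
  forall j : nat, exists S : {set G},
   [/\ P v0 \subset S, robust (lam * (eta / (4 * (C1 + 3))) ^+ j) S,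
       #|S|%:R <= (C1 + 3) * D, #|low_degree mu D S|%:R <= j.+1%:R * (mu * (3 * D))
     & [\/ C1 * D <= #|S|%:R, forall v, v \in L -> #|P v :\: S|%:R <= eta * D
         | j%:R * (eta * D) <= #|S|%:R]].
Proof.
move=> lam0 eta0 eta1 D0 C10 mu0 v0L hP.
set f := eta / (4 * (C1 + 3)).
have f0 : 0 < f by rewrite divr_gt0 // mulr_gt0 //; lra.
have f1 : f <= 1 by rewrite ler_pdivrMr ?mulr_gt0 //; lra.
have mD : 0 <= mu * (3 * D) by rewrite !mulr_ge0 // ltW.
elim=> [|j [S [s1 s2 s3 s4 s5]]].
  have [h1 h2 h3 h4] := hP v0 v0L.
  exists (P v0); split=> //; rewrite ?expr0 ?mulr1 ?mul1r //.
    by apply: le_trans h2 _; rewrite ler_pM2r //; lra.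
  by apply: Or33; rewrite mul0r.
have keep : [\/ C1 * D <= #|S|%:R | forall v, v \in L -> #|P v :\: S|%:R <= eta * D] ->
   exists S : {set G}, [/\ P v0 \subset S, robust (lam * f ^+ j.+1) S,
       #|S|%:R <= (C1 + 3) * D, #|low_degree mu D S|%:R <= j.+2%:R * (mu * (3 * D))
     & [\/ C1 * D <= #|S|%:R, forall v, v \in L -> #|P v :\: S|%:R <= eta * D
         | j.+1%:R * (eta * D) <= #|S|%:R]].
  move=> h; exists S; split=> //.
  - apply: robust_le s2; rewrite exprS mulrCA ler_piMl // mulr_ge0 // exprn_ge0 //; exact: ltW.
  - by apply: le_trans s4 _; rewrite ler_wpM2r // ler_nat.
  by case: h => h; [apply: Or31 | apply: Or32].
have [big|small] := lerP (C1 * D) (#|S|%:R : R); first by apply: keep; left.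
have [stuck|] := pselect (forall v, v \in L -> #|P v :\: S|%:R <= eta * D).
  by apply: keep; right.
move=> /existsNP[v /not_implyP[vL /negP]]; rewrite -ltNge => hv.
have [h1 h2 h3 h4] := hP v vL.
have cU : #|S :|: P v|%:R = #|S|%:R + #|P v :\: S|%:R :> R.
  rewrite -natrD -(cards_cup erefl (disjD _ _)); congr (#|pred_of_set _|%:R).
  by apply/setP => z; rewrite !inE; case: (z \in S).
have UC : #|S :|: P v|%:R <= (C1 + 3) * D.
  have : #|S :|: P v|%:R <= #|S|%:R + #|P v|%:R :> R by rewrite -natrD ler_nat leq_card_setU.
  by clear -small h2; lra.
exists (S :|: P v); split=> //.
- exact: subset_trans s1 (subsetUl _ _).
- have -> : lam * f ^+ j.+1 = lam * f ^+ j * ((eta * D) / (4 * ((C1 + 3) * D))).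
    rewrite exprSr mulrA; congr (_ * _); rewrite /f; field.
    by apply/andP; split; apply: lt0r_neq0; lra.
  apply: robust_union => //.
  + by rewrite mulr_ge0 // exprn_ge0 // ltW.
  + by rewrite mulr_gt0.
  + by apply: le_trans (ltW h4) _; rewrite ler_nat subset_leq_card // setIC setSI.
  + apply: robust_le h1; rewrite ler_piMr // exprn_ile1 //; exact: ltW.
- apply: le_trans (low_degree_union _ _ _ _) _.
  by rewrite -[j.+2%:R]natr1 mulrDl mul1r; apply: lerD.
case: s5 => [h|h|h].
- by apply: Or31; rewrite cU; apply: le_trans h _; rewrite lerDl.
- by move: hv; rewrite ltNge h.
by apply: Or33; rewrite cU -[j.+1%:R]natr1 mulrDl mul1r; apply: lerD => //; apply: ltW.
Qed.

(** For P = S :\: Z one has ar S S >= 2 ar P S - ar P P. Nearly all vertices of [S] lie in [P] and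
    have degree about [D] in [S], while [P] spans few arcs, so [S] has nearly 2 D |S| arcs. *)
Lemma full_dense (ep mu D d C1 ga : R) (M : nat) (G : sgraph) (S Z : {set G}) :
  0 < ep -> ep <= 1 -> 0 < d -> D = (1 + ep) * d -> 500 / ep <= C1 -> 0 <= mu -> mu <= ep / 100 ->
  100 <= ep * M%:R -> ga * (C1 + 3) <= ep / 100 -> 0 <= ga ->
  Z \subset S -> C1 * D <= #|S|%:R -> #|S|%:R <= (C1 + 3) * D ->
  #|low_degree mu D S|%:R <= D -> #|Z|%:R <= #|S|%:R / M%:R + 4 * d ->
  (ar (S :\: Z) (S :\: Z))%:R <= ga * #|S|%:R ^+ 2 ->
  2 * (1 + ep / 2) * d * #|S|%:R <= (ar S S)%:R.
Proof.
move=> ep0 ep1 d0 hD hC1 mu0 mu1 hM hga ga0 sZ S1 S2 hlow hZ hP.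
set P := S :\: Z in hP; set s : R := #|S|%:R in S1 S2 hZ hP *.
have D0 : 0 < D by rewrite hD mulr_gt0 //; lra.
have dD : d <= D by rewrite hD ler_peMl //; [exact: ltW | lra].
have s0 : 0 <= s by [].
have M0 : 0 < M%:R :> R.
  by rewrite -(pmulr_rgt0 _ ep0); apply: lt_le_trans hM; clear; lra.
have sM : s / M%:R <= ep / 100 * s.
  rewrite ler_pdivrMr // mulrAC -[leLHS]mul1r ler_wpM2r //.
  by clear -hM; lra.
have D5 : 5 * D <= ep / 100 * s.
  have h : 500 / ep * D <= s by apply: le_trans S1; rewrite ler_pM2r.
  have e : 500 / ep * D * ep = 500 * D by rewrite mulrAC divfK // lt0r_neq0.
  have := ler_wpM2r (ltW ep0) h; rewrite e; clear; lra.
have cP : #|P|%:R = s - #|Z|%:R.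
  by rewrite /s -(cardsID Z S) (setIidPr sZ) natrD addrAC subrr add0r.
pose X := low_degree mu D S.
have arPS : (#|P|%:R - #|X|%:R) * ((1 - mu) * D) <= (ar P S)%:R.
  have m0 : 0 <= (1 - mu) * D by rewrite mulr_ge0 //; [lra | exact: ltW].
  apply: le_trans (_ : #|P :\: X|%:R * ((1 - mu) * D) <= _).
    rewrite ler_wpM2r // lerBlDr -natrD ler_nat -(cardsID X P) addnC leq_add2l.
    by rewrite subset_leq_card // subsetIr.
  rewrite /ar natr_sum (big_setID X) /=; apply: ler_wpDl; first exact: sumr_ge0.
  rewrite mulr_natl -sumr_const; apply: ler_sum => u; rewrite !inE negb_and -leNgt.
  by move=> /andP[/orP[/negbTE->|//]]; rewrite ?andbF.
have U : P :|: Z = S by rewrite setUC cupD.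
have dU : [disjoint P & Z] by rewrite disjoint_sym disjD.
have e1 : (ar S S)%:R = (ar P P)%:R + (ar Z Z)%:R + 2 * (ar P Z)%:R :> R.
  by rewrite (ar_split U dU) natrD natrD natrM.
have e2 : (ar P S)%:R = (ar P P)%:R + (ar P Z)%:R :> R.
  by rewrite -{1}U arUr // natrD.
have zz : 0 <= (ar Z Z)%:R :> R by [].
have pp : 0 <= (ar P P)%:R :> R by [].
have g1 : ga * s ^+ 2 <= ep / 100 * (D * s).
  have h : ga * s * s <= ga * s * ((C1 + 3) * D) by rewrite ler_wpM2l // mulr_ge0.
  have h' : ga * (C1 + 3) * (D * s) <= ep / 100 * (D * s).
    by rewrite ler_wpM2r // mulr_ge0 // ltW.
  clear -h h'; lra.
have low : (1 - ep / 50) * s <= #|P|%:R - #|X|%:R.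
  rewrite cP; clear -hZ sM D5 hlow dD; lra.
have lowm : (1 - ep / 100) * D <= (1 - mu) * D.
  by rewrite ler_pM2r //; clear -mu1; lra.
have prod : (1 - ep / 50) * s * ((1 - ep / 100) * D) <= (ar P S)%:R.
  apply: le_trans arPS; apply: ler_pM => //.
    by rewrite mulr_ge0 //; clear -ep1; lra.
  by rewrite mulr_ge0 //; [clear -ep1; lra | exact: ltW].
have prod' : (1 - 3 / 100 * ep) * (s * D) <= (ar P S)%:R.
  apply: le_trans prod.
  have : 0 <= ep * ep * (s * D) by rewrite !mulr_ge0 // ltW.
  clear; lra.
have fin : (1 + ep / 2) * (d * s) <= (1 - ep / 25) * (s * D).
  have ds : 0 <= d * s by rewrite mulr_ge0 // ltW.
  have e : (1 - ep / 25) * (s * D) = (1 - ep / 25) * (1 + ep) * (d * s) by rewrite hD; ring.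
  rewrite e ler_wpM2r //; clear -ep0 ep1; nra.
clear -e1 e2 zz pp g1 prod' fin hP; lra.
Qed.

(** The vertices of [L] have about [D] neighbours each in the much smaller set [S]. Their arcs count
    from both ends, which makes the average degree of the union about 2D. *)
Lemma stuck_dense (ep D d C2 C3 : R) (G : sgraph) (S L : {set G}) :
  0 < ep -> ep <= 1 -> 0 < d -> D = (1 + ep) * d -> 5 * C3 <= C2 * ep ->
  #|S|%:R <= C3 * D -> C2 * D <= #|L|%:R -> [disjoint S & L] ->
  (forall v, v \in L -> (1 - ep / 10) * D <= (dg v S)%:R) ->
  2 * (1 + ep / 2) * d * #|S :|: L|%:R <= (ar (S :|: L) (S :|: L))%:R.
Proof.
move=> ep0 ep1 d0 hD hC hS hL dSL hdeg.
have cast (x y z : nat) : (x + y + 2 * z)%:R = x%:R + y%:R + 2 * z%:R :> R.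
  by rewrite natrD natrD natrM.
rewrite (ar_split erefl dSL) (cards_cup erefl dSL) cast [(#|S| + _)%:R]natrD.
have h1 : (1 - ep / 10) * D * #|L|%:R <= (ar S L)%:R.
  by rewrite arC /ar natr_sum mulr_natr -sumr_const; apply: ler_sum.
have D0 : 0 < D by rewrite hD mulr_gt0 //; lra.
have l0 : 0 <= #|L|%:R :> R by [].
have h2 : 5 * #|S|%:R <= ep * #|L|%:R.
  have a : 5 * C3 * D <= C2 * ep * D by rewrite ler_pM2r.
  have b : ep * (C2 * D) <= ep * #|L|%:R by rewrite ler_pM2l.
  clear -a b hS; lra.
have h3 : (1 + 8 / 10 * ep) * d * #|L|%:R <= (1 - ep / 10) * D * #|L|%:R.
  rewrite ler_wpM2r // hD mulrA ler_pM2r //; clear -ep0 ep1; nra.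
have h4 : 5 * #|S|%:R * d <= ep * #|L|%:R * d by rewrite ler_pM2r.
have h5 : ep * (#|S|%:R * d) <= #|S|%:R * d by rewrite ler_piMl // mulr_ge0 // ltW.
have a1 : 0 <= (ar S S)%:R :> R by [].
have a2 : 0 <= (ar L L)%:R :> R by [].
clear -h1 h3 h4 h5 a1 a2; lra.
Qed.

(** The average degree is barely above 2D, so Markov's inequality leaves nearly a third of the
    vertices with degree at most 3D. *)
Lemma many_low_degree (D k : R) (G : sgraph) : 2 <= D -> 0 <= k -> 12 <= #|G|%:R :> R ->
  (arcs G)%:R <= 2 * D * (#|G|%:R - k) + 2 ->
  #|G|%:R / 4 <= #|[set v : G | (dg v [set: G])%:R <= 3 * D]|%:R :> R.
Proof.
move=> D2 k0 N12 har; set L := [set v | _]; set N : R := #|G|%:R in N12 har *.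
have h1 : (N - #|L|%:R) * (3 * D) <= (arcs G)%:R.
  have -> : N - #|L|%:R = #|~: L|%:R by rewrite [in RHS]cardsCs setCK natrB // max_card.
  rewrite /arcs /ar natr_sum (big_setID L) /=; apply: ler_wpDl; first exact: sumr_ge0.
  rewrite mulr_natl -sumr_const setTD; apply: ler_sum => v; rewrite !inE -ltNge.
  exact: ltW.
have D0 : 0 < D by lra.
have h2 : 0 <= D * k by rewrite mulr_ge0 // ltW.
have h3 : (N - #|L|%:R) * (3 * D) <= (2 * N + 1) * D.
  apply: le_trans h1 _; apply: le_trans har _; clear -h2 D2; lra.
rewrite mulrA ler_pM2r // in h3; clear -h3 N12; lra.
Qed.

End Sparse.

(** * Decompositions from separators *)

Section Decomposition.
Variable R : realType.

(** In quotients: x / y <= h (x / y) ^ be if x / y <= 3/4. Summed over the sides of a balanced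
    separation, this makes the total of the [be]-th powers grow by the factor 1 / h at least. *)
Lemma powR_subadditive_gap (be h x y : R) : 0 < be -> be < 1 -> 0 <= x -> 0 < y ->
  h = (3 / 4) `^ (1 - be) -> 4 * x <= 3 * y -> x * y `^ be <= x `^ be * h * y.
Proof.
move=> b0 b1 x0 y0 -> xy.
have split z : 0 <= z -> z = z `^ be * z `^ (1 - be).
  move=> z0; rewrite -powRD; last by rewrite addrCA subrr addr0 oner_eq0.
  by rewrite addrCA subrr addr0 powRr1.
have le1 : x `^ (1 - be) <= (3 / 4) `^ (1 - be) * y `^ (1 - be).
  rewrite -powRM; [|lra|lra]; apply: ge0_ler_powR; rewrite ?nnegrE; lra.
rewrite {1}(split x x0) {2}(split y (ltW y0)).
rewrite -!mulrA [X in _ <= X](_ : _ = x `^ be * ((3 / 4) `^ (1 - be) * y `^ (1 - be) * y `^ be)); last by ring.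
rewrite ler_wpM2l ?powR_ge0 // [_ * y `^ be]mulrC [X in _ <= X]mulrC.
by rewrite ler_wpM2l ?powR_ge0.
Qed.

Lemma powR_sublinear (be a : R) : be < 1 -> 0 < a -> exists n0 : nat, forall n : nat,
  (n0 <= n)%N -> n%:R `^ be <= a * n%:R.
Proof.
move=> b1 a0.
have r0 : 0 < 1 - be by lra.
have [n0 hn0] := @exists_nat_ge R (a^-1 `^ (1 - be)^-1).
exists n0.+1 => n hn.
have nR : n0%:R <= n%:R :> R by rewrite ler_nat ltnW.
have n1 : 0 < n%:R :> R by rewrite ltr0n (leq_trans _ hn).
have h : a^-1 <= n%:R `^ (1 - be).
  have -> : a^-1 = (a^-1 `^ (1 - be)^-1) `^ (1 - be).
    by rewrite -powRrM mulVf ?gt_eqF // powRr1 // invr_ge0 ltW.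
  apply: ge0_ler_powR; [exact: ltW | by rewrite nnegrE powR_ge0 | by rewrite nnegrE ltW |].
  exact: le_trans hn0 nR.
have e : n%:R = n%:R `^ be * n%:R `^ (1 - be) :> R.
  rewrite -powRD; last by rewrite addrCA subrr addr0 oner_eq0.
  by rewrite addrCA subrr addr0 powRr1 // ltW.
rewrite {2}e; have p0 : 0 < n%:R `^ be by apply: powR_gt0.
rewrite mulrCA ler_pMr // -[leLHS](divff (lt0r_neq0 a0)) ler_pM2l //.
Qed.

Definition pieces (H : sgraph) (K : nat) (S : {set H}) (ps : seq {set H}) : Prop :=
  [/\ forall p, p \in ps -> (#|p| <= K)%N,
      forall x, x \in S -> exists2 p, p \in ps & x \in p
    & forall x y, x \in S -> y \in S -> edge x y -> exists p, [/\ p \in ps, x \in p & y \in p]].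

(** Recursive splitting along separators. The induction proves the stronger bound (1 + dl) |S| - M
    |S| ^ be: by [powR_subadditive_gap] the subtracted terms of the two sides exceed that of [S] by
    enough to pay for the repeated separator. *)
Lemma decomposition (F : sgraph -> Prop) (dl : R) : strongly_sublinear_separators R F ->
  0 < dl -> exists K : nat, forall H : sgraph, F H ->
  exists (I : finType) (P : I -> {set H}),
  [/\ forall i, (#|P i| <= K)%N, forall x, exists i, x \in P i,
      forall x y, edge x y -> exists i, x \in P i /\ y \in P i
    & (\sum_i #|P i|)%:R <= (1 + dl) * #|H|%:R].
Proof.
move=> [Fsub [be0 [c [n0 [be01 c0 hsep]]]]] dl0.
(* Raising the exponent only weakens the bound on the separators of nonempty graphs and makes it
   positive. *)
pose be : R := Num.max be0 (1 / 2).
have b0 : 0 < be by rewrite lt_max; apply/orP; right; lra.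
have b1 : be < 1 by rewrite gt_max be01; lra.
have bb : be0 <= be by rewrite le_max lexx.
pose h : R := (3 / 4) `^ (1 - be).
have h0 : 0 < h by apply: powR_gt0; lra.
have h1 : h < 1.
  have -> : 1 = 1 `^ (1 - be) :> R by rewrite powR1.
  apply: gt0_ltr_powR; rewrite ?nnegrE; lra.
(* Solves M (1 / h - 1) = (1 + dl) c: the guaranteed gain at a split equals the cost of its
   separator. *)
pose M := (1 + dl) * c * h / (1 - h).
have M0 : 0 < M by rewrite divr_gt0 ?mulr_gt0 //; lra.
have Mh : M * (1 - h) = (1 + dl) * c * h by rewrite /M mulfVK // gt_eqF //; lra.
have [k1 hk1] := @powR_sublinear be (dl / M) b1 ltac:(by rewrite divr_gt0).
(* Separators of order at most n / 12 leave sides of at most 2n / 3 + n / 12 = 3n / 4 vertices. *)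
have [k2 hk2] := @powR_sublinear be (1 / (12 * c)) b1 ltac:(by rewrite divr_gt0 ?mulr_gt0).
(* Sets with at most 4 K4 elements are not split. The sides of a larger one have at least a third of
   its elements, so all sets that occur have at least K4 elements, where M |S| ^ be <= dl |S|. *)
pose K4 := (n0 + k1 + k2 + 1)%N.
exists (4 * K4)%N => H FH.
have main m : forall S : {set H}, (#|S| <= m)%N -> (K4 <= #|S|)%N ->
    exists ps : seq {set H}, pieces (4 * K4) S ps /\
    (\sum_(p <- ps) #|p|)%:R <= (1 + dl) * #|S|%:R - M * #|S|%:R `^ be.
  elim: m => [|m IH] S cS K4S; first by move: K4S cS; rewrite /K4; clear; lia.
  have n1 : (0 < #|S|)%N by apply: leq_trans K4S; rewrite /K4 addn1.
  set n : R := #|S|%:R.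
  have np : 0 < n by rewrite ltr0n.
  set t := n `^ be.
  have t0 : 0 < t by apply: powR_gt0.
  have Mt : M * t <= dl * n.
    have := hk1 #|S| ltac:(by apply: leq_trans K4S; rewrite /K4; clear; lia).
    by rewrite -/n -/t -(ler_pM2l M0) => /le_trans; apply; rewrite mulrA mulrCA divff ?gt_eqF // mulr1.
  have ct : 12 * (c * t) <= n.
    have := hk2 #|S| ltac:(by apply: leq_trans K4S; rewrite /K4; clear; lia).
    rewrite -/n -/t mul1r -(ler_pM2l c0) => ht.
    have e : c * ((12 * c)^-1 * n) = n / 12 by field; lra.
    rewrite e in ht; clear -ht; lra.
  have [small|big] := leqP #|S| (4 * K4).
    exists [:: S]; split; last first.
      by rewrite big_seq1 -/n -/t; clear -Mt; lra.
    split.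
    - by move=> p; rewrite inE => /eqP->.
    - by move=> x xS; exists S; rewrite ?inE.
    by move=> x y xS yS _; exists S; rewrite ?inE.
  have FS : F (induced_subgraph S) by apply: (Fsub H) => //; exists val; split; [exact: val_inj | ].
  have n0S : (n0 <= nb_vertices (induced_subgraph S))%N.
    rewrite /nb_vertices card_induced; apply: leq_trans K4S; rewrite /K4; clear; lia.
  have [A1 [A2 [[U12 E12 _ _] [B1 B2] O12]]] := hsep _ FS n0S.
  rewrite /nb_vertices card_induced in B1 B2; rewrite /nb_vertices card_induced /separation_order -/n in O12.
  have O : #|A1 :&: A2|%:R <= c * t.
    apply: le_trans O12 _; rewrite ler_pM2l //; apply: ler_powR => //.
    by rewrite (ler_nat R 1).
  have c12 : #|A1|%:R + #|A2|%:R = n + #|A1 :&: A2|%:R :> R.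
    by rewrite /n -natrD -cardsUI U12 natrD cardsT card_induced.
  have {}B1 : n <= 3 * #|A1|%:R by rewrite /n -natrM ler_nat.
  have {}B2 : n <= 3 * #|A2|%:R by rewrite /n -natrM ler_nat.
  have [u1 u2] : 4 * #|A1|%:R <= 3 * n /\ 4 * #|A2|%:R <= 3 * n.
    by clear -B1 B2 c12 O ct; split; lra.
  have cA (A : {set induced_subgraph S}) : #|val @: A| = #|A| by apply/card_imset/val_inj.
  have bigR : 4 * K4%:R <= n by rewrite /n -natrM ler_nat ltnW.
  have lower (A : {set induced_subgraph S}) : n <= 3 * #|A|%:R -> (K4 <= #|val @: A|)%N.
    rewrite cA -(ler_nat R) => hA; have : 0 <= K4%:R :> R by [].
    by clear -hA bigR; lra.
  have upper (A : {set induced_subgraph S}) : 4 * #|A|%:R <= 3 * n -> (#|val @: A| <= m)%N.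
    move=> hA; rewrite -ltnS; apply: leq_trans cS; rewrite cA -(ltr_nat R) -/n.
    by clear -hA np; lra.
  have [ps1 [[p11 p12 p13] s1]] := IH _ (upper _ u1) (lower _ B1).
  have [ps2 [[p21 p22 p23] s2]] := IH _ (upper _ u2) (lower _ B2).
  rewrite !cA in s1 s2.
  have inA x (xS : x \in S) : (exist _ x xS : induced_subgraph S) \in A1 \/ (exist _ x xS : induced_subgraph S) \in A2.
    by have /setP/(_ (exist _ x xS)) := U12; rewrite !inE => /orP[]; auto.
  have imA x (xS : x \in S) (A : {set induced_subgraph S}) : (exist _ x xS : induced_subgraph S) \in A -> x \in val @: A.
    by move=> h2; apply/imsetP; exists (exist _ x xS).
  exists (ps1 ++ ps2); split.
    split.
    - by move=> p; rewrite mem_cat => /orP[/p11|/p21].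
    - move=> x xS; have [/imA/p12[p h2 h3]|/imA/p22[p h2 h3]] := inA x xS;
        by exists p; rewrite // mem_cat h2 ?orbT.
    move=> x y xS yS xy.
    have /orP[/andP[hx hy]|/andP[hx hy]] := E12 (exist _ x xS) (exist _ y yS) xy.
      have [p [h2 h3 h4]] := p13 x y (imA _ _ _ hx) (imA _ _ _ hy) xy.
      by exists p; rewrite mem_cat h2.
    have [p [h2 h3 h4]] := p23 x y (imA _ _ _ hx) (imA _ _ _ hy) xy.
    by exists p; rewrite mem_cat h2 orbT.
  rewrite big_cat natrD /=; apply: le_trans (lerD s1 s2) _.
  set a1 : R := #|A1|%:R in u1 c12 *; set a2 : R := #|A2|%:R in u2 c12 *.
  have g1 := @powR_subadditive_gap be h a1 n b0 b1 (ler0n _ _) np erefl u1.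
  have g2 := @powR_subadditive_gap be h a2 n b0 b1 (ler0n _ _) np erefl u2.
  rewrite -/t in g1 g2.
  have g3 : t <= (a1 `^ be + a2 `^ be) * h.
    have o0 : 0 <= #|A1 :&: A2|%:R * t by rewrite mulr_ge0 // ltW.
    rewrite -(ler_pM2r np); move: g1 g2; have : (a1 + a2) * t = (n + #|A1 :&: A2|%:R) * t by rewrite c12.
    by clear -o0; lra.
  have key : (1 + dl) * (c * t) <= M * (a1 `^ be + a2 `^ be - t).
    rewrite -(ler_pM2r h0).
    have e : (1 + dl) * (c * t) * h = M * (1 - h) * t by rewrite Mh; ring.
    rewrite e; have := ler_wpM2l (ltW M0) g3; clear; lra.
  have := ler_wpM2l (_ : 0 <= 1 + dl) O; move=> /(_ ltac:(by clear -dl0; lra)) O'.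
  have e : (1 + dl) * (a1 + a2) = (1 + dl) * (n + #|A1 :&: A2|%:R) by rewrite c12.
  by clear -key O' e; lra.
have all_pieces : exists ps : seq {set H}, pieces (4 * K4) [set: H] ps /\
    (\sum_(p <- ps) #|p|)%:R <= (1 + dl) * #|H|%:R.
  have [small|big] := leqP #|H| (4 * K4); last first.
    have [|ps [h2 h3]] := main #|H| [set: H] ltac:(by rewrite cardsT).
      rewrite cardsT; apply: leq_trans (ltnW big); rewrite /K4; clear; lia.
    exists ps; split=> //; apply: le_trans h3 _; rewrite cardsT gerBl.
    by rewrite mulr_ge0 ?powR_ge0 // ltW.
  exists [:: [set: H]]; split; last by rewrite big_seq1 cardsT ler_peMl // lerDl ltW.
  split.
  - by move=> p; rewrite inE => /eqP->; rewrite cardsT.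
  - by move=> x xS; exists [set: H]; rewrite ?inE.
  by move=> x y xS yS _; exists [set: H]; rewrite ?inE.
have [ps [[q1 q2 q3] q4]] := all_pieces.
pose P (i : 'I_(size ps)) := nth set0 ps i.
have idx p : p \in ps -> exists i, P i = p.
  move=> pin; have lt : (index p ps < size ps)%N by rewrite index_mem.
  by exists (Ordinal lt); rewrite /P /= nth_index.
exists ('I_(size ps) : finType), P; split.
- by move=> i; apply: q1; apply: mem_nth.
- by move=> x; have [|p /idx[i <-] xp] := q2 x; [rewrite inE | exists i].
- move=> x y xy; have [||p [/idx[i <-] xp yp]] := q3 x y _ _ xy; rewrite ?inE //.
  by exists i.
by move: q4; rewrite (big_nth set0) big_mkord.
Qed.

End Decomposition.

(** * Sparse minimal graphs *)

Section Main.
Variable R : realType.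

Lemma critical_pieces (ep mu D k : R) (G : sgraph) : critical D k G ->
  0 < mu -> mu <= ep / 100 -> ep <= 1 -> 2 <= mu * D -> 200 <= ep * D -> 0 <= k ->
  12 <= #|G|%:R :> R ->
  exists (L : {set G}) (P : G -> {set G}), #|G|%:R / 4 <= #|L|%:R :> R /\
  forall v, v \in L -> [/\ P v \subset [set y | edge v y], robust (mu ^+ 2 / 6) (P v),
    P v != set0, (1 - ep / 100) * D * #|P v|%:R <= (ar (P v) (P v))%:R
    & [/\ #|P v|%:R <= 3 * D, (1 - ep / 100) * D <= #|P v|%:R
        & #|low_degree mu D (P v)|%:R <= mu * (3 * D)]].
Proof.
move=> [[n1 n2 n3] hcod hdg _] mu0 mu1 ep1 muD epD k0 N12.
pose L := [set v : G | (dg v [set: G])%:R <= 3 * D].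
have D0 : 0 < D by rewrite -(pmulr_rgt0 _ mu0); clear -muD; lra.
have mu1' : mu <= 1 by clear -mu1 ep1; lra.
have D2 : 2 <= D.
  have : mu * D <= D by rewrite ler_piMl // ltW.
  by clear -muD; lra.
have cL := many_low_degree D2 k0 N12 n3.
have ex v : exists S : {set G}, v \in L -> [/\ S \subset [set y | edge v y],
    robust (mu ^+ 2 / 6) S, S != set0,
    (D - 1 - mu ^+ 2 / 2 * D) * #|S|%:R <= (ar S S)%:R
    & #|low_degree mu D S|%:R <= mu * #|S|%:R].
  have [|] := boolP (v \in L); last by exists set0.
  rewrite inE => vL; have [S hS] := local_piece mu0 mu1' muD hcod (hdg v) vL.
  by exists S.
have [P hP] := choice ex; exists L, P; split=> // v vL.
have [s1 s2 s3 s4 s5] := hP v vL.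
have hm : (1 - ep / 100) * D <= D - 1 - mu ^+ 2 / 2 * D.
  have h : mu * mu <= mu * 1 by rewrite ler_pM2l.
  have h' : mu ^+ 2 / 2 * D <= ep / 200 * D.
    by rewrite ler_pM2r // expr2; clear -h mu1; lra.
  by clear -h' epD; lra.
have a1 : (1 - ep / 100) * D * #|P v|%:R <= (ar (P v) (P v))%:R.
  by apply: le_trans s4; rewrite ler_wpM2r.
have c3 : #|P v|%:R <= 3 * D.
  have: (dg v [set: G])%:R <= 3 * D by move: vL; rewrite inE.
  apply: le_trans; rewrite ler_nat /dg; apply: subset_leq_card.
  by apply: subset_trans s1 _; apply/subsetP => y; rewrite !inE.
split=> //; split=> //.
  have x0 : 0 < #|P v|%:R :> R by rewrite ltr0n card_gt0.
  by rewrite -(ler_pM2r x0); apply: le_trans a1 _; rewrite -natrM ler_nat ar_le.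
by apply: le_trans s5 _; rewrite ler_pM2l.
Qed.

Lemma critical_linked (D k : R) (G : sgraph) (X Y : {set G}) (J : nat) : critical D k G ->
  J%:R <= k -> k <= #|X|%:R -> k <= #|Y|%:R -> linked_by X Y J.
Proof.
move=> [_ _ _ hsep] hJ hX hY; apply: linking_paths.
- move=> A B h1 h2 h3 h4; rewrite -(ler_nat R); apply: le_trans hJ _; exact: hsep.
- by rewrite -(ler_nat R); apply: le_trans hJ _.
- by rewrite -(ler_nat R); apply: le_trans hJ _.
Qed.

Lemma stuck_degree (ep eta D : R) (G : sgraph) (X S : {set G}) (v : G) :
  0 < D -> 0 <= ep -> eta <= ep / 80 -> X \subset [set y | edge v y] ->
  (1 - ep / 100) * D <= #|X|%:R -> #|X :\: S|%:R <= eta * D ->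
  (1 - ep / 10) * D <= (dg v S)%:R.
Proof.
move=> D0 ep0 he sX cX cS.
have h1 : #|X|%:R = #|X :&: S|%:R + #|X :\: S|%:R :> R by rewrite -natrD cardsID.
have h2 : #|X :&: S|%:R <= (dg v S)%:R :> R.
  rewrite ler_nat /dg; apply: subset_leq_card; apply/subsetP => y.
  by rewrite !inE => /andP[/(subsetP sX)]; rewrite !inE => -> ->.
have h3 : eta * D <= ep / 80 * D by rewrite ler_pM2r.
have h4 : 0 <= ep * D by rewrite mulr_ge0 // ltW.
clear -h1 h2 h3 h4 cX cS; lra.
Qed.

Lemma exists_subset_window (G : finType) (X : {set G}) (x : R) : 0 <= x -> x + 1 <= #|X|%:R ->
  exists Y : {set G}, [/\ Y \subset X, x <= #|Y|%:R & #|Y|%:R <= x + 1].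
Proof.
move=> x0 hX; have [m [m1 m2]] := truncn_bounds x0.
have m3 : (m.+1 <= #|X|)%N.
  by rewrite -(ler_nat R) -[m.+1%:R]natr1; apply: le_trans hX; rewrite lerD2r.
have [Y [sY cY]] := exists_subset_card m3.
by exists Y; split=> //; rewrite cY -[m.+1%:R]natr1 ?lerD2r // ltW.
Qed.

Lemma sparse_minor (ep : R) : 0 < ep -> ep <= 1 ->
  exists C dl : R, [/\ 1 <= C, 0 < dl & forall K, exists d0 : R, forall d, d0 <= d ->
  forall H, hostable H d dl K -> forall G : sgraph,
  critical ((1 + ep) * d) (ep / 100 * ((1 + ep) * d)) G -> C * d < #|G|%:R -> minor H G].
Proof.
move=> ep0 ep1.
pose eta := ep / 80.
have eta0 : 0 < eta by rewrite /eta; lra.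
have eta1 : eta <= 1 by rewrite /eta; lra.
(* At size C1 D both the low-degree vertices and the 4d vertices of the packing in [full_dense] are
   negligible. *)
pose C1 := 500 / ep.
have C10 : 500 <= C1 by rewrite ler_pdivlMr //; clear -ep1; lra.
have [J1 hJ1] := exists_nat_ge (C1 / eta).
have {}hJ1 : C1 <= J1%:R * eta by rewrite -ler_pdivrMr.
have j1 : 1 <= J1.+1%:R :> R by rewrite ler1n.
(* A union of J1 + 1 sets, each with at most 3 mu D vertices of low degree, then has at most ep /
   100 * D of them. *)
pose mu := ep / (300 * J1.+1%:R).
have mu0 : 0 < mu.
  by apply: divr_gt0; [exact: ep0 | apply: mulr_gt0; clear -j1; lra].
have muJ : J1.+1%:R * mu = ep / 300 by rewrite /mu; field; clear -j1; lra.
have mu1 : mu <= ep / 100.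
  have : 1 * mu <= J1.+1%:R * mu by rewrite ler_pM2r.
  by rewrite muJ; clear -ep0; lra.
pose lam := mu ^+ 2 / 6.
have mu1' : mu <= 1 by clear -mu1 ep1; lra.
have lam0 : 0 < lam by rewrite divr_gt0 // exprn_gt0.
have lam1 : lam <= 1.
  have : mu ^+ 2 <= 1 by rewrite exprn_ile1 // ltW.
  by rewrite /lam; clear; lra.
pose f := eta / (4 * (C1 + 3)).
have f0 : 0 < f by rewrite divr_gt0 //; clear -C10; lra.
have f1 : f <= 1 by rewrite ler_pdivrMr; clear -C10 eta1; lra.
pose lamJ := lam * f ^+ J1.
have lamJ0 : 0 < lamJ by rewrite mulr_gt0 // exprn_gt0.
have lamJ1 : lamJ <= 1 by rewrite mulr_ile1 ?exprn_ile1 ?exprn_ge0 // ltW.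
pose ga := ep / (100 * (C1 + 3)).
have ga0 : 0 < ga by rewrite divr_gt0 //; clear -C10; lra.
have ga1 : ga <= 1 by rewrite ler_pdivrMr; clear -C10 ep1; lra.
have gaC : ga * (C1 + 3) = ep / 100 by rewrite /ga; field; clear -C10; lra.
have [M' hM'] := exists_nat_ge (100 / ep); pose M := M'.+1.
have hM : 100 <= ep * M%:R.
  move: hM'; rewrite ler_pdivrMr // /M -[M'.+1%:R]natr1; clear -ep0; lra.
(* The set [S] has at most C3 D vertices, which is ep / 5 of the C2 D vertices that [stuck_dense]
   will add to it. *)
pose C3 := C1 + 3; pose C2 := 5 * C3 / ep.
have C30 : 503 <= C3 by rewrite /C3; clear -C10; lra.
have C2ep : C2 * ep = 5 * C3 by rewrite /C2 mulfVK // lt0r_neq0.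
have C20 : 0 < C2 by rewrite -(pmulr_lgt0 _ ep0) C2ep; clear -C30; lra.
pose CD := 2 * (C3 + C2 + 1).
have CD1 : 1 <= CD by rewrite /CD; clear -C20 C30; lra.
have he0 : 0 < ep / 2 by clear -ep0; lra.
have he1 : ep / 2 <= 1 by clear -ep1; lra.
have six : 1 <= 6 :> R by clear; lra.
have [dlT [dlT0 dlT1 two]] := two_pieces he0 he1 six lam0 lam1.
have [dlB [dlB0 ros]] := @robust_or_sparse R lamJ ga M lamJ0 lamJ1 ga0 ga1 isT.
have [dlD [dlD0 den]] := dense_minor he0 he1 CD1.
pose dl : R := Num.min dlT (Num.min dlB dlD).
have dl0 : 0 < dl by rewrite !lt_min dlT0 dlB0.
have dlTle : dl <= dlT by rewrite ge_min lexx.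
have dlBle : dl <= dlB by rewrite !ge_min lexx orbT.
have dlDle : dl <= dlD by rewrite !ge_min lexx !orbT.
exists (8 * (C3 + C2 + 1)), dl; split=> //; first by clear -C20 C30; lra.
move=> K; have [d1 {}two] := two K; have [d2 {}ros] := ros K; have [d3 {}den] := den K.
exists (Num.max (Num.max d1 d2) (Num.max d3 (Num.max (2 / mu) (400 / ep)))) => d.
rewrite !ge_max => /andP[/andP[hd1 hd2] /and3P[hd3 hd4 hd5]] H hH G crit hG.
have hT := hostable_mono dlTle hH; have hB := hostable_mono dlBle hH.
have hDn := hostable_mono dlDle hH.
rewrite ler_pdivrMr // in hd4; rewrite ler_pdivrMr // in hd5.
have d0 : 0 < d by rewrite -(pmulr_lgt0 _ ep0); clear -hd5; lra.
set D := (1 + ep) * d in crit.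
have dD : d <= D by rewrite /D ler_peMl //; [exact: ltW | clear -ep0; lra].
have D2d : D <= 2 * d by rewrite /D ler_pM2r //; clear -ep1; lra.
have D0 : 0 < D by apply: lt_le_trans dD.
have d400 : 400 <= d.
  apply: le_trans hd5 _; rewrite ler_piMr //; exact: ltW.
have muD : 2 <= mu * D.
  by apply: le_trans hd4 _; rewrite mulrC ler_pM2l.
have epD : 200 <= ep * D.
  have : ep * d <= ep * D by rewrite ler_pM2l.
  by clear -hd5; lra.
have k0 : 0 <= ep / 100 * D by rewrite mulr_ge0 // ?divr_ge0 // ltW.
have Cd : 0 < (C3 + C2) * d by rewrite mulr_gt0 // addr_gt0 //; clear -C30; lra.
have N12 : 12 <= #|G|%:R :> R.
  by apply: le_trans (ltW hG); clear -Cd d400; lra.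
have [L [P [cL hP]]] := critical_pieces crit mu0 mu1 ep1 muD epD k0 N12.
have CDd : (C3 + C2) * D <= 2 * ((C3 + C2) * d).
  have : (C3 + C2) * D <= (C3 + C2) * (2 * d).
    by rewrite ler_pM2l // addr_gt0 //; clear -C30; lra.
  by clear; lra.
have dDens : (1 + ep / 2) * d <= (1 - ep / 100) * D.
  rewrite /D mulrA ler_pM2r //; clear -ep0 ep1; nra.
have L0 : (0 < #|L|)%N.
  by rewrite -(ltr0n R); apply: lt_le_trans cL; clear -N12; lra.
have [v0 v0L] : exists v0, v0 \in L by apply/set0Pn; rewrite -card_gt0.
have [[v [vL hv]]|all_meet] := pselect (exists v, v \in L /\ #|P v :&: P v0|%:R <= eta * D).
  have big w : w \in L -> ep / 100 * D <= #|P w|%:R.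
    move=> wL; have [_ _ _ _ [_ h _]] := hP w wL; apply: le_trans h.
    by rewrite ler_pM2r //; clear -ep0 ep1; lra.
  have six3 : 3 * D <= 6 * d by clear -D2d; lra.
  have [v1 v2 v3 v4 [v5 v6 _]] := hP v vL.
  have [w1 w2 w3 w4 [w5 w6 _]] := hP v0 v0L.
  apply: (two d hd1 H hT G (P v) (P v0)) => //.
  - exact: le_trans v5 six3.
  - exact: le_trans w5 six3.
  - by apply: le_trans v4; rewrite ler_wpM2r.
  - by apply: le_trans w4; rewrite ler_wpM2r.
  - apply: le_trans hv _; rewrite /eta.
    have : ep * D <= ep * (2 * d) by rewrite ler_pM2l.
    by clear; lra.
  (* As dlT <= ep / 800, the number of paths stays within the connectivity ep / 100 * D of the
     critical graph. *)
  move=> J hJ; apply: critical_linked crit _ (big v vL) (big v0 v0L).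
  apply: le_trans hJ _.
  have h1 : dlT * d <= ep / 2 / 400 * d by rewrite ler_pM2r.
  have h2 : ep * d <= ep * D by rewrite ler_pM2l.
  clear -h1 h2 hd5; lra.
have hP' v : v \in L -> [/\ robust lam (P v), #|P v|%:R <= 3 * D,
     #|low_degree mu D (P v)|%:R <= mu * (3 * D) & eta * D < #|P v :&: P v0|%:R].
  move=> vL; have [_ v2 _ _ [v5 _ v7]] := hP v vL; split=> //.
  by rewrite ltNge; apply/negP => h; apply: all_meet; exists v.
have C11 : 1 <= C1 by clear -C10; lra.
have [S [s1 s2 s3 s4 s5]] := grow_pieces (ltW lam0) eta0 eta1 D0 C11 mu0 v0L hP' J1.
have full : C1 * D <= #|S|%:R -> minor H G.
  move=> hfull.
  have S2d : 2 * d <= #|S|%:R.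
    apply: le_trans hfull; apply: ler_pM => //; [exact: ltW | clear -C10; lra].
  have [//|[Z [sZ cZ aZ]]] := ros d hd2 H hB G S s2 S2d.
  apply: (den d hd3 H hDn G S).
  - by rewrite -card_gt0 -(ltr0n R); apply: lt_le_trans S2d; rewrite mulr_gt0.
  - apply: le_trans s3 _.
    have : C2 * d >= 0 by rewrite mulr_ge0 // ltW.
    have : C3 * D <= C3 * (2 * d) by rewrite ler_pM2l //; clear -C30; lra.
    rewrite /CD -/C3; clear -d0; lra.
  apply: (@full_dense R ep mu D d C1 ga M G S Z) => //.
  - exact: ltW.
  - by rewrite gaC.
  - exact: ltW.
  apply: le_trans s4 _; rewrite mulrA muJ.
  have : ep * D <= D by rewrite ler_piMl // ltW.
  by clear -D0; lra.
case: s5 => [//|stuck|hJ]; last first.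
  apply: full; apply: le_trans hJ; rewrite mulrA ler_pM2r //.
have cLS : C2 * D + 1 <= #|L :\: S|%:R.
  have h : #|L|%:R <= #|S|%:R + #|L :\: S|%:R :> R.
    rewrite -natrD ler_nat -(cardsID S L) leq_add2r.
    by rewrite subset_leq_card // subsetIr.
  have h3 : #|S|%:R <= C3 * D by [].
  clear -h h3 cL hG CDd d400; lra.
have C2D : 0 <= C2 * D by rewrite mulr_ge0 // ltW.
have [Y [sY Y1 Y2]] := exists_subset_window C2D cLS.
have dSY : [disjoint S & Y].
  by apply: disjointWr sY _; exact: disjD.
have S0 : S != set0.
  have [_ _ /set0Pn[x xP] _ _] := hP v0 v0L.
  by apply/set0Pn; exists x; apply: (subsetP s1).
apply: (den d hd3 H hDn G (S :|: Y)).
- by rewrite setU_eq0 negb_and S0.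
- have h : #|S :|: Y|%:R <= #|S|%:R + #|Y|%:R :> R by rewrite -natrD ler_nat leq_card_setU.
  have h3 : #|S|%:R <= C3 * D by [].
  rewrite /CD; clear -h h3 Y2 CDd d400; lra.
apply: (@stuck_dense R ep D d C2 C3) => //; first by rewrite C2ep.
move=> v vY; have vL : v \in L.
  by have := subsetP sY v vY; rewrite inE => /andP[].
have [v1 _ _ _ [_ v6 _]] := hP v vL.
exact: (stuck_degree D0 (ltW ep0) (lexx _) v1 v6 (stuck v vL)).
Qed.

(** A critical graph of order at most C d is dense enough for [dense_minor] as a whole, because the
    offset costs only a proportion ep / 100. A larger one falls to [sparse_minor]. *)
Lemma dense_graph_minor (ep : R) : 0 < ep -> ep <= 1 ->
  exists dl : R, 0 < dl /\ forall K, exists d0 : R, forall d, d0 <= d ->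
  forall H, hostable H d dl K -> forall G : sgraph, (0 < #|G|)%N ->
  (1 + ep) * d * #|G|%:R <= (nb_edges G)%:R -> minor H G.
Proof.
move=> ep0 ep1.
have [C [dlS [C1 dlS0 spa]]] := sparse_minor ep0 ep1.
have he0 : 0 < ep / 2 by clear -ep0; lra.
have he1 : ep / 2 <= 1 by clear -ep1; lra.
have [dlD [dlD0 den]] := dense_minor he0 he1 C1.
exists (Num.min dlS dlD); split; first by rewrite lt_min dlS0.
move=> K; have [d1 {}spa] := spa K; have [d2 {}den] := den K.
exists (Num.max 5 (Num.max d1 d2)) => d; rewrite !ge_max => /and3P[d5 hd1 hd2] H hH G G0 hG.
have hS : hostable H d dlS K by apply: hostable_mono hH; rewrite ge_min lexx.
have hD : hostable H d dlD K by apply: hostable_mono hH; rewrite ge_min lexx orbT.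
have d0 : 0 < d by clear -d5; lra.
set D := (1 + ep) * d in hG.
have dD : d <= D by rewrite /D ler_peMl //; [exact: ltW | clear -ep0; lra].
have D0 : 0 < D by apply: lt_le_trans dD.
have k0 : 0 <= ep / 100 * D by rewrite mulr_ge0 // ?divr_ge0 // ltW.
have k1 : ep / 100 * D <= D / 4.
  by rewrite mulrC ler_pM2l //; clear -ep1; lra.
have aG : 2 * D * #|G|%:R <= (arcs G)%:R.
  by rewrite arcs_nb_edges natrM -mulrA ler_pM2l.
have [G' [mG crit]] := minimal_minor (le_trans d5 dD) k0 k1 G0 aG.
suff h : minor H G' by exact: minor_trans h mG.
have [small|large] := lerP (#|G'|%:R : R) (C * d); last exact: (spa d hd1 H hS G' crit large).
have [[n1 n2 _] _ _ _] := crit.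
apply: (den d hd2 H hD G' [set: G']).
- by rewrite -card_gt0 cardsT -(ltr0n R); apply: lt_le_trans n1; clear -D0; lra.
- by rewrite cardsT.
rewrite cardsT; apply: le_trans n2.
set N : R := #|G'|%:R in n1 *.
have h1 : D * D <= D * N by rewrite ler_pM2l //; clear -n1; lra.
have h2 : ep * (D * D) <= ep * (D * N) by rewrite ler_pM2l.
have N0 : 0 <= N by [].
have h3 : (1 + ep / 2) * (d * N) <= (1 - ep / 100) * (1 + ep) * (d * N).
  by rewrite ler_wpM2r ?mulr_ge0 // ?(ltW d0) //; clear -ep0 ep1; nra.
have h4 : (1 - ep / 100) * (1 + ep) * (d * N) = (1 - ep / 100) * (D * N).
  by rewrite /D; ring.
clear -h2 h3 h4; lra.
Qed.

End Main.

(** * The extremal function *)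

Section Extremal.
Variable R : realType.

Lemma chromatic_coloring (H : sgraph) : (chromatic_number H <= 4)%N ->
  exists col : H -> 'I_4, forall x y, edge x y -> col x != col y.
Proof.
rewrite /chromatic_number; case: ex_minnP => m /existsP[c /forallP hc] _ m4.
exists (fun x => widen_ord m4 (c x)) => x y xy.
have /forallP/(_ y)/implyP/(_ xy) := hc x.
by apply: contra => /eqP /(congr1 val) /= /val_inj ->.
Qed.

Lemma vertex_cover_numberP (H : sgraph) :
  exists C : {set H}, vertex_cover C /\ #|C| = vertex_cover_number H.
Proof.
rewrite /vertex_cover_number; case: ex_minnP => m /existsP[C /andP[hC /eqP cC]] _.
by exists C.
Qed.

Lemma vertex_cover_number_le (H : sgraph) (C : {set H}) :
  vertex_cover C -> (vertex_cover_number H <= #|C|)%N.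
Proof.
move=> hC; rewrite /vertex_cover_number; case: ex_minnP => m _; apply.
by apply/existsP; exists C; rewrite hC eqxx.
Qed.

Lemma extremal_le (H : sgraph) (x : R) :
  (forall G : sgraph, (0 < #|G|)%N -> x * #|G|%:R <= (nb_edges G)%:R -> minor H G) ->
  (extremal_function R H <= x%:E)%E.
Proof.
move=> h; apply: ge_ereal_sup => _ [G [G0 nm ->]]; rewrite lee_fin leNgt.
apply/negP; rewrite /density ltr_pdivlMr ?ltr0n // => /ltW lt.
exact: nm (h G G0 lt).
Qed.

Lemma extremal_ge (H G : sgraph) (x : R) : (0 < #|G|)%N -> ~ minor H G ->
  x * #|G|%:R <= (nb_edges G)%:R -> (x%:E <= extremal_function R H)%E.
Proof.
move=> G0 nm h; apply: (@le_trans _ _ (density R G)%:E).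
  by rewrite lee_fin /density ler_pdivlMr // ltr0n.
by apply: ereal_sup_ubound; exists G.
Qed.

(** The vertices of [H] whose branch sets meet [A] form a vertex cover, and disjoint branch sets
    meet [A] in distinct vertices. *)
Lemma minor_cover (H G : sgraph) (A : {set G}) : minor H G -> vertex_cover A ->
  (vertex_cover_number H <= #|A|)%N.
Proof.
move=> [B [_ dB eB]] /forallP hA.
pose C := [set x | B x :&: A != set0].
have hC : vertex_cover C.
  apply/forallP => x; apply/forallP => y; apply/implyP => /eB[u [v [ux vy uv]]].
  have /forallP/(_ v)/implyP/(_ uv)/orP[uA|vA] := hA u; apply/orP; [left|right].
    by rewrite inE; apply/set0Pn; exists u; rewrite inE ux.
  by rewrite inE; apply/set0Pn; exists v; rewrite inE vy.
apply: leq_trans (vertex_cover_number_le hC) _.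
(* The option type supplies a default outside [C], where [B x :&: A] is empty. *)
have ex x : exists u : option G, x \in C -> exists2 z, u = Some z & z \in B x :&: A.
  have [|] := boolP (x \in C); last by exists None.
  by rewrite inE => /set0Pn[u uB]; exists (Some u) => _; exists u.
have [g hg] := choice ex.
have gC : {in C &, injective g}.
  move=> x y xC yC exy; have [u e1] := hg x xC; have [v e2] := hg y yC.
  rewrite exy e2 in e1; case: e1 => ->; rewrite !inE => /andP[vy _] /andP[vx _].
  by apply/eqP/negPn/negP => /dB /disjoint_false h; apply: (h u).
have sI : injective (@Some G) by move=> ? ? [].
rewrite -(card_in_imset gC) -(card_imset A sI); apply: subset_leq_card.
apply/subsetP => _ /imsetP[x xC ->]; have [u -> ] := hg x xC.
by rewrite inE => /andP[_ uA]; rewrite imset_f.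
Qed.

Lemma minor_card (H G : sgraph) : minor H G -> (#|H| <= #|G|)%N.
Proof.
move=> [B [nB dB _]].
have ex x : exists u, u \in B x by have [/set0Pn] := nB x.
have [g hg] := choice ex.
apply: (@leq_card _ _ g) => x y exy; apply/eqP/negPn/negP => /dB /disjoint_false h.
by apply: (h (g x)); [exact: hg | rewrite exy; exact: hg].
Qed.

Definition complete_graph (k : nat) : sgraph.
Proof.
by refine (@SGraph 'I_k (fun x y => x != y) _ _) => [x y|x]; rewrite ?eqxx // eq_sym.
Defined.

Lemma arcs_complete (k : nat) : arcs (complete_graph k) = (k * k.-1)%N.
Proof.
rewrite arcsE (eq_bigr (fun=> k.-1)); first by rewrite sum_nat_const card_ord.
move=> x _; have <- : #|predC1 (x : 'I_k)| = k.-1 by rewrite cardC1 card_ord.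
rewrite -sum1_card [RHS]big_mkcond /=; apply: eq_bigr => y _.
by rewrite inE /= eq_sym; case: (y == x).
Qed.

Definition complete_bipartite (a b : nat) : sgraph.
Proof.
refine (@SGraph ('I_a + 'I_b)%type
  (fun x y => if x is inl _ then if y is inr _ then true else false
              else if y is inl _ then true else false) _ _).
- by case=> [x|x] [y|y].
- by case.
Defined.

Lemma arcs_bipartite (a b : nat) : arcs (complete_bipartite a b) = (2 * (a * b))%N.
Proof.
rewrite arcsE big_sumType /= (eq_bigr (fun=> b)) => [|i _]; last first.
  by rewrite big_sumType /= big1 // add0n sum_nat_const card_ord muln1.
rewrite [X in (_ + X)%N](eq_bigr (fun=> a)) => [|i _]; last first.
  by rewrite big_sumType /= addnC big1 // add0n sum_nat_const card_ord muln1.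
by rewrite !sum_nat_const !card_ord [(b * a)%N]mulnC mul2n addnn.
Qed.

Lemma cover_bipartite (a b : nat) : exists A : {set complete_bipartite a b},
  vertex_cover A /\ #|A| = a.
Proof.
exists [set inl x | x in [set: 'I_a]]; split; last first.
  by rewrite card_imset ?cardsT ?card_ord // => x y [].
apply/forallP => -[x|x]; apply/forallP => -[y|y]; apply/implyP => //= _; apply/orP.
  by left; rewrite imset_f.
by right; rewrite imset_f.
Qed.

Definition target (H : sgraph) : R :=
  Num.max ((nb_vertices H)%:R / 2) (vertex_cover_number H)%:R.

Lemma target_ge (H : sgraph) : (nb_vertices H)%:R / 2 <= target H.
Proof. by rewrite /target le_max lexx. Qed.

Lemma extremal_lower (H : sgraph) : (2 <= nb_vertices H)%N ->
  (((1 - 4 / (nb_vertices H)%:R) * target H)%:E <= extremal_function R H)%E.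
Proof.
rewrite /target; set n := nb_vertices H => n2; set t := vertex_cover_number H.
have n0 : 0 < n%:R :> R by rewrite ltr0n ltnW.
have [le|lt] := lerP (t%:R : R) (n%:R / 2).
  apply: (@extremal_ge H (complete_graph n.-1)).
  - by rewrite card_ord; clear -n2; lia.
  - by move/minor_card; rewrite card_ord -/(nb_vertices H) -/n; clear -n2; lia.
  have e : 2 * (nb_edges (complete_graph n.-1))%:R = n.-1%:R * n.-2%:R :> R.
    by rewrite -natrM -arcs_nb_edges arcs_complete natrM.
  have en : n%:R = n.-2%:R + 2 :> R by rewrite -natrD; congr _%:R; clear -n2; lia.
  have e' : (1 - 4 / n%:R) * (n%:R / 2) = (n%:R - 4) / 2 :> R by field; apply: lt0r_neq0.
  rewrite e' card_ord.
  have : (n%:R - 4) * n.-1%:R <= n.-1%:R * n.-2%:R :> R.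
    by rewrite mulrC ler_wpM2l // en; clear; lra.
  rewrite -e; clear; lra.
have t0 : (0 < t)%N by rewrite -(ltr0n R); apply: lt_trans lt; rewrite divr_gt0.
(* This graph has density at least t - 2, and the loss of 2 is below 4t / n because t > n / 2. *)
apply: (@extremal_ge H (complete_bipartite t.-1 (t * t))).
- by rewrite card_sum !card_ord; clear -t0; nia.
- move=> hm; have [A [hA cA]] := cover_bipartite t.-1 (t * t).
  by have := minor_cover hm hA; rewrite cA -/t; clear -t0; lia.
have -> : nb_edges (complete_bipartite t.-1 (t * t)) = (t.-1 * (t * t))%N.
  by apply/eqP; rewrite -(eqn_pmul2l (isT : 0 < 2)%N) -arcs_nb_edges arcs_bipartite.
rewrite card_sum !card_ord.
have et : t%:R = t.-1%:R + 1 :> R by rewrite natr1 prednK.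
have cast (a b : nat) : (a + b * b)%:R = a%:R + b%:R * b%:R :> R by rewrite natrD natrM.
have cast' (a b : nat) : (a * (b * b))%:R = a%:R * (b%:R * b%:R) :> R by rewrite !natrM.
rewrite cast cast'.
have h1 : (1 - 4 / n%:R) * t%:R <= t%:R - 2 :> R.
  have : 2 <= 4 / n%:R * t%:R :> R.
    rewrite mulrAC ler_pdivlMr //; clear -lt; lra.
  clear; lra.
apply: le_trans (_ : (t%:R - 2) * (t.-1%:R + t%:R * t%:R) <= _).
  by rewrite ler_wpM2r // addr_ge0 // mulr_ge0.
have u0 : 0 <= t.-1%:R :> R by [].
rewrite et; clear -u0; nra.
Qed.

Lemma hostable_intro (H : sgraph) (d dl : R) (K : nat) (I : finType) (P : I -> {set H}) :
  (chromatic_number H <= 4)%N -> target H <= d ->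
  (forall i, (#|P i| <= K)%N) -> (forall x, exists i, x \in P i) ->
  (forall x y, edge x y -> exists i, x \in P i /\ y \in P i) ->
  (\sum_i #|P i|)%:R <= (1 + dl) * #|H|%:R -> hostable H d dl K.
Proof.
move=> /chromatic_coloring[col hcol]; rewrite /target ge_max => /andP[m1 m2] h1 h2 h3 h4.
have [C [hC cC]] := vertex_cover_numberP H.
exists I, P, C, col; split=> //; split=> //; last by rewrite cC.
by move: m1; rewrite ler_pdivrMr // mulrC.
Qed.

Lemma extremal_upper_large (F : sgraph -> Prop) (e : R) :
  strongly_sublinear_separators R F -> 0 < e -> e <= 1 ->
  exists n0 : nat, forall H, F H -> (chromatic_number H <= 4)%N -> (n0 <= nb_vertices H)%N ->
  (extremal_function R H <= ((1 + e) * target H)%:E)%E.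
Proof.
move=> hF e0 e1; have [dl [dl0 hdl]] := dense_graph_minor e0 e1.
have [K hK] := decomposition hF dl0; have [d0 hd0] := hdl K.
have [n0 hn0] := exists_nat_ge (2 * d0).
exists n0 => H FH chi hn; have [I [P [p1 p2 p3 p4]]] := hK H FH.
apply: extremal_le; apply: hd0; last exact: hostable_intro p1 p2 p3 p4.
apply: le_trans (target_ge H); rewrite ler_pdivlMr // mulrC.
by apply: le_trans hn0 _; rewrite ler_nat.
Qed.

(** With [n] fixed, [H] is taken as a single piece and no separators enter. This gives an upper
    bound depending on [n] alone, which is turned into a relative error because [target H] is at
    least 1. *)
Lemma extremal_upper_small (n : nat) : exists e : R, 0 <= e /\
  forall H, (chromatic_number H <= 4)%N -> nb_vertices H = n -> (2 <= n)%N ->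
  (extremal_function R H <= ((1 + e) * target H)%:E)%E.
Proof.
have [dl [dl0 hdl]] := dense_graph_minor (@ltr01 R) (lexx _).
have [d0 hd0] := hdl n; pose d := Num.max d0 n%:R.
have dn : n%:R <= d by rewrite le_max lexx orbT.
have d00 : 0 <= d by apply: le_trans dn.
exists (2 * d); split; first by rewrite mulr_ge0.
move=> H chi cH n2.
have t1 : 1 <= target H.
  apply: le_trans (target_ge H); rewrite cH ler_pdivlMr // mul1r.
  by rewrite ler_nat.
have td : target H <= d.
  rewrite /target ge_max cH; apply/andP; split; first by clear -dn d00; lra.
  apply: le_trans dn; rewrite ler_nat -cH -[nb_vertices H]cardsT.
  apply: vertex_cover_number_le; apply/forallP => x; apply/forallP => y.
  by rewrite !inE implybT.
apply: (@le_trans _ _ ((2 * d)%:E)); last first.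
  rewrite lee_fin; have : 2 * d * 1 <= 2 * d * target H by rewrite ler_wpM2l // mulr_ge0.
  by clear -t1; lra.
apply: extremal_le => G G0 hG.
apply: (hd0 d _ H _ G G0); first by rewrite le_max lexx.
  apply: (@hostable_intro _ _ _ _ unit (fun=> [set: H])).
  - exact: chi.
  - exact: td.
  - by move=> _; rewrite cardsT -/(nb_vertices H) cH.
  - by move=> x; exists tt; rewrite inE.
  - by move=> x y _; exists tt; rewrite !inE.
  by rewrite sum_nat_const card_unit mul1n cardsT ler_peMl // lerDl ltW.
by apply: le_trans hG; rewrite ler_wpM2r.
Qed.

(** The infimum of the admissible errors need not be admissible, but it is after adding a positive
    term. The choice 8 / (n + 1) also dominates the error 4 / n of the lower bound. *)
Lemma error_function (P : nat -> R -> Prop) :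
  (forall n e e', e <= e' -> P n e -> P n e') ->
  (forall n, exists e, 0 <= e /\ P n e) ->
  (forall e, 0 < e -> exists n0, forall n, (n0 <= n)%N -> P n e) ->
  exists f : nat -> R, [/\ forall n, P n (f n), forall n, 8 / n.+1%:R <= f n
    & (f n @[n --> \oo] --> (0 : R))%classic].
Proof.
move=> mono ex lim.
pose E n : classical_sets.set R := (fun e => 0 <= e /\ P n e).
have lb n : lbound (E n) 0 by move=> e [].
have hE n : has_inf (E n) by split; [have [e he] := ex n; exists e | exists 0].
have inf0 n : 0 <= inf (E n) by apply: lb_le_inf; [case: (hE n) | exact: lb].
have p n : 0 < 8 / n.+1%:R :> R by rewrite divr_gt0.
exists (fun n => inf (E n) + 8 / n.+1%:R); split.
- move=> n; have [e [_ Pe] /ltW le] := inf_adherent (p n) (hE n).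
  exact: mono le Pe.
- by move=> n; rewrite lerDr.
apply/cvgr0Pnorm_le => e e0.
have e2 : 0 < e / 2 by rewrite divr_gt0.
have [n0 hn0] := lim _ e2; have [n1 hn1] := exists_nat_ge (16 / e).
exists (maxn n0 n1) => // n /=; rewrite geq_max => /andP[h0 h1].
rewrite ger0_norm; last by rewrite addr_ge0 // ltW.
have i2 : inf (E n) <= e / 2.
  by apply: ge_inf; [exists 0; exact: lb | split; [exact: ltW | exact: hn0]].
have : 8 / n.+1%:R <= e / 2.
  rewrite ler_pdivrMr //.
  have h : 16 / e <= n.+1%:R.
    by apply: le_trans hn1 _; rewrite ler_nat; apply: leq_trans h1 _.
  move: h; rewrite ler_pdivrMr //; clear; lra.
by move: i2 (8 / _) => /= i2 y hy; clear -i2 hy; lra.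
Qed.

End Extremal.

Local Open Scope classical_set_scope.
Local Open Scope ring_scope.

Theorem theorem1p1 (R : realType) (F : sgraph -> Prop)
    (hF : strongly_sublinear_separators R F) :
  exists f : nat -> R,
    [/\ forall n : nat, 0 <= f n,
        f n @[n --> \oo] --> (0 : R)
      & forall H : sgraph, F H ->
          (chromatic_number H <= 4)%N -> (2 <= nb_vertices H)%N ->
          let m : R := Num.max ((nb_vertices H)%:R / 2)
                               (vertex_cover_number H)%:R in
          (((1 - f (nb_vertices H)) * m)%:E <= extremal_function R H)%E /\
          (extremal_function R H <= ((1 + f (nb_vertices H)) * m)%:E)%E].
Proof.
have tge H : (2 <= nb_vertices H)%N -> 0 <= target R H.
  by move=> h; apply: le_trans (target_ge R H); rewrite divr_ge0.
pose P n (e : R) := forall H, F H -> (chromatic_number H <= 4)%N -> nb_vertices H = n ->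
  (2 <= n)%N -> (extremal_function R H <= ((1 + e) * target R H)%:E)%E.
have mono n e e' : e <= e' -> P n e -> P n e'.
  move=> le h H FH chi cH n2; apply: le_trans (h H FH chi cH n2) _.
  by rewrite lee_fin ler_wpM2r ?lerD2l // tge // cH.
have ex n : exists e, 0 <= e /\ P n e.
  have [e [e0 he]] := extremal_upper_small R n.
  by exists e; split=> // H _; exact: he.
have lim e : 0 < e -> exists n0, forall n, (n0 <= n)%N -> P n e.
  move=> e0; have m0 : 0 < Num.min e 1 by rewrite lt_min e0 ltr01.
  have m1 : Num.min e 1 <= 1 by rewrite ge_min lexx orbT.
  have [n0 hn0] := extremal_upper_large hF m0 m1; exists n0 => n hn.
  apply: (mono n (Num.min e 1)); first by rewrite ge_min lexx.
  by move=> H FH chi cH _; apply: hn0 => //; rewrite cH.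
have [f [f1 f2 f3]] := error_function mono ex lim.
exists f; split=> //.
  by move=> n; apply: le_trans (f2 n); rewrite divr_ge0.
move=> H FH chi n2 /=; rewrite -/(target R H); split; last exact: f1.
apply: le_trans (extremal_lower R n2); rewrite lee_fin ler_wpM2r ?tge // lerD2l lerN2.
apply: le_trans (f2 _).
have n0 : 0 < (nb_vertices H)%:R :> R by rewrite ltr0n ltnW.
have n1 : 1 <= (nb_vertices H)%:R :> R by rewrite ler1n ltnW.
rewrite ler_pdivrMr // mulrAC ler_pdivlMr // -[_.+1%:R]natr1; clear -n1; lra.
Qed.
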